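(* Let $n,r\ge 1$, let $f_{l,i}\in\mathbb{R}[x_i]$ ($1\le l\le r$, $1\le i\le n$) and $g_j\in\mathbb{R}[x_j]$ ($1\le j\le n$) be univariate polynomials, let $f(\mathbf{x})=\sum_{l=1}^r\prod_{i=1}^n f_{l,i}(x_i)$, and let $$p^*=\inf\{f(\mathbf{x}) : \mathbf{x}\in\mathbb{R}^n,\ g_j(x_j)\ge 0,\ j=1,\dots,n\}=\inf\Big\{\sum_{l=1}^r t_{l,n} : \mathbf{x}\in\mathbb{R}^n,\ \mathbf{t}\in\mathbb{R}^{rn},\ h_{l,i}=0\ \forall l,i,\ g_j(x_j)\ge 0\ \forall j\Big\},$$ with $h_{l,i}$ the lifting constraints defined in the context. Let $I_1,\dots,I_N$ be the maximal cliques of a chordal extension of the graph $G_{r,n}$ (so that they admit a clique tree), with constraint assignments $J_a$, $H_a$ and splitting $\sum_{l=1}^r t_{l,n}=\sum_{a=1}^N f_a$ as in the context. For each relaxation order $k$, let $p^{\mathrm{LR}}_k$ and $\lambda^{\mathrm{LR}}_k$ be the optimal values of the moment relaxation and of the sum-of-squares relaxation defined in the context. Assume that there exist $R\in\mathbb{R}$ and polynomials $q_a\in\mathbb{R}[x_{I_a}]$, $a=1,\dots,N$, such that $$R^2-\|\mathbf{x}\|_2^2=\sum_{a=1}^N q_a(x_{I_a}),$$ where each $q_a$ belongs to the quadratic module generated by $\{g_j : j\in J_a\}$ in $\mathbb{R}[x_{I_a}]$. Then the sequences $(p^{\mathrm{LR}}_k)_k$ and $(\lambda^{\mathrm{LR}}_k)_k$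 are monotonically nondecreasing and $$p^{\mathrm{LR}}_k\uparrow p^*,\qquad \lambda^{\mathrm{LR}}_k\uparrow p^*\qquad\text{as } k\to\infty.$$
   Context: Lifting. Besides $\mathbf{x}=(x_1,\dots,x_n)$ introduce variables $\mathbf{t}=(t_{l,i})_{1\le l\le r,\,1\le i\le n}$ and the polynomials $$h_{l,1}=t_{l,1}-f_{l,1}(x_1),\qquad h_{l,i}=t_{l,i}-t_{l,i-1}f_{l,i}(x_i)\quad (2\le i\le n).$$ Graph. $G_{r,n}$ is the graph whose vertices are the $n(r+1)$ variables $x_i$, $t_{l,i}$, with two vertices adjacent iff they appear in the same constraint: for every $l$ the edge $t_{l,1}x_1$, and for every $l$ and $2\le i\le n$ the three edges $t_{l,i}t_{l,i-1}$, $t_{l,i}x_i$, $t_{l,i-1}x_i$. A chordal extension of $G_{r,n}$ is a chordal graph on the same vertex set containing all edges of $G_{r,n}$. Its maximal cliques $I_1,\dots,I_N$ satisfy the running intersection property, i.e. they can be arranged in a tree such that for each vertex the cliques containing it form a connected subtree. Write $x_{I_a}$ for the tuple of variables (both of type $x$ and of type $t$) in $I_a$, and $S_{ab}=I_a\cap I_b$. Assignments. Each $j\in\{1,\dots,n\}$ is assigned to one clique containing $x_j$; $J_a$ is the set of $j$ assigned to $I_a$. Each pair $(l,i)$ is assigned to one clique containing all variables of $h_{l,i}$; $H_a$ is the set of pairs assigned to $I_a$. Each term $t_{l,n}$ of the objective is assigned to one clique containing it; $f_a\in\mathbb{R}[x_{I_a}]$ is the sum of the terms assigned to $I_a$, so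 $\sum_{l}t_{l,n}=\sum_a f_a$. Put $d_j=\lceil \deg(g_j)/2\rceil$; relaxation orders are integers $k\ge 1$ with $k\ge\max_j d_j$. Moments. For a real sequence $y^{(a)}$ indexed by the monomials in $x_{I_a}$ of degree at most $2k$, $L_{y^{(a)}}$ is the linear functional on polynomials in $x_{I_a}$ of degree at most $2k$ sending each monomial to the corresponding entry of $y^{(a)}$. The moment matrix $M^{I_a}_k(y^{(a)})$ is indexed by monomials $u,v$ in $x_{I_a}$ of degree at most $k$ with $(u,v)$ entry $L_{y^{(a)}}(uv)$. The localizing matrix $M^{I_a}_{k-d_j}(g_jy^{(a)})$ is indexed by monomials $u,v$ of degree at most $k-d_j$ with $(u,v)$ entry $L_{y^{(a)}}(g_juv)$. $y^{(a)}|_{S_{ab}}$ is the restriction of $y^{(a)}$ to monomials in the variables of $S_{ab}$, and $y^{(a)}_0$ is the entry indexed by the monomial $1$. Moment relaxation: $p^{\mathrm{LR}}_k$ is the infimum of $\sum_{a=1}^N L_{y^{(a)}}(f_a)$ over $(y^{(a)})_{a=1}^N$ subject to: $M^{I_a}_k(y^{(a)})\succeq0$ for all $a$; $M^{I_a}_{k-d_j}(g_jy^{(a)})\succeq 0$ for all $a$ and $j\in J_a$; $L_{y^{(a)}}(q\,h_{l,i})=0$ for all $a$, $(l,i)\in H_a$ and monomials $q$ in $x_{I_a}$ with $\deg(q\,h_{l,i})<2k$; $y^{(a)}|_{S_{ab}}=y^{(b)}|_{S_{ab}}$ for all $a,b$; $y^{(a)}_0=1$ for all $a$. SOS relaxation: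 $\lambda^{\mathrm{LR}}_k$ is the supremum of $\lambda\in\mathbb{R}$ such that $$\sum_{a}f_a-\lambda-\sum_{a}\sum_{j\in J_a}\sigma_{a,j}g_j-\sum_a\sum_{(l,i)\in H_a}\tau_{a,l,i}h_{l,i}=\sum_a\sigma_{a,0},$$ where $\sigma_{a,0}=\mathbf{z}_{k,I_a}^{\top}Q_{a,0}\mathbf{z}_{k,I_a}$ and $\sigma_{a,j}=\mathbf{z}_{k-d_j,I_a}^{\top}Q_{a,j}\mathbf{z}_{k-d_j,I_a}$ with $Q_{a,0},Q_{a,j}\succeq0$, $\mathbf{z}_{m,I_a}$ is the vector of monomials in $x_{I_a}$ of degree at most $m$, and $\tau_{a,l,i}\in\mathbb{R}[x_{I_a}]$ with $\deg(\tau_{a,l,i}h_{l,i})<2k$. The quadratic module generated by $\{g_j: j\in J_a\}$ in $\mathbb{R}[x_{I_a}]$ is $\{s_0+\sum_{j\in J_a}s_jg_j : s_0,s_j \text{ sums of squares in }\mathbb{R}[x_{I_a}]\}$. Infima of empty sets are $+\infty$ and suprema of empty sets are $-\infty$. *)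

(* Defs.v *)
From HB Require Import structures.
From mathcomp Require Import all_boot all_order all_algebra.
From mathcomp Require Import boolp classical_sets reals constructive_ereal.
From mathcomp Require Import ereal topology normedtype sequences.
(* The notations of mpoly clash with those of MathComp-Analysis. *)
From mathcomp Require Import -(notations) mpoly.

Set Implicit Arguments.
Unset Strict Implicit.
Unset Printing Implicit Defensive.

Import Order.TTheory GRing.Theory Num.Theory.

Local Open Scope ring_scope.

(* Vertices: [inl i] stands for x_i and [inr (l, i)] for t_{l,i}. Indices start
   at 0, so x_1, ..., x_n of the mathematical text are x_0, ..., x_(n-1). *)
Definition vertex (r n : nat) : finType := ('I_n + 'I_r * 'I_n)%type.

Definition xv (r n : nat) (i : 'I_n) : vertex r n := inl i.
Definition tv (r n : nat) (l : 'I_r) (i : 'I_n) : vertex r n := inr (l, i).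
Arguments xv r {n} i.

Definition ord_last (n : nat) (hn : (0 < n)%N) : 'I_n :=
  Ordinal (eq_leq (prednK hn)).

Section Graphs.
Context {r n : nat}.
Local Notation V := (vertex r n).

(* The variables of the constraint h_{l,i}. For 0 < i, [ord_pred i] is i - 1. *)
Definition constraint_vars (l : 'I_r) (i : 'I_n) : {set V} :=
  if i == 0 :> nat then [set tv l i; xv r i]
  else [set tv l i; tv l (ord_pred i); xv r i].

Definition constraint_graph : rel V :=
  [rel u v | (u != v) &&
     [exists l : 'I_r, exists i : 'I_n,
       (u \in constraint_vars l i) && (v \in constraint_vars l i)]].
End Graphs.

Definition chordal (T : finType) (e : rel T) : Prop :=
  forall c : seq T, cycle e c -> uniq c -> (4 <= size c)%N ->
    exists u v : T, [/\ u \in c, v \in c, e u v, v != next c u & u != next c v].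

Definition chordal_extension (T : finType) (e e' : rel T) : Prop :=
  [/\ ssrbool.symmetric e', irreflexive e', subrel e e' & chordal e'].

Definition is_clique (T : finType) (e : rel T) (C : {set T}) : bool :=
  [forall u in C, forall v in C, (u != v) ==> e u v].

Definition enumerates_maximal_cliques (T : finType) (e : rel T) (N : nat)
    (I : 'I_N -> {set T}) : Prop :=
  injective I /\
  (forall C : {set T}, maxset (is_clique e) C <-> exists a : 'I_N, I a = C).

Section Polynomials.
Context {R : realType} {r n : nat}.
Local Notation V := (vertex r n).
Local Notation monomial := (multinom #|V|).
Local Notation poly_t := (mpoly #|V| R).

Definition var (v : V) : poly_t := mpolyX R (mnm1 (enum_rank v)).

Definition mon_in (I : {set V}) (m : monomial) : bool :=
  [forall v : V, (v \notin I) ==> (m (enum_rank v) == 0%N)].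

(* Membership in R[x_I]. *)
Definition poly_in (I : {set V}) (p : poly_t) : bool :=
  all (mon_in I) (msupp p).

(* deg p < d: [mmeasure mdeg p] is [msize p], that is 1 + deg p, or 0 if p = 0. *)
Definition deg_lt (p : poly_t) (d : nat) : bool :=
  (mmeasure (@mdeg #|V|) p <= d)%N.

(* p(x_i) *)
Definition univ (p : {poly R}) (i : 'I_n) : poly_t := horner_alg (var (xv r i)) p.

Definition lifting (f : 'I_r -> 'I_n -> {poly R}) (l : 'I_r) (i : 'I_n) : poly_t :=
  if i == 0 :> nat then var (tv l i) - univ (f l i) i
  else var (tv l i) - var (tv l (ord_pred i)) * univ (f l i) i.

(* The point with coordinates x and t. *)
Definition lifted_point (x : 'rV[R]_n) (t : 'M[R]_(r, n)) (i : 'I_#|V|) : R :=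
  match enum_val i with
  | inl j => x 0 j
  | inr (l, j) => t l j
  end.

Definition is_sos (I : {set V}) (s : poly_t) : Prop :=
  exists ps : seq poly_t, all (poly_in I) ps /\ s = \sum_(p <- ps) p ^+ 2.

Definition quadratic_module (g : 'I_n -> {poly R}) (I : {set V}) (J : {set 'I_n})
    (q : poly_t) : Prop :=
  exists (s0 : poly_t) (s : 'I_n -> poly_t),
    [/\ is_sos I s0, (forall j, j \in J -> is_sos I (s j))
      & q = s0 + \sum_(j in J) s j * univ (g j) j].

(* Monomials in x_I of degree at most d. *)
Definition bmon (I : {set V}) (d : nat) : finType :=
  {m : bmultinom #|V| d.+1 | mon_in I (bmnm m)}.

Definition bmon_val (I : {set V}) (d : nat) (u : bmon I d) : monomial :=
  bmnm (val u).

Lemma mon_in0 (I : {set V}) (d : nat) : mon_in I (bmnm (@bm0 #|V| d)).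
Proof. by apply/forallP => v; rewrite mnm0E eqxx implybT. Qed.

Definition bmon1 (I : {set V}) (d : nat) : bmon I d := exist _ bm0 (mon_in0 I d).

Definition riesz (I : {set V}) (d : nat) (y : bmon I d -> R) (p : poly_t) : R :=
  \sum_(u : bmon I d) mcoeff (bmon_val u) p * y u.

(* Matrices indexed by the monomials in x_I of degree at most m. *)
Local Notation monmx I m := 'M[R]_#|{: bmon I m}|.

Definition monvec (I : {set V}) (m : nat) : 'cV[poly_t]_#|{: bmon I m}| :=
  \col_u mpolyX R (bmon_val (enum_val u)).

Definition localizing_mx (I : {set V}) (d m : nat) (g : poly_t) (y : bmon I d -> R) :
    monmx I m :=
  \matrix_(u, v) riesz y (g * mpolyX R (bmon_val (enum_val u))
                            * mpolyX R (bmon_val (enum_val v))).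

Definition moment_mx (I : {set V}) (d m : nat) (y : bmon I d -> R) : monmx I m :=
  \matrix_(u, v) riesz y (mpolyX R (bmon_val (enum_val u))
                            * mpolyX R (bmon_val (enum_val v))).

Definition gram_poly (I : {set V}) (m : nat) (Q : monmx I m) : poly_t :=
  ((monvec I m)^T *m map_mx (@mpolyC #|V| R) Q *m monvec I m) 0 0.

End Polynomials.

Definition psd (R : realType) (m : nat) (A : 'M[R]_m) : Prop :=
  A^T = A /\ forall u : 'cV[R]_m, 0 <= (u^T *m A *m u) 0 0.

Definition half_deg (R : realType) (p : {poly R}) : nat := uphalf (size p).-1.

Section Problem.
Context {R : realType} {r n : nat}.
Variables (f : 'I_r -> 'I_n -> {poly R}) (g : 'I_n -> {poly R}).
Local Notation V := (vertex r n).
Local Notation poly_t := (mpoly #|V| R).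

Definition separable_fun (x : 'rV[R]_n) : R :=
  \sum_(l < r) \prod_(i < n) (f l i).[x 0 i].

Definition opt_value : \bar R :=
  ereal_inf [set (separable_fun x)%:E | x in
    [set x : 'rV[R]_n | forall j, 0 <= (g j).[x 0 j]]%classic]%classic.

Definition lifted_opt_value (hn : (0 < n)%N) : \bar R :=
  ereal_inf [set (\sum_(l < r) z.2 l (ord_last hn))%:E | z in
    [set z : 'rV[R]_n * 'M[R]_(r, n) |
      (forall l i, meval (lifted_point z.1 z.2) (lifting f l i) = 0) /\
      (forall j, 0 <= (g j).[z.1 0 j])]%classic]%classic.

Definition relaxation_order (k : nat) : Prop :=
  (1 <= k)%N /\ forall j, (half_deg (g j) <= k)%N.

Context {N : nat}.
Variables (I : 'I_N -> {set V}) (J : 'I_N -> {set 'I_n})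
  (H : 'I_N -> {set 'I_r * 'I_n}) (obj : 'I_N -> poly_t).

Definition moment_feasible (k : nat) (y : forall a : 'I_N, bmon (I a) (2 * k) -> R) :
    Prop :=
  [/\ (forall a, psd (moment_mx k (y a))),
      (forall a j, j \in J a ->
        psd (localizing_mx (k - half_deg (g j)) (univ (g j) j) (y a))),
      (forall a l i (q : multinom #|V|), (l, i) \in H a -> mon_in (I a) q ->
        deg_lt (mpolyX R q * lifting f l i) (2 * k) ->
        riesz (y a) (mpolyX R q * lifting f l i) = 0),
      (forall a b (w : bmon (I a :&: I b) (2 * k)) u v,
        bmon_val u = bmon_val w -> bmon_val v = bmon_val w -> y a u = y b v)
    & (forall a, y a (bmon1 (I a) (2 * k)) = 1)].

Definition moment_value (k : nat) : \bar R :=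
  ereal_inf [set (\sum_(a < N) riesz (y a) (obj a))%:E | y in
    @moment_feasible k]%classic.

Definition sos_feasible (k : nat) (lambda : R) : Prop :=
  exists (Q0 : forall a, 'M[R]_#|{: bmon (I a) k}|)
         (Q : forall a j, 'M[R]_#|{: bmon (I a) (k - half_deg (g j))}|)
         (tau : 'I_N -> 'I_r -> 'I_n -> poly_t),
    [/\ (forall a, psd (Q0 a)),
        (forall a j, j \in J a -> psd (Q a j)),
        (forall a l i, (l, i) \in H a ->
          poly_in (I a) (tau a l i) /\
          deg_lt (tau a l i * lifting f l i) (2 * k))
      & \sum_(a < N) obj a - mpolyC _ lambda
        - \sum_(a < N) \sum_(j in J a) gram_poly (Q a j) * univ (g j) j
        - \sum_(a < N) \sum_(li in H a) tau a li.1 li.2 * lifting f li.1 li.2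
        = \sum_(a < N) gram_poly (Q0 a)].

Definition sos_value (k : nat) : \bar R :=
  ereal_sup [set lambda%:E | lambda in sos_feasible k]%classic.

End Problem.

Definition assigned_to (A : finType) (N : nat) (s : A -> 'I_N) (a : 'I_N) : {set A} :=
  [set x | s x == a].

(* Main.v *)
(* Let M be the convex cone of all right-hand sides of the sum-of-squares
   relaxations. Each variable v satisfies c^m - v^(2m) in M for all m: for x_j
   because the ball identity restricts to a univariate certificate, for t_{l,i}
   inductively along the lifting equations. Consequently the closure of M
   contains the products p^2 (c - v^2) (c - w^2) ... over each clique, and with
   them every Bernstein polynomial whose variables lie in one clique.

   If lambda < p^*, adding penalties sigma_j g_j and Lambda h^2 to f - lambda
   gives a sum of clique polynomials which is positive on a box. It is the
   Bernstein operator applied to a sum of clique-local functions on a finite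
   grid that is nonnegative pointwise; as the graph is chordal, eliminating
   simplicial vertices by minimisation rewrites this sum with nonnegative
   clique-local terms. Hence f - lambda lies in M, which bounds both relaxations
   from below for large k; feasible points bound them from above. *)
Require Import Defs.
From HB Require Import structures.
From mathcomp Require Import all_boot all_order all_algebra.
From mathcomp Require Import boolp classical_sets reals constructive_ereal.
From mathcomp Require Import ereal topology normedtype sequences derive.
From mathcomp Require Import -(notations) mpoly.
From mathcomp Require Import ring lra zify.

Set Implicit Arguments.
Unset Strict Implicit.
Unset Printing Implicit Defensive.

Import Order.TTheory GRing.Theory Num.Theory.
Import numFieldNormedType.Exports.

Local Open Scope ring_scope.

(** * Chordal graphs and clique-local functions *)

(** The obstacle is that [M] is not a quadratic module: only squares from a single clique are
    available, g_j may be multiplied only by squares from its own clique, and the ball identity need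
    not split into a bound for each clique. Putinar's theorem therefore cannot be applied clique by
    clique. Single variables escape this: a univariate certificate for x_j involves nothing but x_j,
    so it fits into the clique to which g_j is assigned. The restriction to one variable needs
    values of the other x_i with g_i >= 0. If some g_i is negative everywhere, - g_i is a positive
    constant plus a sum of squares, and [M] contains the negatives of squares from the clique of
    g_i, which supply the bound directly. The Bernstein operator is chosen because it respects
    cliques and, with corrected coefficients, reproduces polynomials exactly. The only error is then
    in the coefficients; the positive margin on the box absorbs it and also pays for the passage
    from the closure back to [M]. *)

Section ChordalGraphs.
Variables (T : finType) (e : rel T).
Hypotheses (eC : ssrbool.symmetric e) (eI : irreflexive e) (eCh : chordal e).

Lemma cliqueP (C : {set T}) :
  reflect {in C &, forall u v, u != v -> e u v} (is_clique e C).
Proof.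
apply: (iffP forall_inP) => H u; last first.
  by move=> uC; apply/forall_inP => v vC; apply/implyP; apply: H.
by move=> v uC vC; have /forall_inP/(_ v vC)/implyP := H u uC.
Qed.

Lemma sub_clique (C D : {set T}) : C \subset D -> is_clique e D -> is_clique e C.
Proof.
by move=> /fintype.subsetP CD /cliqueP cD; apply/cliqueP => u v /CD uD /CD vD; apply: cD.
Qed.

Definition simplicial (U : {set T}) (u : T) : bool :=
  is_clique e [set w in U | e u w].

(** Index 0 of the list is [x], so [take i p] ends at the vertex of index [i], and
    [rcons (drop j.-1 p) y] starts at that of index [j]. *)
Lemma path_shortcut x p y i j :
    path e x (rcons p y) -> (i < j <= (size p).+1)%N ->
    e (nth x (x :: rcons p y) i) (nth x (x :: rcons p y) j) ->
  path e x (rcons (take i p ++ drop j.-1 p) y).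
Proof.
case: j => [|j]; first by rewrite ltn0.
move=> pth /andP[ij jp] /= eij.
rewrite rcons_cat cat_path.
have ip : (i <= size p)%N by lia.
have lastE : last x (take i p) = nth x (x :: rcons p y) i.
  case: i ip {eij ij} => [|i] ip /=; first by rewrite take0.
  rewrite (last_nth x) size_takel //= nth_rcons ip nth_take //.
have [pi pj] : path e x (take i p) /\ path e (nth x (rcons p y) j) (drop j.+1 (rcons p y)).
  split.
    move: pth; rewrite -{1}(cat_take_drop i (rcons p y)) cat_path => /andP[].
    by rewrite -cats1 takel_cat.
  move: pth; rewrite -{1}(cat_take_drop j.+1 (rcons p y)) cat_path => /andP[_].
  by rewrite (last_nth x) size_takel ?size_rcons //= nth_take.
rewrite pi /= lastE.
have -> : rcons (drop j p) y = drop j (rcons p y) by rewrite drop_rcons.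
by rewrite (drop_nth x) ?size_rcons //= eij pj.
Qed.

(** If [x] and [y] were not adjacent, a shortest path between them through [A] would close up with
    [v] to a cycle of length at least 4. A chord between path vertices would shorten the path, and a
    chord at [v] would end in [A], where [v] has no neighbour. *)
Lemma separator_clique (v x y a b : T) (A : {set T}) :
    v \notin A -> {in A, forall z, ~~ e v z} ->
    x \notin A -> y \notin A -> e v x -> e v y -> x != y ->
    a \in A -> b \in A -> e x a -> e y b ->
    (exists2 p, path e a p & last a p = b /\ all [in A] p) ->
  e x y.
Proof.
move=> vA vAn xA yA vx vy xy aA bA xa yb [p0 p0p [p0l p0A]].
apply/negPn/negP => nxy.
pose good n := [exists p : n.-tuple T, path e x (rcons p y) && all [in A] p].
have ex_good : exists n, good n.
  exists (size (a :: p0)); apply/existsP; exists (in_tuple (a :: p0)) => /=.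
  by rewrite rcons_path p0p p0l (eC b) yb xa aA p0A.
case: (ex_minnP ex_good) => m /existsP[[p /= /eqP sp] /andP[pp pA]] minm.
have {}minm q : path e x (rcons q y) -> all [in A] q -> (size p <= size q)%N.
  move=> qp qA; rewrite sp; apply: minm; apply/existsP; exists (in_tuple q).
  by rewrite /= qp qA.
set s := x :: rcons p y.
have ssz : size s = (size p).+2 by rewrite /= size_rcons.
have no_chord i j : (i.+1 < j < size s)%N -> ~~ e (nth x s i) (nth x s j).
  rewrite ssz => /andP[ij jp]; apply/negP => eij.
  have ij' : (i < j <= (size p).+1)%N by clear -ij jp; lia.
  have pA' : all [in A] (take i p ++ drop j.-1 p).
    rewrite all_cat; apply/andP; split; apply/allP => z zp; apply: (allP pA).
      exact: mem_take zp.
    exact: mem_drop zp.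
  have := minm _ (path_shortcut pp ij' eij) pA'.
  rewrite size_cat size_take size_drop; clear -ij jp; case: ltnP; lia.
have uniqs i j : (i < j < size s)%N -> nth x s i != nth x s j.
  rewrite ssz => /andP[ij jp]; apply/eqP => eqij.
  case: i => [|i] in ij eqij *.
    case: j => // j in ij jp eqij *; rewrite /= nth_rcons in eqij.
    case: ltnP eqij => [jp' xE|pj].
      by move/negP: xA; apply; rewrite xE; apply: (allP pA); rewrite mem_nth.
    by rewrite (_ : j == size p) => [/eqP|]; [rewrite (negPf xy) | clear -pj jp; lia].
  have : e (nth x s i) (nth x s i.+1).
    by move/(pathP x): pp; apply; rewrite size_rcons; clear -ij jp; lia.
  by rewrite eqij (negPf (no_chord i j _)) // ssz; clear -ij jp; lia.
have nA z : z \in s -> [|| z == x, z == y | z \in A].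
  rewrite inE mem_rcons inE; case/or3P => [->|->|zp] //; first by rewrite orbT.
  by rewrite (allP pA) ?orbT.
have vs : v \notin s.
  apply/negP => /nA /or3P[/eqP vE|/eqP vE|]; last by apply/negP.
    by rewrite vE eI in vx.
  by rewrite vE eI in vy.
have us : uniq s.
  apply/(uniqP x) => i j; rewrite !inE => si sj eqij; apply/eqP.
  case: ltngtP => // ij; [have := uniqs i j | have := uniqs j i];
    by rewrite eqij ij ?si ?sj eqxx => /(_ isT).
have pnil : (0 < size p)%N.
  by case: (p) pp => //=; rewrite (negPf nxy).
have [] := eCh (c := v :: s).
- by rewrite /= vx rcons_path pp last_rcons eC vy.
- by rewrite cons_uniq vs us.
- by change (size (v :: s)) with (size s).+1; rewrite ssz !ltnS.
suff ch u w : u \in v :: s -> w \in v :: s -> e u w -> w != next (v :: s) u ->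
     u != next (v :: s) w -> (index u (v :: s) < index w (v :: s))%N -> False.
  move=> u [w [uc wc euw n1 n2]].
  case: (ltngtP (index u (v :: s)) (index w (v :: s))) => [lt|lt|eq].
  - exact: (ch u w).
  - by apply: (ch w u) => //; rewrite eC.
  - by move: euw; rewrite -(nth_index v uc) eq nth_index // eI.
have indv : index v (v :: s) = 0 by rewrite [LHS]/= eqxx.
have inds z : z \in s -> index z (v :: s) = (index z s).+1.
  by move=> zs; rewrite [LHS]/=; case: eqP => // vz; rewrite vz zs in vs.
have nexts z : z \in v :: s -> next (v :: s) z = nth v s (index z (v :: s)).
  by move=> zc; rewrite next_nth zc.
move=> uc wc euw; rewrite !nexts //.
move: wc euw; rewrite [w \in _]in_cons => /predU1P[->|ws]; first by rewrite indv.
move: uc; rewrite in_cons => /predU1P[->|us']; rewrite ?indv !inds //.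
  move=> vw wx vn _.
  case/or3P: (nA w ws) => [/eqP wE|/eqP wE|wA]; first by rewrite wE eqxx in wx.
    have iy : index w s = (size p).+1.
      rewrite wE /s [LHS]/= (negPf xy) -cats1 index_cat.
      case: ifP => yp; first by move: yA; rewrite (allP pA _ yp).
      by rewrite /= eqxx addn0.
    by move: vn; rewrite iy nth_default ?eqxx // ssz.
  by move: vw; apply/negP/vAn.
move=> euw n1 n2; rewrite ltnS => lt.
have eu : u = nth x s (index u s) by rewrite nth_index.
have ew : w = nth x s (index w s) by rewrite nth_index.
have sw : (index w s < size s)%N by rewrite index_mem.
move: euw; rewrite eu ew; apply/negP; apply: no_chord.
rewrite sw andbT ltn_neqAle lt andbT; apply/eqP => eqi.
by move: n1; rewrite eqi nth_index // eqxx.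
Qed.

(* Dirac's argument: the neighbourhood of a component of the non-neighbours
   of v is a clique, so one may recurse into the component and its boundary. *)
Lemma simplicial_nonadjacent (U : {set T}) (v : T) :
    v \in U -> (exists2 w, w \in U & (w != v) && ~~ e v w) ->
  exists2 u, u \in U & [&& u != v, ~~ e v u & simplicial U u].
Proof.
move: {2}#|U| (leqnn #|U|) => k; elim: k U v => [|k IH] U v.
  by rewrite leqn0 cards_eq0 => /eqP ->; rewrite inE.
move=> Uk vU [w wU /andP[wv vw]].
pose W := [set a in U | (a != v) && ~~ e v a].
pose rr := [rel a b | [&& a \in W, b \in W & e a b]].
pose A := [set a in W | connect rr w a].
have wW : w \in W by rewrite inE wU wv.
have wA : w \in A by rewrite inE wW connect0.
have rrC : connect_sym rr.
  by apply: sym_connect_sym => a b /=; rewrite andbCA eC.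
have AP a : a \in A -> [/\ a \in U, a != v & ~~ e v a].
  by rewrite !inE => /andP[/and3P[]].
pose S := [set s in U | (s \notin A) && [exists a in A, e a s]].
have SP s : s \in S -> [/\ s \in U, s \notin A, e v s & exists2 a, a \in A & e a s].
  rewrite inE => /and3P[sU sA /exists_inP[a aA ea]]; split=> //; last by exists a.
  have [aU av va] := AP a aA.
  apply/negPn/negP => nvs; move/negP: sA; apply.
  have sW : s \in W.
    rewrite inE sU nvs andbT; apply/eqP => sv.
    by rewrite -sv eC ea in va.
  move: (aA); rewrite ![_ \in A]inE => /andP[aW wa].
  rewrite sW /=; apply: connect_trans wa _; apply: connect1.
  by rewrite /= aW sW ea.
have pathA a b : a \in A -> b \in A ->
    exists2 p, path e a p & last a p = b /\ all [in A] p.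
  rewrite ![_ \in A]inE => /andP[aW wa] /andP[bW wb].
  have /connectP[p pth ->] : connect rr a b.
    by apply: connect_trans wb; rewrite rrC.
  exists p; first by apply: sub_path pth => u z /= /and3P[].
  split=> //; elim: p a aW wa pth => //= z p IHp a aW wa /andP[raz pz].
  have zW : z \in W by case/and3P: raz.
  have wz : connect rr w z by apply: (connect_trans wa); apply: connect1.
  by rewrite inE zW wz /=; apply: IHp pz.
have cS : is_clique e S.
  apply/cliqueP => x y xS yS xy.
  have [xU xA vx [a aA ax]] := SP _ xS; have [yU yA vy [b bA byy]] := SP _ yS.
  apply: (@separator_clique v x y a b A) => //.
  - by apply/negP => /AP[_]; rewrite eqxx.
  - by move=> z /AP[].
  - by rewrite eC.
  - by rewrite eC.
  - exact: pathA.
pose U' := A :|: S.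
have vU' : v \notin U'.
  apply/negP; rewrite finset.in_setU => /orP[/AP[_]|/SP[_ _]]; first by rewrite eqxx.
  by rewrite eI.
have U'U : U' \subset U.
  by apply/fintype.subsetP => z; rewrite finset.in_setU => /orP[/AP[]|/SP[]].
have U'k : (#|U'| <= k)%N.
  rewrite -ltnS; apply: leq_trans Uk; apply: proper_card.
  by apply/fintype.properP; split=> //; exists v.
(* All neighbours in [U] of a vertex of [A] lie in [U'], so being simplicial in [U'] is enough. *)
suff [u uA su] : exists2 u, u \in A & simplicial U' u.
  have [uU uv vu] := AP u uA.
  exists u; rewrite ?uv ?vu //=; apply: sub_clique su.
  apply/fintype.subsetP => z; rewrite inE => /andP[zU euz].
  rewrite inE euz andbT finset.in_setU; case: (boolP (z \in A)) => //= zA.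
  by rewrite inE zU zA; apply/exists_inP; exists u.
have U'A a : a \in A -> a \in U' by move=> aA; rewrite finset.in_setU aA.
have U'S a : a \in S -> a \in U' by move=> aA; rewrite finset.in_setU aA orbT.
(* The induction hypothesis at [s] yields a simplicial vertex not adjacent to [s]. It avoids [S] if
   [s] is in the clique [S], and also if [s] is in [A] once every vertex of [S] is adjacent to all
   of [U']. If nobody has a non-neighbour in [U'], then [U'] is a clique and [w] will do. *)
case: (boolP [exists s in S, [exists z in U', (z != s) && ~~ e s z]]).
  move=> /exists_inP[s sS /exists_inP[z zU' Hz]].
  have [|u uU' /and3P[us esu sui]] := IH U' s U'k (U'S _ sS); first by exists z.
  exists u => //; move: uU'; rewrite finset.in_setU => /orP[//|uS].
  by move: esu; rewrite (cliqueP _ cS) // eq_sym.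
rewrite negb_exists_in => /forall_inP univ.
have {}univ s z : s \in S -> z \in U' -> z != s -> e s z.
  move=> sS zU' zs; move: (univ s sS); rewrite negb_exists_in => /forall_inP/(_ z zU').
  by rewrite zs negbK.
case: (boolP [exists s in A, [exists z in U', (z != s) && ~~ e s z]]).
  move=> /exists_inP[s sA /exists_inP[z zU' Hz]].
  have [|u uU' /and3P[us esu sui]] := IH U' s U'k (U'A _ sA); first by exists z.
  exists u => //; move: uU'; rewrite finset.in_setU => /orP[//|uS].
  by move: esu; rewrite eC univ ?U'A // eq_sym.
rewrite negb_exists_in => /forall_inP univA.
exists w => //; apply/cliqueP => a b; rewrite inE => /andP[aU' _].
rewrite inE => /andP[bU' _] ab.
move: aU'; rewrite finset.in_setU => /orP[aA|aS]; last by apply: univ; rewrite 1?eq_sym.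
move: (univA a aA); rewrite negb_exists_in => /forall_inP/(_ b bU').
by rewrite eq_sym ab negbK.
Qed.

Lemma exists_simplicial (U : {set T}) :
  U != finset.set0 -> exists2 u, u \in U & simplicial U u.
Proof.
case/finset.set0Pn => v vU.
case: (boolP [exists w in U, (w != v) && ~~ e v w]).
  case/exists_inP => w wU Hw.
  have [|u uU /and3P[_ _ su]] := @simplicial_nonadjacent U v vU; first by exists w.
  by exists u.
rewrite negb_exists_in => /forall_inP univ.
case: (boolP (is_clique e U)) => [cU|].
  by exists v => //; apply: sub_clique cU; apply/fintype.subsetP => z; rewrite inE => /andP[].
rewrite negb_forall_in => /exists_inP[a aU]; rewrite negb_forall_in.
case/exists_inP => b bU; rewrite negb_imply => ab.
have [|u uU /and3P[_ _ su]] := @simplicial_nonadjacent U a aU; last by exists u.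
by exists b => //; rewrite eq_sym.
Qed.

(** * Splitting a nonnegative sum of clique-local functions *)

Section Splitting.
Variables (R : realDomainType) (k : nat).
Local Notation grid := {ffun T -> 'I_k.+1}.

Definition local_on (C : {set T}) (phi : grid -> R) : Prop :=
  forall al be : grid, {in C, al =1 be} -> phi al = phi be.

(** The sets are not tied to an index family, since each elimination adds a term on the
    neighbourhood of the eliminated vertex. *)
Inductive local_sum (Q : {set T} -> (grid -> R) -> Prop) : (grid -> R) -> Prop :=
| local_sum0 Phi : (forall al, Phi al = 0) -> local_sum Q Phi
| local_sumD C phi Phi Phi' : Q C phi -> local_sum Q Phi ->
    (forall al, Phi' al = phi al + Phi al) -> local_sum Q Phi'.

Definition upd (al : grid) (v : T) (s : 'I_k.+1) : grid :=
  [ffun w => if w == v then s else al w].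

Definition min_val (F : 'I_k.+1 -> R) : R := F [arg min_(s < ord0) F s]%O.

Definition min_out (v : T) (phi : grid -> R) (al : grid) : R :=
  min_val (fun s => phi (upd al v s)).

Lemma min_out_le v phi al s : min_out v phi al <= phi (upd al v s).
Proof. by rewrite /min_out /min_val; case: arg_minP => // i _; apply. Qed.

Lemma min_out_attained v phi al : exists s, min_out v phi al = phi (upd al v s).
Proof. by eexists. Qed.

Lemma upd_id al v : upd al v (al v) = al.
Proof. by apply/ffunP => w; rewrite ffunE; case: eqP => // ->. Qed.

Lemma local_min_out v (C : {set T}) phi :
  local_on (v |: C) phi -> local_on C (min_out v phi).
Proof.
move=> loc al be eqC; congr min_val.
apply/funext => s; apply: loc => w; rewrite finset.in_setU1 !ffunE.
by case: eqP => //= _; apply: eqC.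
Qed.

Definition clique_local (U : {set T}) (C : {set T}) (phi : grid -> R) : Prop :=
  [/\ C \subset U, is_clique e C & local_on C phi].

Definition clique_nonneg (C : {set T}) (phi : grid -> R) : Prop :=
  [/\ is_clique e C, local_on C phi & forall al, 0 <= phi al].

Lemma sub_local (C D : {set T}) phi : C \subset D -> local_on C phi -> local_on D phi.
Proof.
by move=> /fintype.subsetP CD loc al be eqD; apply: loc => v /CD; apply: eqD.
Qed.

(** [A] collects the terms whose set contains [v]; such a set is a clique, so it consists of [v] and
    neighbours of [v]. *)
Lemma local_sum_splitv (U : {set T}) v Phi :
    v \in U -> local_sum (clique_local U) Phi ->
  exists A B, [/\ local_on (v |: [set w in U | e v w]) A,
    local_sum (clique_local (U :\ v)) B & forall al, Phi al = A al + B al].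
Proof.
move=> vU; elim=> [Ph Ph0|C phi Ph Ph' [CU cC lC] _ [A [B [lA sB PhE]]] Ph'E].
  exists (fun=> 0), (fun=> 0); split=> //; first by constructor.
  by move=> al; rewrite Ph0 addr0.
case: (boolP (v \in C)) => vC.
  exists (fun al => phi al + A al), B; split=> //; last first.
    by move=> al; rewrite Ph'E PhE addrA.
  move=> al be eqv; rewrite (lA al be) //; congr (_ + _); apply: lC => w wC.
  apply: eqv; rewrite finset.in_setU1 inE; case: (eqVneq w v) => //= wv.
  by rewrite (fintype.subsetP CU) // (cliqueP _ cC) // eq_sym.
exists A, (fun al => phi al + B al); split=> //; last first.
  by move=> al; rewrite Ph'E PhE addrCA.
apply: (local_sumD (C := C) _ sB) => //; split=> //.
apply/fintype.subsetP => w wC; rewrite !inE (fintype.subsetP CU) // andbT.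
by apply: contraNneq vC => <-.
Qed.

(* A simplicial vertex lies in a single maximal clique, so that it can be
   eliminated by minimising over its coordinate. *)
Lemma nonneg_local_split (U : {set T}) Phi :
    local_sum (clique_local U) Phi -> (forall al, 0 <= Phi al) ->
  local_sum clique_nonneg Phi.
Proof.
move: {2}#|U| (erefl #|U|) => m; elim: m U Phi => [|m IH] U Phi.
  (* With no vertex left, [Phi] is constant: a single nonnegative term on the empty clique. *)
  move=> /eqP; rewrite cards_eq0 => /eqP -> lP Phi0.
  apply: (local_sumD (C := finset.set0) (phi := Phi) (Phi := fun=> 0)).
  - split=> //; first by apply/cliqueP => u v; rewrite inE.
    elim: lP => [Ph Ph0|C phi Ph Ph' [C0 _ lC] _ IH Ph'E] al be eqv.
      by rewrite !Ph0.
    rewrite !Ph'E (IH al be) //; congr (_ + _); apply: lC => w /(fintype.subsetP C0).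
    by rewrite inE.
  - by constructor.
  - by move=> al; rewrite addr0.
move=> Um lP Phi0.
have [|v vU sv] := @exists_simplicial U; first by rewrite -card_gt0 Um.
have [A [B [lA lB PhE]]] := local_sum_splitv vU lP.
set N := [set w in U | e v w] in lA.
have cN : is_clique e (v |: N).
  apply/cliqueP => a b; rewrite !finset.in_setU1 => /orP[/eqP ->|aN] /orP[/eqP ->|bN].
  - by rewrite eqxx.
  - by move: bN; rewrite inE => /andP[].
  - by move: aN; rewrite inE eC => /andP[].
  - exact: (cliqueP _ sv).
pose M := min_out v A.
have lM : local_on N M by apply: local_min_out.
apply: (local_sumD (C := v |: N) (phi := fun al => A al - M al)
                   (Phi := fun al => M al + B al)).
- split=> //; last by move=> al; rewrite subr_ge0 -{2}(upd_id al v) min_out_le.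
  move=> al be eqv; rewrite (lA al be) // (lM al be) // => w wN.
  by apply: eqv; rewrite finset.in_setU1 wN orbT.
- apply: (IH (U :\ v)).
  + by move: Um; rewrite (cardsD1 v) vU => -[].
  + apply: (local_sumD (C := N) (phi := M) _ lB) => //; split=> //.
      apply/fintype.subsetP => w; rewrite !inE => /andP[-> vw].
    by rewrite andbT; apply: contraTneq vw => ->; rewrite eI.
  (* [B] does not depend on the coordinate [v], so at the minimiser [s] the value [M al + B al] is
     [Phi (upd al v s)]. *)
  + move=> al; have [s sE] := min_out_attained v A al.
    have -> : B al = B (upd al v s).
      elim: lB {PhE} => [Ph Ph0|C phi Ph Ph' [CU _ lC] _ IHB Ph'E]; first by rewrite !Ph0.
      rewrite !Ph'E IHB; congr (_ + _); apply: lC => w wC; rewrite ffunE.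
      case: eqP => // wv; move: (fintype.subsetP CU _ wC).
      by rewrite wv !inE eqxx.
    by rewrite /M sE -PhE.
- by move=> al; rewrite PhE addrA subrK.
Qed.

End Splitting.
End ChordalGraphs.

(** * Nonnegative univariate polynomials *)

Section UnivariateSos.
Variable R : realType.
Implicit Types p q : {poly R}.

Lemma horner_right_ge0 q (x0 : R) :
  (forall x, x0 < x -> 0 <= q.[x]) -> 0 <= q.[x0].
Proof.
move=> q0; rewrite leNgt; apply/negP => qlt.
have : \forall x \near x0, q.[x] < 0.
  exact: (cvgr_lt q.[x0] (@continuous_horner R q x0) _ qlt).
move=> /nbhs_ballP[e /= e0 He].
have : q.[x0 + e / 2] < 0.
  apply: He; rewrite /ball /= opprD addNKr normrN gtr0_norm; lra.
by apply/negP; rewrite -leNgt; apply: q0; lra.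
Qed.

Lemma horner_left_le0 q (x0 : R) :
  (forall x, x < x0 -> q.[x] <= 0) -> q.[x0] <= 0.
Proof.
move=> q0; rewrite -oppr_ge0 -[X in - q.[X]]opprK.
have -> : - q.[- - x0] = (- (q \Po (- 'X))).[- x0] by rewrite hornerN horner_comp !hornerE.
apply: horner_right_ge0 => x xx; rewrite hornerN horner_comp !hornerE oppr_ge0.
by apply: q0; lra.
Qed.

Lemma horner_coercive p (A : R) : (1 < size p)%N ->
  exists2 B, 0 < B & forall x, B <= `|x| -> A <= `|p.[x]|.
Proof.
elim/poly_ind: p A => [|p c IH] A; first by rewrite size_poly0.
rewrite -cons_poly_def size_cons_poly; case: ifP => [/andP[/nilP]|] //.
move=> _; rewrite ltnS => sp.
have [B B0 HB] : exists2 B, 0 < B & forall x, B <= `|x| -> `|A| + `|c| <= `|p.[x]| * `|x|.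
  case: (ltnP 1 (size p)) => sp1.
    have [B B0 HB] := IH (`|A| + `|c|) sp1; exists (1 + B); first lra.
    move=> x Bx; have := HB x; have := normr_ge0 p.[x].
    have := normr_ge0 A; have := normr_ge0 c; nra.
  have /size_poly1P[d d0 ->] : size p == 1 by rewrite eqn_leq sp1.
  have d1 : 0 < `|d| by rewrite normr_gt0.
  exists (1 + (`|A| + `|c|) / `|d|).
    have : 0 <= (`|A| + `|c|) / `|d| by rewrite divr_ge0 // addr_ge0.
    lra.
  move=> x xB; rewrite hornerC mulrC -ler_pdivrMr //; lra.
exists B => // x /HB; rewrite cons_poly_def !hornerE -normrM => H.
have := ler_norm A; have := ler_normB (p.[x] * x + c) c.
rewrite addrK; lra.
Qed.

Lemma nonneg_horner_min p : (1 < size p)%N -> (forall x, 0 <= p.[x]) ->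
  exists x0, forall x, p.[x0] <= p.[x].
Proof.
move=> sp p0; have [B B0 HB] := horner_coercive p.[0] sp.
have [||c _ Hc] := @EVT_min R (horner p) (- B) B; first lra.
  by apply: continuous_subspaceT => x; apply: continuous_horner.
have in0 : 0 \in `[- B, B] by rewrite in_itv /=; apply/andP; split; lra.
exists c => x; case: (lerP B `|x|) => xB; last first.
  by apply: Hc; rewrite in_itv /= -ler_norml ltW.
by apply: (le_trans (Hc 0 in0)); rewrite -[leRHS]ger0_norm // HB.
Qed.

(* Subtracting the minimum of p leaves a double root, and the quotient by
   (X - x0)^2 is again nonnegative. *)
Lemma nonneg_poly_sos p : (forall x, 0 <= p.[x]) ->
  exists x0 (s : seq {poly R}), p = p.[x0]%:P + \sum_(q <- s) q ^+ 2.
Proof.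
move: {2}(size p) (leqnn (size p)) => k; elim: k p => [|k IH] p.
  by rewrite leqn0 size_poly_eq0 => /eqP -> _; exists 0, [::]; rewrite big_nil horner0 addr0.
move=> spk p0; case: (leqP (size p) 1) => sp1.
  by exists 0, [::]; rewrite big_nil addr0 (size1_polyC sp1) hornerC.
have [x0 Hx0] := nonneg_horner_min sp1 p0.
have : root (p - p.[x0]%:P) x0 by rewrite /root !hornerE subrr.
case/factor_theorem => q qE.
have qx x : p.[x] - p.[x0] = q.[x] * (x - x0).
  by have := congr1 (horner^~ x) qE; rewrite !hornerE.
(* [q.[x] * (x - x0)] is nonnegative, so [q] changes sign at [x0]. *)
have root_q : root q x0.
  rewrite /root eq_le; apply/andP; split.
    apply: horner_left_le0 => x xx; have := Hx0 x; rewrite -subr_ge0 qx; nra.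
  apply: horner_right_ge0 => x xx; have := Hx0 x; rewrite -subr_ge0 qx; nra.
have [q2 q2E] := factor_theorem _ _ root_q.
have pE : p = p.[x0]%:P + ('X - x0%:P) ^+ 2 * q2.
  by rewrite -[LHS](subrK p.[x0]%:P) qE q2E; ring.
have q2x x : p.[x] - p.[x0] = (x - x0) ^+ 2 * q2.[x].
  by rewrite qx q2E !hornerE; ring.
have q20 x : 0 <= q2.[x].
  have pos y : x0 < y -> 0 <= q2.[y].
    move=> xy; have := Hx0 y; rewrite -subr_ge0 q2x pmulr_rge0 //.
    by rewrite exprn_gt0 // subr_gt0.
  case: (ltgtP x0 x) => [/pos //|xx|<-]; last exact: horner_right_ge0.
  have := Hx0 x; rewrite -subr_ge0 q2x pmulr_rge0 //.
  by rewrite lt_def sqrf_eq0 sqr_ge0 subr_eq0 lt_eqF.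
have q2k : (size q2 <= k)%N.
  case: (eqVneq q2 0) => [->|q2n]; first by rewrite size_poly0.
  have sq : (size q <= k)%N.
    have sq1 : size (p - p.[x0]%:P) = size p.
      by rewrite size_polyDl // size_polyN (leq_ltn_trans (size_polyC_leq1 _)).
    have qn : q != 0.
      apply: contraNneq q2n => q0; move/esym/eqP: q2E.
      by rewrite q0 mulf_eq0 polyXsubC_eq0 orbF.
    have := size_Mmonic qn (monicXsubC x0).
    by rewrite -qE sq1 size_XsubC addn2 /= => sE; rewrite -ltnS -sE.
  have := size_Mmonic q2n (monicXsubC x0).
  by rewrite -q2E size_XsubC addn2 /= => sE; rewrite ltnW // -sE.
have [x1 [s sE]] := IH q2 q2k q20.
have : Num.sqrt q2.[x1] ^+ 2 = q2.[x1] by rewrite sqr_sqrtr.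
move: (Num.sqrt q2.[x1]) => a a2; rewrite -a2 in sE.
exists x0, (('X - x0%:P) * a%:P :: [seq ('X - x0%:P) * r | r <- s]).
rewrite [LHS]pE sE big_cons big_map mulrDr polyC_exp -exprMn.
by congr (_ + (_ + _)); rewrite big_distrr /=; apply: eq_bigr => r _; rewrite exprMn.
Qed.

(** The constant split off by [nonneg_poly_sos] is a value of [p], hence positive here. Applied to -
    g_j, this margin turns an infeasible constraint into negatives of squares. *)
Lemma pos_poly_sos p : (forall x, 0 < p.[x]) ->
  exists2 eps, 0 < eps & exists s : seq {poly R}, p = eps%:P + \sum_(q <- s) q ^+ 2.
Proof.
move=> p0; have [x|x0 [s sE]] := @nonneg_poly_sos p; first exact: ltW.
by exists p.[x0] => //; exists s.
Qed.

End UnivariateSos.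

(** * Bernstein coefficients *)

Section UniformlyClose.
Variables (R : realType) (A : nat -> Type).
Implicit Types X Y : forall d, A d -> R.

(** The bound on [Y] is included to make the relation stable under products. The type [A d] will be
    a grid of mesh 1 / d. *)
Definition uclose X Y : Prop :=
  (exists B, forall d a, `|Y d a| <= B) /\
  (forall eps, 0 < eps -> exists d0, forall d a, (d0 <= d)%N -> `|X d a - Y d a| <= eps).

Lemma uclose_eq X Y X' Y' : (forall d a, X d a = X' d a) -> (forall d a, Y d a = Y' d a) ->
  uclose X Y -> uclose X' Y'.
Proof.
move=> eX eY [[B HB] H]; split; first by exists B => d a; rewrite -eY.
by move=> eps /H[d0 Hd]; exists d0 => d a; rewrite -eX -eY; apply: Hd.
Qed.

Lemma uclose_cst (c : R) : uclose (fun _ _ => c) (fun _ _ => c).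
Proof.
split; first by exists `|c|.
by move=> eps e0; exists 0 => d a _; rewrite subrr normr0 ltW.
Qed.

Lemma ucloseD X Y X' Y' : uclose X Y -> uclose X' Y' ->
  uclose (fun d a => X d a + X' d a) (fun d a => Y d a + Y' d a).
Proof.
move=> [[B HB] H] [[B' HB'] H']; split.
  by exists (B + B') => d a; rewrite (le_trans (ler_normD _ _)) // lerD.
move=> eps e0; have e2 : 0 < eps / 2 by lra.
have [d0 Hd] := H _ e2; have [d1 Hd'] := H' _ e2.
exists (maxn d0 d1) => d a; rewrite geq_max => /andP[h0 h1].
rewrite opprD addrACA (le_trans (ler_normD _ _)) //.
have := Hd d a h0; have := Hd' d a h1; lra.
Qed.

Lemma ucloseM X Y X' Y' : uclose X Y -> uclose X' Y' ->
  uclose (fun d a => X d a * X' d a) (fun d a => Y d a * Y' d a).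
Proof.
move=> [[B HB] H] [[B' HB'] H']; split.
  exists (`|B| * `|B'|) => d a; rewrite normrM ler_pM //.
    exact: le_trans (HB d a) (ler_norm _).
  exact: le_trans (HB' d a) (ler_norm _).
move=> eps e0; pose K := 1 + `|B| + `|B'|.
have K0 : 0 < K by rewrite /K; have := normr_ge0 B; have := normr_ge0 B'; lra.
have [e' [e'0 e'1 e'K]] : exists e', [/\ 0 < e', e' <= 1 & e' * K <= eps].
  exists (Num.min 1 (eps / K)); split.
  - by rewrite lt_min ltr01 divr_gt0.
  - by rewrite ge_min lexx.
  - by rewrite -ler_pdivlMr // ge_min lexx orbT.
have [d0 Hd] := H _ e'0; have [d1 Hd'] := H' _ e'0.
exists (maxn d0 d1) => d a; rewrite geq_max => /andP[h0 h1].
have -> : X d a * X' d a - Y d a * Y' d a =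
   (X d a - Y d a) * (X' d a - Y' d a) + (X d a - Y d a) * Y' d a
   + Y d a * (X' d a - Y' d a) by ring.
apply: le_trans e'K; rewrite /K [leRHS]mulrDr [e' * (1 + _)]mulrDr mulr1.
have T1 : `|(X d a - Y d a) * (X' d a - Y' d a)| <= e'.
  by rewrite normrM -[leRHS]mulr1 ler_pM // ?Hd // (le_trans (Hd' d a h1)).
have T2 : `|(X d a - Y d a) * Y' d a| <= e' * `|B'|.
  by rewrite normrM ler_pM ?Hd // (le_trans (HB' d a)) // ler_norm.
have T3 : `|Y d a * (X' d a - Y' d a)| <= e' * `|B|.
  by rewrite normrM mulrC ler_pM ?Hd' // (le_trans (HB d a)) // ler_norm.
apply: (le_trans (ler_normD _ _)); rewrite [leRHS]addrAC.
by apply: (lerD _ T3); apply: (le_trans (ler_normD _ _)); apply: lerD.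
Qed.

Lemma uclose_sum (J : Type) (s : seq J) (F G : J -> forall d, A d -> R) :
    (forall j, uclose (F j) (G j)) ->
  uclose (fun d a => \sum_(j <- s) F j d a) (fun d a => \sum_(j <- s) G j d a).
Proof.
move=> H; elim: s => [|j s IH].
  by apply: uclose_eq (uclose_cst 0) => d a; rewrite big_nil.
by apply: uclose_eq (ucloseD (H j) IH) => d a; rewrite big_cons.
Qed.

Lemma uclose_prod (J : Type) (s : seq J) (F G : J -> forall d, A d -> R) :
    (forall j, uclose (F j) (G j)) ->
  uclose (fun d a => \prod_(j <- s) F j d a) (fun d a => \prod_(j <- s) G j d a).
Proof.
move=> H; elim: s => [|j s IH].
  by apply: uclose_eq (uclose_cst 1) => d a; rewrite big_nil.
by apply: uclose_eq (ucloseM (H j) IH) => d a; rewrite big_cons.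
Qed.

End UniformlyClose.

Lemma uclose_comp (R : realType) (A A' : nat -> Type) (h : forall d, A' d -> A d)
    (X Y : forall d, A d -> R) :
  uclose X Y -> uclose (fun d a => X d (h d a)) (fun d a => Y d (h d a)).
Proof.
move=> [[B HB] H]; split; first by exists B => d a; apply: HB.
by move=> eps /H[d0 Hd]; exists d0 => d a; apply: Hd.
Qed.

Section Bernstein.
Variable R : realType.

Definition bern_ratio (d i j : nat) : R := 'C(i, j)%:R / 'C(d, j)%:R.

(* Sampling q at i / d would reproduce q only approximately under the Bernstein
   operator; replacing (i / d)^j by C(i, j) / C(d, j) makes it exact
   (bern_coef_sum) and is a uniformly small perturbation (uclose_bern_coef). *)
Definition bern_coef (q : {poly R}) (d i : nat) : R :=
  \sum_(j < size q) q`_j * bern_ratio d i j.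

(** The ratio is the product of the (i - s) / (d - s) for s < j, each close to i / d. Truncated
    subtraction and division by 0 agree on both sides in the degenerate cases. *)
Lemma bern_ratioS d i j :
  bern_ratio d i j.+1 = bern_ratio d i j * ((i - j)%:R / (d - j)%:R).
Proof.
have E k : 'C(k, j.+1)%:R = (k - j)%:R * 'C(k, j)%:R / j.+1%:R :> R.
  apply: (@mulIf _ j.+1%:R); first by rewrite pnatr_eq0.
  by rewrite divfK ?pnatr_eq0 // -!natrM mulnC mul_bin_left.
by rewrite /bern_ratio !E invf_div mulrA divfK ?pnatr_eq0 // -mulf_div mulrC.
Qed.

Lemma uclose_ratio1 (j : nat) :
  uclose (fun d (i : 'I_d.+1) => (i - j)%:R / (d - j)%:R : R)
         (fun d (i : 'I_d.+1) => i%:R / d%:R).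
Proof.
split.
  exists 1 => d i; rewrite ger0_norm ?divr_ge0 //.
  have : (i <= d)%N by rewrite -ltnS.
  case: (posnP d) (nat_of_ord i) => [->|d0] k kd; first by rewrite invr0 mulr0.
  by rewrite ler_pdivrMr ?ltr0n // mul1r ler_nat.
(* Both cases below bound the difference by j / (d - j); the threshold makes this at most [eps]. *)
move=> eps e0; exists (j + (Num.truncn (j%:R / eps)).+1)%N => d i dd.
have jd : (j < d)%N by clear -dd; lia.
have id : (i <= d)%N by rewrite -ltnS.
have dj : j%:R / (d - j)%:R <= eps.
  rewrite ler_pdivrMr ?ltr0n ?subn_gt0 // mulrC -ler_pdivrMr //.
  apply: ltW; apply: lt_le_trans (truncnS_gt _) _.
  by rewrite ler_nat leq_subRL // ltnW.
apply: le_trans dj.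
have d0 : 0 < d%:R :> R by rewrite ltr0n (leq_ltn_trans _ jd).
have dj0 : 0 < d%:R - j%:R :> R by rewrite subr_gt0 ltr_nat.
rewrite [(d - j)%:R]natrB; last exact: ltnW.
case: (leqP j i) => ji.
  rewrite natrB //.
  have -> : (i%:R - j%:R) / (d%:R - j%:R) - i%:R / d%:R
     = - (j%:R * (d%:R - i%:R) / d%:R / (d%:R - j%:R)) :> R.
    by field; rewrite !gt_eqF.
  rewrite normrN ger0_norm; last first.
    by rewrite !divr_ge0 ?(ltW dj0) ?mulr_ge0 // subr_ge0 ler_nat.
  rewrite ler_pM2r ?invr_gt0 // ler_pdivrMr // ler_wpM2l //.
  by rewrite gerBl.
have -> : (i - j)%N = 0%N by clear -ji; lia.
rewrite mul0r sub0r normrN ger0_norm ?divr_ge0 //.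
apply: ler_pM => //; rewrite ?invr_ge0 ?(ltW d0) // ?ler_nat ?(ltnW ji) //.
by rewrite lef_pV2 ?posrE // gerBl.
Qed.

Lemma uclose_bern_coef q :
  uclose (fun d (i : 'I_d.+1) => bern_coef q d i)
         (fun d (i : 'I_d.+1) => q.[i%:R / d%:R]).
Proof.
apply: uclose_eq (uclose_sum _ _) => [d a|d a|j]; first by [].
  by rewrite horner_coef.
apply: ucloseM; first exact: uclose_cst.
elim: (nat_of_ord j) => [|k IH].
  apply: uclose_eq (uclose_cst _ 1) => d a; last by rewrite expr0.
  by rewrite /bern_ratio !bin0 divr1.
apply: uclose_eq (ucloseM IH (uclose_ratio1 k)) => d a; last by rewrite exprSr.
by rewrite bern_ratioS.
Qed.

Variable P : comNzRingType.
Variable C : {rmorphism R -> P}.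

Definition bern (w : P) (d i : nat) : P := w ^+ i * (1 - w) ^+ (d - i) *+ 'C(d, i).

Lemma bin_trinomial d i j : (j <= i <= d)%N ->
  ('C(i, j) * 'C(d, i) = 'C(d, j) * 'C(d - j, i - j))%N.
Proof.
move=> /andP[ji id].
have := bin_fact ji; have := bin_fact id; have := bin_fact (leq_trans ji id).
have := bin_fact (leq_sub2r j id).
have -> : (d - j - (i - j) = d - i)%N by clear -ji id; lia.
move: 'C(i, j) 'C(d, i) 'C(d, j) 'C(_, _) => a b c e E1 E2 E3 E4.
have fpos : (0 < j`! * (i - j)`! * (d - i)`!)%N by rewrite !muln_gt0 !fact_gt0.
apply/eqP; rewrite -(eqn_pmul2r fpos); apply/eqP.
transitivity d`!; first by rewrite -E3 -E4; ring.
by rewrite -E2 -E1; ring.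
Qed.

(** By [bin_trinomial], the term of index i >= j is w^j times the term of index i - j in the
    binomial expansion of ((1 - w) + w)^(d - j) = 1; the terms with i < j vanish. *)
Lemma bern_ratio_sum (w : P) d j : (j <= d)%N ->
  \sum_(i < d.+1) C (bern_ratio d i j) * bern w d i = w ^+ j.
Proof.
move=> jd.
have cj : 'C(d, j)%:R != 0 :> R by rewrite pnatr_eq0 -lt0n bin_gt0.
rewrite -(big_mkord xpredT (fun i => C (bern_ratio d i j) * bern w d i)).
rewrite (@big_cat_nat _ _ _ j) //=; last by rewrite leqW.
rewrite big1_seq ?add0r => [|i]; last first.
  rewrite mem_index_iota => /andP[_ /andP[_ ij]].
  by rewrite /bern_ratio bin_small // mul0r rmorph0 mul0r.
rewrite -{1}(add0n j) big_addn subSn // big_mkord.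
rewrite -[RHS]mulr1 -[X in _ = _ * X](expr1n _ (d - j)) -[X in _ = _ * X ^+ _](subrK w) exprDn.
rewrite big_distrr; apply: eq_bigr => k _ /=.
have kd : (k + j <= d)%N by have := ltn_ord k; clear -jd; lia.
rewrite /bern -[_ *+ 'C(d, _)]mulr_natr -[_ *+ 'C(d - j, _)]mulr_natr.
have -> : C (bern_ratio d (k + j) j) * ((w ^+ (k + j) * (1 - w) ^+ (d - (k + j))) * 'C(d, k + j)%:R)
  = C (bern_ratio d (k + j) j * 'C(d, k + j)%:R) * (w ^+ (k + j) * (1 - w) ^+ (d - (k + j))).
  by rewrite rmorphM rmorph_nat; ring.
have -> : bern_ratio d (k + j) j * 'C(d, k + j)%:R = 'C(d - j, k)%:R.
  rewrite /bern_ratio mulrAC -natrM bin_trinomial ?leq_addl // addnK natrM mulrAC.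
  by rewrite divff // mul1r.
rewrite rmorph_nat addnC subnDA exprD; ring.
Qed.

Lemma bern_coef_sum (q : {poly R}) (w : P) d : (size q <= d.+1)%N ->
  \sum_(i < d.+1) C (bern_coef q d i) * bern w d i = (map_poly C q).[w].
Proof.
move=> qd; rewrite (horner_coef_wide _ (size_poly _ _)).
under eq_bigr => i _.
  rewrite /bern_coef rmorph_sum big_distrl /=.
  under eq_bigr => j _ do rewrite rmorphM -mulrA.
  over.
rewrite exchange_big /=; apply: eq_bigr => j _.
rewrite -big_distrr bern_ratio_sum ?coef_map //.
by rewrite -ltnS (leq_trans (ltn_ord j)).
Qed.

End Bernstein.

(** * Convex cones and their multipliers *)

Section Cones.
Variables (R : realType) (P : comNzRingType) (C : {rmorphism R -> P}).
Variable M : P -> Prop.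
Hypothesis MD : forall p q, M p -> M q -> M (p + q).
Hypothesis MZ : forall c p, 0 <= c -> M p -> M (C c * p).
Hypothesis MC : forall c, 0 <= c -> M (C c).

Definition cone_closure (p : P) : Prop := forall eps, 0 < eps -> M (p + C eps).

(* Bounding all powers at once makes the notion stable under products: M need
   not be closed under multiplication by squares, so that a bound on p ^+ 2 alone
   would be of no use. *)
Definition power_bounded (c : R) (p : P) : Prop :=
  forall m, M (C (c ^+ m) - p ^+ (2 * m)).

Lemma cone_closureW p : M p -> cone_closure p.
Proof. by move=> Mp eps e0; apply: MD => //; apply: MC; apply: ltW. Qed.

Lemma cone_closureD p q : cone_closure p -> cone_closure q -> cone_closure (p + q).
Proof.
move=> Hp Hq eps e0; rewrite (splitr eps) rmorphD addrACA.
by apply: MD; [apply: Hp|apply: Hq]; lra.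
Qed.

Lemma cone_closureZ c p : 0 <= c -> cone_closure p -> cone_closure (C c * p).
Proof.
rewrite le_eqVlt => /predU1P[<- _|c0 Hp] eps e0.
  by rewrite rmorph0 mul0r add0r; apply: MC; apply: ltW.
have -> : C c * p + C eps = C c * (p + C (eps / c)).
  by rewrite mulrDr -rmorphM mulrCA divff ?gt_eqF // mulr1.
by apply: MZ; [exact: ltW|apply: Hp; rewrite divr_gt0].
Qed.

(** Division by [m.+1] makes the constant arbitrarily small, because [K] does not depend on [m]. *)
Lemma cone_closure_limit p (K : R) :
  (forall m : nat, cone_closure (C m.+1%:R * p + C K)) -> cone_closure p.
Proof.
move=> H eps e0; pose m := Num.truncn (`|K| / eps).
have m1 : 0 < m.+1%:R :> R by rewrite ltr0n.
have Hm : `|K| < eps * m.+1%:R by rewrite mulrC -ltr_pdivrMr // truncnS_gt.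
have K' : 0 < eps * m.+1%:R - K by have := ler_norm K; lra.
have -> : p + C eps = C m.+1%:R^-1 * (C m.+1%:R * p + C K + C (eps * m.+1%:R - K)).
  rewrite -addrA -rmorphD addrC [K + _]addrC subrK.
  rewrite mulrDr mulrA -!rmorphM mulVf ?gt_eqF // rmorph1 mul1r.
  by rewrite mulrCA mulVf ?gt_eqF // mulr1 addrC.
by apply: MZ; [rewrite invr_ge0 ltW | apply: H].
Qed.

Lemma power_bounded_le c d p : 0 <= c -> c <= d -> power_bounded c p -> power_bounded d p.
Proof.
move=> c0 cd H m; rewrite -[d ^+ m](subrK (c ^+ m)) rmorphD -addrA.
by apply: MD (H m); apply: MC; rewrite subr_ge0 lerXn2r // nnegrE // (le_trans c0).
Qed.

(** * Bounds and multipliers over a subring whose squares lie in the cone *)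

Section Subring.
Variable S : P -> Prop.
Hypothesis SC : forall c, S (C c).
Hypothesis SD : forall p q, S p -> S q -> S (p + q).
Hypothesis SM : forall p q, S p -> S q -> S (p * q).
Hypothesis Msq : forall p, S p -> M (p ^+ 2).

Lemma subringN p : S p -> S (- p).
Proof. by move=> Sp; rewrite -mulN1r -(rmorph1 C) -rmorphN; apply: SM. Qed.

Lemma subring1 : S 1. Proof. by rewrite -(rmorph1 C). Qed.

Lemma subringX p m : S p -> S (p ^+ m).
Proof.
move=> Sp; elim: m => [|m IH]; first by rewrite expr0; apply: subring1.
by rewrite exprS; apply: SM.
Qed.

Lemma subringB p q : S p -> S q -> S (p - q).
Proof. by move=> Sp Sq; apply: SD => //; apply: subringN. Qed.

(** Weighted inequality 2 x y <= t x^2 + y^2 / t for x = p^(2m) and y = q^(2m). The weight t = (d /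
    c)^m makes both terms on the right at most (c d)^m. The bounds on [p] and [q] are used at the
    exponent [2 * m]. *)
Lemma power_boundedM c d p q : 0 < c -> 0 < d -> S p -> S q ->
  power_bounded c p -> power_bounded d q -> power_bounded (c * d) (p * q).
Proof.
move=> c0 d0 Sp Sq Hp Hq m.
pose t := d ^+ m / c ^+ m; have t0 : 0 < t by rewrite divr_gt0 ?exprn_gt0.
have cm0 : c ^+ m != 0 by rewrite gt_eqF ?exprn_gt0.
have dm0 : d ^+ m != 0 by rewrite gt_eqF ?exprn_gt0.
have e1 : C (t / 2) * C (c ^+ (2 * m)) = C ((c * d) ^+ m / 2).
  rewrite -rmorphM; congr (C _); rewrite /t mulnC exprM exprMn.
  by move: (c ^+ m) (d ^+ m) cm0 => x y x0; field.
have e2 : C (t^-1 / 2) * C (d ^+ (2 * m)) = C ((c * d) ^+ m / 2).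
  rewrite -rmorphM; congr (C _); rewrite /t mulnC exprM exprMn.
  by move: (c ^+ m) (d ^+ m) cm0 dm0 => x y x0 y0; field; rewrite x0 y0.
have e3 : C (t / 2) * C t^-1 = C (1 / 2).
  by rewrite -rmorphM; congr (C _); rewrite mulrAC divff ?gt_eqF.
have e4 : C (1 / 2) * C t^-1 = C (t^-1 / 2) by rewrite -rmorphM; congr (C _); ring.
have e5 : C (1 / 2) + C (1 / 2) = 1 by rewrite -rmorphD -splitr rmorph1.
have -> : C ((c * d) ^+ m) - (p * q) ^+ (2 * m) =
    C (t / 2) * (C (c ^+ (2 * m)) - p ^+ (2 * (2 * m)))
  + (C (t^-1 / 2) * (C (d ^+ (2 * m)) - q ^+ (2 * (2 * m)))
  + C (t / 2) * (p ^+ (2 * m) - C t^-1 * q ^+ (2 * m)) ^+ 2).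
  have sq y : y ^+ (2 * (2 * m)) = (y ^+ (2 * m)) ^+ 2 by rewrite mulnC exprM.
  have -> : C ((c * d) ^+ m) = C ((c * d) ^+ m / 2) + C ((c * d) ^+ m / 2).
    by rewrite -rmorphD -splitr.
  rewrite !sq [(p * q) ^+ _]exprMn !mulrBr e1 e2; move: (p ^+ (2 * m)) (q ^+ (2 * m)) => x y.
    have -> : x * y = (C (1 / 2) + C (1 / 2)) * (x * y) by rewrite e5 mul1r.
  by rewrite -e4 -e3; ring.
apply: MD; first by apply: MZ (Hp _); rewrite ltW // divr_gt0.
apply: MD; first by apply: MZ (Hq _); rewrite ltW // divr_gt0 // invr_gt0.
apply: MZ; first by rewrite ltW // divr_gt0.
by apply: Msq; apply: subringB; [|apply: SM => //]; apply: subringX.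
Qed.

Section Multipliers.
Hypothesis SB : forall p, S p -> exists c, M (C c - p).

(** A substitute for stability of [M] under multiplication by squares. Multipliers can be added and
    multiplied by squares from [S]; nothing is claimed about products of two of them, so further
    factors are adjoined one at a time. *)
Definition multiplier (q : P) : Prop :=
  S q /\ forall p, S p -> cone_closure (q * p ^+ 2).

Lemma multiplierD q q' : multiplier q -> multiplier q' -> multiplier (q + q').
Proof.
move=> [Sq Hq] [Sq' Hq']; split; first exact: SD.
by move=> p Sp; rewrite mulrDl; apply: cone_closureD; [apply: Hq|apply: Hq'].
Qed.

Lemma multiplierZ c q : 0 <= c -> multiplier q -> multiplier (C c * q).
Proof.
move=> c0 [Sq Hq]; split; first exact: SM.
by move=> p Sp; rewrite -mulrA; apply: cone_closureZ => //; apply: Hq.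
Qed.

Lemma multiplierM q r : multiplier q -> S r -> multiplier (q * r ^+ 2).
Proof.
move=> [Sq Hq] Sr; split; first by apply: SM => //; apply: subringX.
by move=> p Sp; rewrite -mulrA -exprMn; apply/Hq/SM.
Qed.

Lemma multiplier1 : multiplier 1.
Proof.
by split=> [|p Sp]; [exact: subring1|rewrite mul1r; apply/cone_closureW/Msq].
Qed.

(* x^m - m x + (m - 1) is (x - 1)^2 times a polynomial with nonnegative
   coefficients. *)
Lemma multiplier_tangent q u m : multiplier q -> S u ->
  multiplier (q * (u ^+ (2 * m.+1) - C m.+1%:R * u ^+ 2 + C m%:R)).
Proof.
move=> Mq Su; elim: m => [|m IH].
  rewrite muln1 rmorph0 addr0 rmorph1 mul1r subrr -(rmorph0 C) mulrC.
  exact: multiplierZ.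
have -> : q * (u ^+ (2 * m.+2) - C m.+2%:R * u ^+ 2 + C m.+1%:R) =
    q * (u ^+ (2 * m.+1) - C m.+1%:R * u ^+ 2 + C m%:R) * u ^+ 2
    + C m.+1%:R * (q * (u ^+ 2 - 1) ^+ 2).
  rewrite [(2 * m.+2)%N]mulnSr exprD -[m.+2]addn1 -[m.+1]addn1 !natrD !rmorphD !rmorph_nat.
  by move: (u ^+ (2 * _)) => x; ring.
apply: multiplierD; first exact: multiplierM.
apply: multiplierZ => //; apply: multiplierM => //.
by apply: subringB; [apply: subringX|apply: subring1].
Qed.

(** The second half encodes q <= 1, which allows q u^(2m) p^2 to be replaced by u^(2m) p^2 in the
    next estimate. *)
Definition unit_multiplier (q : P) : Prop := multiplier q /\ multiplier (1 - q).

(* The tangent inequality bounds m (1 - u^2) q p^2 from below by - u^(2m) q p^2,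
   hence by a constant independent of m. *)
Lemma multiplier_ball q u : unit_multiplier q -> S u ->
  (forall m, M (1 - u ^+ (2 * m))) -> multiplier (q * (1 - u ^+ 2)).
Proof.
move=> [Mq M1q] Su Hu; split.
  apply: SM; first by case: Mq.
  by apply: subringB; [apply: subring1|apply: subringX].
move=> p Sp; have [K HK] := SB (subringX 4 Sp).
have e2 : C (1 / 2) + C (1 / 2) = 1 by rewrite -rmorphD -splitr rmorph1.
apply: (@cone_closure_limit _ ((1 + K) / 2)) => m.
set x := u ^+ (2 * m.+1).
(* The last three terms bound [x * p ^+ 2] by (1 + K) / 2: twice it is at most x^2 + p^4, where x^2
   <= 1 by [Hu] and p^4 <= K by [HK]. *)
have -> : C m.+1%:R * (q * (1 - u ^+ 2) * p ^+ 2) + C ((1 + K) / 2) =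
   q * (x - C m.+1%:R * u ^+ 2 + C m%:R) * p ^+ 2
   + (q * p ^+ 2 + ((1 - q) * (u ^+ m.+1 * p) ^+ 2
   + (C (1 / 2) * (1 - u ^+ (2 * (2 * m.+1)))
   + (C (1 / 2) * (C K - p ^+ 4) + C (1 / 2) * (x - p ^+ 2) ^+ 2)))).
  have -> : (u ^+ m.+1 * p) ^+ 2 = x * p ^+ 2 by rewrite exprMn -exprM mulnC.
  have -> : u ^+ (2 * (2 * m.+1)) = x ^+ 2 by rewrite mulnC exprM.
  have -> : C ((1 + K) / 2) = C (1 / 2) + C (1 / 2) * C K.
    by rewrite -rmorphM -rmorphD; congr (C _); ring.
  have -> : (1 - q) * (x * p ^+ 2) =
      (C (1 / 2) + C (1 / 2)) * (x * p ^+ 2) - q * (x * p ^+ 2) by rewrite e2; ring.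
  by rewrite -[m.+1]addn1 natrD rmorphD rmorph1; move: (C (1 / 2)) => h; ring.
apply: cone_closureD; first by case: (multiplier_tangent m Mq Su) => _; apply.
apply: cone_closureD; first by case: Mq => _; apply.
apply: cone_closureD; first by case: M1q => _; apply; apply: SM => //; apply: subringX.
have h0 : 0 <= 1 / 2 :> R by rewrite divr_ge0.
apply: cone_closureW; do 2 (apply: MD; first exact: MZ).
by apply: MZ => //; apply: Msq; apply: subringB; apply: subringX.
Qed.

(** The ball factor for 2 w - 1 is 4 w (1 - w). The factors w and 1 - w are recovered by w = w^2 + w
    (1 - w) and its mirror image, and the upper bounds by 1 - q w = (1 - q) + q (1 - w). *)
Lemma unit_multiplierM q w : unit_multiplier q -> S w ->
    (forall m, M (1 - (C 2 * w - 1) ^+ (2 * m))) ->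
  unit_multiplier (q * w) /\ unit_multiplier (q * (1 - w)).
Proof.
move=> Uq Sw Hw; have [Mq M1q] := Uq.
have S2 : S (C 2 * w - 1) by apply: subringB; [apply: SM|apply: subring1].
have S1w : S (1 - w) by apply: subringB => //; apply: subring1.
have Mx : multiplier (q * w * (1 - w)).
  have -> : q * w * (1 - w) = C (1 / 4) * (q * (1 - (C 2 * w - 1) ^+ 2)).
    have e4 : C (1 / 4) * C 4 = 1 by rewrite -rmorphM -(rmorph1 C); congr (C _); field.
    by rewrite -[LHS]mul1r -[X in X * _ = _]e4 !rmorph_nat; move: (C (1 / 4)) => h; ring.
  by apply: multiplierZ; [rewrite divr_ge0 | apply: multiplier_ball].
have Mqw : multiplier (q * w).
  have -> : q * w = q * w ^+ 2 + q * w * (1 - w) by ring.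
  by apply: multiplierD => //; apply: multiplierM.
have Mq1w : multiplier (q * (1 - w)).
  have -> : q * (1 - w) = q * (1 - w) ^+ 2 + q * w * (1 - w) by ring.
  by apply: multiplierD => //; apply: multiplierM.
by split; split=> //; [have -> : 1 - q * w = 1 - q + q * (1 - w) by ring|
  have -> : 1 - q * (1 - w) = 1 - q + q * w by ring]; apply: multiplierD.
Qed.

(** Binomial coefficients are pulled out first, because [unit_multiplier] is not preserved by large
    scalars; then the factors w and 1 - w enter one by one. *)
Lemma unit_multiplier_bern (J : Type) (s : seq J) (w : J -> P) (d : nat) (al : J -> nat)
    (Q : pred J) :
    (forall j, Q j -> S (w j)) ->
    (forall j, Q j -> forall m, M (1 - (C 2 * w j - 1) ^+ (2 * m))) ->
  cone_closure (\prod_(j <- s | Q j) bern (w j) d (al j)).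
Proof.
move=> Sw Hw.
have -> : \prod_(j <- s | Q j) bern (w j) d (al j) =
   C (\prod_(j <- s | Q j) 'C(d, al j)%:R) *
   \prod_(j <- s | Q j) (w j ^+ al j * (1 - w j) ^+ (d - al j)).
  rewrite rmorph_prod -big_split /=; apply: eq_bigr => j _.
  by rewrite rmorph_nat mulrC mulr_natr.
apply: cone_closureZ; first by apply: prodr_ge0 => j _; apply: ler0n.
suff [[_ H] _] : unit_multiplier
    (\prod_(j <- s | Q j) (w j ^+ al j * (1 - w j) ^+ (d - al j))).
  by have := H 1 subring1; rewrite expr1n mulr1.
have U1 : unit_multiplier 1.
  split; first exact: multiplier1.
  by rewrite subrr -(mul0r 1) -(rmorph0 C); apply: multiplierZ => //; apply: multiplier1.
have UX q w' m m' : unit_multiplier q -> S w' ->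
    (forall m, M (1 - (C 2 * w' - 1) ^+ (2 * m))) ->
    unit_multiplier (q * (w' ^+ m * (1 - w') ^+ m')).
  move=> Uq Sw' Hw'; elim: m' => [|k IHk]; last first.
    by rewrite exprSr !mulrA; case: (unit_multiplierM IHk Sw' Hw'); rewrite !mulrA.
  rewrite expr0 mulr1; elim: m => [|k IHk]; first by rewrite expr0 mulr1.
  by rewrite exprSr !mulrA; case: (unit_multiplierM IHk Sw' Hw').
apply: big_rec => // j q Qj Uq; rewrite mulrC; apply: UX => //; [exact: Sw|exact: Hw].
Qed.

End Multipliers.
End Subring.
End Cones.

(** * Polynomials supported on a clique *)

Section SparsePolynomials.
Variables (R : realType) (r n : nat).
Local Notation V := (vertex r n).
Local Notation P := (mpoly #|V| R).
Local Notation C := (@mpolyC #|V| R).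
Implicit Types (I : {set V}) (p q : P).

Lemma poly_inP I p : reflect (forall m, m \in msupp p -> mon_in I m) (poly_in I p).
Proof. exact: allP. Qed.

Lemma mon_inD I (m1 m2 : multinom #|V|) :
  mon_in I m1 -> mon_in I m2 -> mon_in I (mnm_add m1 m2).
Proof.
move=> /forallP H1 /forallP H2; apply/forallP => v; apply/implyP => vI.
by rewrite mnmDE (eqP (implyP (H1 v) vI)) (eqP (implyP (H2 v) vI)).
Qed.

Lemma poly_inC I c : poly_in I (C c).
Proof.
apply/poly_inP => m; rewrite msuppC; case: ifP => // _; rewrite inE => /eqP ->.
by apply/forallP => v; rewrite mnm0E eqxx implybT.
Qed.

Lemma poly_in1 I : poly_in I (1 : P).
Proof. exact: (poly_inC I 1). Qed.

Lemma poly_inD I p q : poly_in I p -> poly_in I q -> poly_in I (p + q).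
Proof.
move=> /poly_inP Hp /poly_inP Hq; apply/poly_inP => m /msuppD_le.
by rewrite mem_cat => /orP[/Hp|/Hq].
Qed.

Lemma poly_inM I p q : poly_in I p -> poly_in I q -> poly_in I (p * q).
Proof.
move=> /poly_inP Hp /poly_inP Hq; apply/poly_inP => m /msuppM_le /allpairsP[[m1 m2]].
by move=> /= [/Hp H1 /Hq H2 ->]; apply: mon_inD.
Qed.

Lemma poly_inN I p : poly_in I p -> poly_in I (- p).
Proof.
move=> Hp; rewrite -mulN1r -(rmorph1 C) -rmorphN.
by apply: poly_inM => //; apply: poly_inC.
Qed.

Lemma poly_inB I p q : poly_in I p -> poly_in I q -> poly_in I (p - q).
Proof. by move=> Hp Hq; apply: poly_inD => //; apply: poly_inN. Qed.

Lemma poly_in_sum I (J : Type) (s : seq J) (Q : pred J) (F : J -> P) :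
  (forall j, Q j -> poly_in I (F j)) -> poly_in I (\sum_(j <- s | Q j) F j).
Proof.
move=> HF; apply: (big_ind (fun p => poly_in I p)) => [||//]; last exact: poly_inD.
by rewrite -(rmorph0 C); apply: poly_inC.
Qed.

Lemma poly_inX I p m : poly_in I p -> poly_in I (p ^+ m).
Proof. exact: (subringX (poly_inC I) (@poly_inM I)). Qed.

Lemma poly_in_mon I (m : multinom #|V|) : mon_in I m -> poly_in I (mpolyX R m).
Proof. by move=> mI; apply/poly_inP => m'; rewrite msuppX inE => /eqP ->. Qed.

Lemma poly_in_var I (v : V) : v \in I -> poly_in I (var v : P).
Proof.
move=> vI; apply: poly_in_mon; apply/forallP => w; apply/implyP => wI.
rewrite mnm1E (inj_eq enum_rank_inj); case: (eqVneq v w) => // vw.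
by rewrite -vw vI in wI.
Qed.

Lemma univE (p : {poly R}) (i : 'I_n) : univ p i = (map_poly C p).[var (xv r i)].
Proof.
rewrite /univ /horner_alg /horner_morph; congr (_.[_]).
by apply: eq_map_poly => c /=; rewrite alg_mpolyC.
Qed.

Lemma poly_in_univ I (p : {poly R}) (i : 'I_n) : xv r i \in I -> poly_in I (univ p i).
Proof.
move=> iI; rewrite univE horner_coef; apply: poly_in_sum => j _.
by rewrite coef_map; apply: poly_inM; [exact: poly_inC|apply/poly_inX/poly_in_var].
Qed.

Lemma poly_in_sub I I' p : I \subset I' -> poly_in I p -> poly_in I' p.
Proof.
move=> /fintype.subsetP II' /poly_inP Hp; apply/poly_inP => m /Hp /forallP Hm.
apply/forallP => v; apply/implyP => vI; apply: (implyP (Hm v)).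
by apply: contra vI => /II'.
Qed.

Lemma poly_in_lifting f l i : poly_in (constraint_vars l i) (lifting f l i : P).
Proof.
rewrite /constraint_vars /lifting; case: ifP => _; apply: poly_inB.
- by apply: poly_in_var; rewrite !inE eqxx.
- by apply: poly_in_univ; rewrite !inE eqxx orbT.
- by apply: poly_in_var; rewrite !inE eqxx.
- apply: poly_inM; last by apply: poly_in_univ; rewrite !inE eqxx orbT.
  by apply: poly_in_var; rewrite !inE eqxx orbT.
Qed.

Lemma mpolyX_prod (m : multinom #|V|) : mpolyX R m = \prod_(v : V) var v ^+ m (enum_rank v).
Proof.
rewrite mpolyXE_id (reindex_onto (@enum_rank V) enum_val) /=; last by move=> i _; rewrite enum_valK.
by apply: eq_bigl => v; rewrite enum_rankK eqxx.
Qed.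

Section ConeInstance.
Variables (M : P -> Prop).
Hypothesis MD : forall p q, M p -> M q -> M (p + q).
Hypothesis MZ : forall c p, 0 <= c -> M p -> M (C c * p).
Hypothesis MC : forall c, 0 <= c -> M (C c).

(** From 2 q <= 1 + q^2 <= 1 + c, for q = p and q = - p. *)
Lemma power_bounded_bound I c p : (forall q, poly_in I q -> M (q ^+ 2)) ->
  poly_in I p -> power_bounded C M c p -> exists2 K, M (C K - p) & M (C K + p).
Proof.
move=> Msq Sp Hp; have S1 := poly_in1 I.
have key q : poly_in I q -> q ^+ 2 = p ^+ 2 -> M (C ((c + 1) / 2) - q).
  move=> Sq qE.
  have -> : C ((c + 1) / 2) - q = C (1 / 2) * (C (c ^+ 1) - p ^+ (2 * 1)) +
                               C (1 / 2) * (1 - q) ^+ 2.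
    have e2 : C (1 / 2) + C (1 / 2) = 1 by rewrite -rmorphD -splitr rmorph1.
    have -> : C ((c + 1) / 2) = C (1 / 2) * C c + C (1 / 2).
      by rewrite -rmorphM -rmorphD; congr (C _); ring.
    rewrite muln1 expr1 -qE.
    transitivity (C (1 / 2) * C c + C (1 / 2) - (C (1 / 2) + C (1 / 2)) * q).
      by rewrite e2 [1 * q]mul1r.
    by move: (C (1 / 2)) => h; ring.
  have h0 : 0 <= 1 / 2 :> R by rewrite divr_ge0.
  apply: MD; first exact: (MZ h0 (Hp 1%N)).
  by apply: MZ => //; apply/Msq/poly_inB.
exists ((c + 1) / 2); first exact: key.
by have := key (- p); rewrite opprK; apply; [apply: poly_inN|rewrite sqrrN].
Qed.

(** Power bounds pass from variables to monomials by [power_boundedM]; two-sided bounds on monomials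
    then combine with coefficients of either sign. *)
Lemma power_bounded_all I : (forall q, poly_in I q -> M (q ^+ 2)) ->
    (forall v, v \in I -> exists2 c, 0 < c & power_bounded C M c (var v)) ->
  forall p, poly_in I p -> exists K, M (C K - p).
Proof.
move=> Msq Hv p /poly_inP Sp.
have mono m : mon_in I m -> exists2 c, 0 < c & power_bounded C M c (mpolyX R m).
  move=> mI; rewrite mpolyX_prod.
  have H1 : exists2 c, 0 < c & power_bounded C M c 1.
    by exists 1 => // k; rewrite !expr1n rmorph1 subrr -(rmorph0 C); apply: MC.
  pose K q := poly_in I q /\ exists2 c, 0 < c & power_bounded C M c q.
  suff [_] : K (\prod_(v : V) var v ^+ m (enum_rank v)) by [].
  apply: big_rec; first by split=> //; apply: poly_in1.
  move=> v q _ [Sq Hq].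
  case: (boolP (v \in I)) => vI; last first.
    by move/forallP/(_ v)/implyP/(_ vI)/eqP: mI => ->; rewrite expr0 mul1r.
  have [cv cv0 Hcv] := Hv v vI; have Sv := poly_in_var vI.
  elim: (m _) => [|k [Sk [ck ck0 Hk]]]; first by rewrite expr0 mul1r.
  rewrite exprS -mulrA; split; first exact: poly_inM.
  exists (cv * ck); first exact: mulr_gt0.
  exact: (power_boundedM MD MZ (poly_inC I) (@poly_inD I) (@poly_inM I) Msq).
have both m : mon_in I m -> exists2 K, M (C K - mpolyX R m) & M (C K + mpolyX R m).
  move=> mI; have [c c0 Hc] := mono m mI.
  exact: (power_bounded_bound Msq (poly_in_mon mI) Hc).
rewrite (mpolyE p); elim: (msupp p) Sp => [|m s IH] Sp.
  by exists 0; rewrite big_nil subr0; apply: MC.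
have [|K HK] := IH; first by move=> m' ms; apply: Sp; rewrite inE ms orbT.
have [K' H1 H2] := both m (Sp m (mem_head _ _)).
exists (`|mcoeff m p| * K' + K).
rewrite big_cons rmorphD opprD addrACA; apply: MD => //.
rewrite rmorphM -mul_mpolyC; case: (ger0P (mcoeff m p)) => c0.
  by rewrite -mulrBr; apply: MZ.
have -> : - (C (mcoeff m p) * mpolyX R m) = C (- mcoeff m p) * mpolyX R m.
  by rewrite rmorphN mulNr.
by rewrite -mulrDr; apply: MZ => //; rewrite oppr_ge0 ltW.
Qed.

End ConeInstance.
End SparsePolynomials.

(** * Positivity on a box *)

Section BernsteinOperator.
Variables (R : realType) (r n : nat).
Local Notation V := (vertex r n).
Local Notation P := (mpoly #|V| R).
Local Notation C := (@mpolyC #|V| R).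
Local Notation grid d := {ffun V -> 'I_d.+1}.
Variable s : R.
Hypothesis s0 : 0 < s.
Implicit Types (I : {set V}) (p q : P).

(* The coordinate of v rescaled from [-s, s] to [0, 1]. *)
Definition unit_coord (v : V) : P := C (1 / 2) + C (1 / (2 * s)) * var v.

Definition box_line : {poly R} := (2 * s) *: 'X - s%:P.

Lemma box_line_coord v : (map_poly C box_line).[unit_coord v] = var v.
Proof.
rewrite /box_line rmorphB /= map_polyZ map_polyX map_polyC /= !hornerE.
rewrite /unit_coord mulrDr mulrA -!rmorphM.
have -> : 2 * s * (1 / 2) = s by field.
have -> : 2 * s * (1 / (2 * s)) = 1 by field; rewrite gt_eqF.
by rewrite rmorph1 mul1r addrAC subrr add0r.
Qed.

Definition bern_op d (phi : grid d -> R) : P :=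
  \sum_(al : grid d) C (phi al) * \prod_(v : V) bern (unit_coord v) d (al v).

(** A variable absent from a monomial contributes the factor 1, which keeps the coefficients local;
    each occurring power is reproduced exactly by the operator once [d] is large enough. *)
Definition bern_samples p d (al : grid d) : R :=
  \sum_(m <- msupp p) mcoeff m p *
    \prod_(v : V) bern_coef (box_line ^+ m (enum_rank v)) d (al v).

Definition grid_point d (al : grid d) (v : V) : R := box_line.[(al v)%:R / d%:R].

Definition eval_at (z : V -> R) (p : P) : R := meval (fun i => z (enum_val i)) p.

Lemma bern_op_sum d (J : Type) (t : seq J) (F : J -> grid d -> R) :
  bern_op (fun al => \sum_(j <- t) F j al) = \sum_(j <- t) bern_op (F j).
Proof.
rewrite exchange_big /=; apply: eq_bigr => al _.
by rewrite rmorph_sum big_distrl.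
Qed.

Lemma bern_op_samples p d : (msize p <= d)%N -> bern_op (@bern_samples p d) = p.
Proof.
move=> pd; rewrite bern_op_sum [RHS]mpolyE; apply: eq_big_seq => m mp.
have md : (mdeg m < d.+1)%N by rewrite ltnS (leq_trans _ pd) // ltnW // msize_mdeg_lt.
rewrite -mul_mpolyC mpolyX_prod /bern_op.
transitivity (C (mcoeff m p) * \sum_(al : grid d) \prod_(v : V)
    (C (bern_coef (box_line ^+ m (enum_rank v)) d (al v)) * bern (unit_coord v) d (al v))).
  rewrite big_distrr /=; apply: eq_bigr => al _.
  by rewrite rmorphM rmorph_prod -mulrA big_split.
congr (_ * _).
rewrite -(bigA_distr_bigA (fun v (i : 'I_d.+1) =>
   C (bern_coef (box_line ^+ m (enum_rank v)) d i) * bern (unit_coord v) d i)).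
apply: eq_bigr => v _; rewrite bern_coef_sum; last first.
  have : (m (enum_rank v) <= mdeg m)%N by rewrite mdegE (bigD1 (enum_rank v)) //= leq_addr.
  have : (size (box_line ^+ m (enum_rank v)) <= m (enum_rank v) * 1 + 1)%N.
    apply: leq_trans (size_exp_leq _ _) _; rewrite addn1 ltnS mulnC leq_mul2l.
    apply/orP; right; rewrite -subn1 leq_subLR /box_line.
    apply: leq_trans (size_polyD _ _) _; rewrite geq_max size_polyN.
    rewrite (leq_trans (size_scale_leq _ _)) ?size_polyX //=.
    by rewrite (leq_trans (size_polyC_leq1 _)).
  clear -md; lia.
by rewrite rmorphXn horner_exp box_line_coord.
Qed.

Lemma bern_samples_local I p d : poly_in I p -> local_on I (@bern_samples p d).
Proof.
move=> /poly_inP Sp al be eqI; apply: eq_big_seq => m /Sp /forallP mI.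
congr (_ * _); apply: eq_bigr => v _.
case: (boolP (v \in I)) => vI; first by rewrite eqI.
move/implyP/(_ vI)/eqP: (mI v) => ->; rewrite expr0 /bern_coef size_poly1.
by rewrite !big_ord1 /bern_ratio !bin0.
Qed.

Lemma bern_samples_close p :
  uclose (bern_samples p) (fun d al => eval_at (grid_point al) p).
Proof.
apply: uclose_eq (uclose_sum _ _) => [d a|d a|m]; first by [].
  by rewrite /eval_at mevalE.
apply: ucloseM; first exact: uclose_cst.
apply: uclose_eq (uclose_prod _ _) => [d a|d a|v]; [by []| |].
  rewrite (reindex_onto (@enum_rank V) enum_val) /=; last by move=> i _; rewrite enum_valK.
  rewrite -[LHS]/(\prod_(v : V) _).
  apply: eq_big => [v|v _]; first by rewrite enum_rankK eqxx.
  rewrite enum_rankK /grid_point -horner_exp; reflexivity.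
exact: (uclose_comp (fun d (al : grid d) => al v) (uclose_bern_coef _)).
Qed.

Lemma grid_point_box d (al : grid d) v : (0 < d)%N -> `|grid_point al v| <= s.
Proof.
move=> d0; rewrite /grid_point.
have a1 : (al v)%:R / d%:R <= 1 :> R.
  by rewrite ler_pdivrMr ?ltr0n // mul1r ler_nat -ltnS.
have a0 : 0 <= (al v)%:R / d%:R :> R by rewrite divr_ge0.
move: ((al v)%:R / d%:R) a0 a1 => x x0 x1.
have -> : box_line.[x] = 2 * (s * x) - s by rewrite mulrA /box_line !hornerE.
have sx0 : 0 <= s * x by rewrite mulr_ge0 // ltW.
have sx1 : s * x <= s by rewrite ler_piMr // ltW.
by rewrite ler_norml; apply/andP; split; lra.
Qed.

Section Positivity.
Variables (M : P -> Prop).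
Hypothesis MD : forall p q, M p -> M q -> M (p + q).
Hypothesis MZ : forall c p, 0 <= c -> M p -> M (C c * p).
Hypothesis MC : forall c, 0 <= c -> M (C c).
Hypothesis Mv : forall v, power_bounded C M (s ^+ 2) (var v).

Lemma unit_coord_ball v m : M (1 - (C 2 * unit_coord v - 1) ^+ (2 * m)).
Proof.
have -> : C 2 * unit_coord v - 1 = C s^-1 * var v.
  rewrite /unit_coord mulrDr mulrA -!rmorphM.
  have -> : 2 * (1 / 2) = 1 :> R by field.
  have -> : 2 * (1 / (2 * s)) = s^-1 by field; rewrite gt_eqF.
  by rewrite rmorph1 addrAC subrr add0r.
have -> : 1 - (C s^-1 * var v) ^+ (2 * m) =
    C (s^-1 ^+ (2 * m)) * (C ((s ^+ 2) ^+ m) - var v ^+ (2 * m)).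
  rewrite mulrBr -rmorphM -exprM -exprMn mulVf ?gt_eqF // expr1n rmorph1.
  by rewrite exprMn rmorphXn.
by apply: MZ (Mv _ _); rewrite exprn_ge0 // invr_ge0 ltW.
Qed.

(** Summation over the coordinates outside [I] collapses, since Bernstein polynomials of a fixed
    degree add up to 1. What remains is a nonnegative combination of products over [I]. *)
Lemma bern_op_local I d (phi : grid d -> R) :
    (forall q, poly_in I q -> M (q ^+ 2)) ->
    local_on I phi -> (forall al, 0 <= phi al) ->
  cone_closure C M (bern_op phi).
Proof.
move=> Msq lphi phi0.
(* Grid points that agree on [I] are grouped under the representative with zeros outside [I]. *)
pose h (al : grid d) : grid d := [ffun v => if v \in I then al v else ord0].
have hphi al : phi al = phi (h al) by apply: lphi => v vI; rewrite ffunE vI.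
rewrite /bern_op (partition_big h predT) //=.
have clo0 : cone_closure C M 0.
  by rewrite -(rmorph0 C); apply: (cone_closureW MD MC); apply: MC.
apply: big_ind => [//||be _]; first exact: (cone_closureD MD).
case: (boolP (h be == be)) => hbe; last first.
  rewrite big_pred0 // => al; apply/eqP => hal; move/eqP: hbe; apply.
  by rewrite -hal; apply/ffunP => v; rewrite !ffunE; case: ifP => // ->.
have -> : \sum_(al | h al == be) C (phi al) * \prod_v bern (unit_coord v) d (al v) =
   C (phi be) * \prod_(v in I) bern (unit_coord v) d (be v).
  pose Q v : pred 'I_d.+1 := if v \in I then pred1 (be v) else predT.
  rewrite (eq_bigl (fun al => al \in family Q)); last first.
    move=> al; apply/eqP/familyP => [hal v|H].
      by rewrite /Q -hal ffunE; case: (v \in I); rewrite inE ?eqxx.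
    apply/ffunP => v; move: (H v); rewrite /Q -(eqP hbe) !ffunE.
    by case: (v \in I) => //; rewrite inE => /eqP.
  transitivity (C (phi be) * \sum_(al in family Q) \prod_v bern (unit_coord v) d (al v)).
    rewrite big_distrr /=; apply: eq_bigr => al /familyP alQ; congr (C _ * _).
    by apply: lphi => v vI; move: (alQ v); rewrite /Q vI inE => /eqP.
  congr (_ * _).
  rewrite -(bigA_distr_big_dep _ (fun v (i : 'I_d.+1) => bern (unit_coord v) d i)) /=.
  rewrite (bigID (mem I)) /= [X in _ * X]big1 ?mulr1; last first.
    move=> v vI; rewrite /Q (negPf vI).
    have := @bern_coef_sum R P C 1 (unit_coord v) d.
    rewrite size_poly1 => /(_ isT); rewrite rmorph1 hornerE => <-.
    apply: eq_bigr => i _; rewrite /bern_coef size_poly1 big_ord1 /bern_ratio !bin0.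
    by rewrite coefC /= divr1 mulr1 rmorph1 mul1r.
  by apply: eq_bigr => v vI; rewrite /Q vI big_pred1_eq.
apply: (cone_closureZ MZ MC) => //.
have SB : forall p, poly_in I p -> exists c, M (C c - p).
  apply: (power_bounded_all MD MZ MC Msq) => v _.
  by exists (s ^+ 2); rewrite ?exprn_gt0.
apply: (unit_multiplier_bern MD MZ MC (poly_inC I) (@poly_inD _ _ _ I) (@poly_inM _ _ _ I) Msq SB).
  move=> v vI; apply: poly_inD; first exact: poly_inC.
  by apply: poly_inM; [exact: poly_inC|exact: poly_in_var].
by move=> v _; apply: unit_coord_ball.
Qed.

Variables (E : rel V) (N : nat) (I : 'I_N -> {set V}).
Hypotheses (EC : ssrbool.symmetric E) (EI : irreflexive E) (ECh : chordal E).
Hypothesis Ic : forall a, is_clique E (I a).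
Hypothesis cI : forall D : {set V}, is_clique E D -> exists a, D \subset I a.
Hypothesis Msq : forall a q, poly_in (I a) q -> M (q ^+ 2).

Lemma box_nonneg_closure (F : 'I_N -> P) (eta : R) :
    (forall a, poly_in (I a) (F a)) -> 0 < eta ->
    (forall z : V -> R, (forall v, `|z v| <= s) -> eta <= \sum_a eval_at z (F a)) ->
  cone_closure C M (\sum_a F a).
Proof.
move=> SF e0 posF.
pose X d (al : grid d) := \sum_a bern_samples (F a) al.
have [_ /(_ _ e0) [d0 Hd]] : uclose X (fun d al => \sum_a eval_at (grid_point al) (F a)).
  exact: (uclose_sum _ (fun a => bern_samples_close (F a))).
(* At least [d0] for accuracy [eta] of the coefficients, beyond all degrees for exact reproduction,
   and positive for the grid. *)
pose d := (d0 + (\max_a msize (F a)).+1)%N.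
have dF a : (msize (F a) <= d)%N.
  apply: (leq_trans (@leq_bigmax _ (fun a => msize (F a)) a)).
  by rewrite /d addnS ltnW // ltnS leq_addl.
have X0 (al : grid d) : 0 <= X d al.
  have d1 : (0 < d)%N by rewrite /d addnS.
  have := posF (grid_point al) (fun v => grid_point_box al v d1).
  have := Hd d al (leq_addr _ _); rewrite ler_norml => /andP[]; lra.
have -> : \sum_a F a = bern_op (X d).
  by rewrite bern_op_sum; apply: eq_bigr => a _; rewrite bern_op_samples.
have : local_sum (@clique_nonneg V E R d) (X d).
  apply: (nonneg_local_split EC EI ECh (U := [set: V])) => //.
  rewrite /X; elim: (index_enum _) => [|a t IH].
    by constructor => al; rewrite big_nil.
  apply: (local_sumD (C := I a) (phi := @bern_samples (F a) d)) IH _.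
    split; [exact: finset.subsetT|exact: Ic|exact: bern_samples_local].
  by move=> al; rewrite big_cons.
elim=> [Phi Phi0|D phi Phi Phi' [cD lD phi0] _ IH Phi'E].
  rewrite /bern_op big1; last by move=> al _; rewrite Phi0 rmorph0 mul0r.
  by rewrite -(rmorph0 C); apply: (cone_closureW MD MC); apply: MC.
have -> : bern_op Phi' = bern_op phi + bern_op Phi.
  rewrite -big_split; apply: eq_bigr => al _.
  by rewrite Phi'E rmorphD mulrDl.
apply: (cone_closureD MD) => //; have [a Da] := cI cD.
exact: (bern_op_local (Msq (a := a)) (sub_local Da lD)).
Qed.

(** Half of the margin is removed from one summand, constants belonging to every clique, and is
    returned as the [eps] of the closure. *)
Lemma box_positive (F : 'I_N -> P) (eta : R) :
    (0 < N)%N -> (forall a, poly_in (I a) (F a)) -> 0 < eta ->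
    (forall z : V -> R, (forall v, `|z v| <= s) -> eta <= \sum_a eval_at z (F a)) ->
  M (\sum_a F a).
Proof.
move=> N0 SF e0 posF; pose a0 := Ordinal N0.
pose F' a := if a == a0 then F a - C (eta / 2) else F a.
have F'E : \sum_a F' a = \sum_a F a - C (eta / 2).
  rewrite (bigD1 a0) //= [in RHS](bigD1 a0) //= /F' eqxx addrAC; congr (_ + _ - _).
  by apply: eq_bigr => a /negPf ->.
rewrite -(subrK (C (eta / 2)) (\sum_a F a)) -F'E.
have e2 : 0 < eta / 2 by rewrite divr_gt0.
apply: (box_nonneg_closure (eta := eta / 2)) => //.
  move=> a; rewrite /F'; case: eqP => // _; apply: poly_inB => //; exact: poly_inC.
move=> z /posF H; rewrite -raddf_sum F'E raddfB /= raddf_sum /eval_at mevalC.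
by rewrite /eval_at in H; lra.
Qed.

End Positivity.
End BernsteinOperator.

(** * Penalization on a compact set *)

Section Penalization.
Variable R : realType.

Lemma continuous_add (T : topologicalType) (F G : T -> R) :
  continuous F -> continuous G -> continuous (fun x => F x + G x).
Proof. by move=> cF cG x; apply: (@continuousD _ _ _ F G x (cF x) (cG x)). Qed.

Lemma continuous_mul (T : topologicalType) (F G : T -> R) :
  continuous F -> continuous G -> continuous (fun x => F x * G x).
Proof. by move=> cF cG x; apply: (@continuousM _ _ F G x (cF x) (cG x)). Qed.

Lemma continuous_bigsum (T : topologicalType) (J : Type) (t : seq J) (F : J -> T -> R) :
  (forall j, continuous (F j)) -> continuous (fun x => \sum_(j <- t) F j x).
Proof.
move=> cF; elim: t => [|j t IH] x.
  by under eq_fun do rewrite big_nil; apply: cst_continuous.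
by under eq_fun do rewrite big_cons; apply: continuousD; [apply: cF|apply: IH].
Qed.

Lemma continuous_bigprod (T : topologicalType) (J : Type) (t : seq J) (F : J -> T -> R) :
  (forall j, continuous (F j)) -> continuous (fun x => \prod_(j <- t) F j x).
Proof.
move=> cF; elim: t => [|j t IH] x.
  by under eq_fun do rewrite big_nil; apply: cst_continuous.
by under eq_fun do rewrite big_cons; apply: continuousM; [apply: cF|apply: IH].
Qed.

Lemma continuous_power (T : topologicalType) (F : T -> R) k :
  continuous F -> continuous (fun x => F x ^+ k).
Proof.
move=> cF; have := continuous_bigprod (t := index_enum 'I_k) (fun _ => cF).
by under [X in continuous X -> _]eq_fun do rewrite prodr_const card_ord.
Qed.

Lemma meval_continuous m (p : mpoly m R) :
  continuous (fun x : 'rV[R]_m => meval (fun i => x ord0 i) p).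
Proof.
under eq_fun do rewrite mevalE.
apply: continuous_bigsum => u x; apply: continuousM; first exact: cst_continuous.
by apply: continuous_bigprod => i; apply: continuous_power; apply: coord_continuous.
Qed.

Definition pos_part (x : R) : R := (x + `|x|) / 2.

Lemma pos_part_ge0 (x : R) : 0 <= pos_part x.
Proof. by rewrite /pos_part; have := ler_norm (- x); rewrite normrN; lra. Qed.

(** 1 - (1 - x)^k is x times the sum of the (1 - x)^i for i < k, hence at least k x (1 - x)^k; the
    induction carries this stronger bound. *)
Lemma bernoulli_weight (x : R) k : 0 <= x <= 1 -> k%:R * (x * (1 - x) ^+ k) <= 1.
Proof.
move=> /andP[x0 x1].
suff H : k%:R * (x * (1 - x) ^+ k) <= 1 - (1 - x) ^+ k.
  by apply: (le_trans H); rewrite lerBlDr lerDl exprn_ge0 // subr_ge0.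
elim: k => [|k IH]; first by rewrite mul0r expr0 subrr.
have y0 : 0 <= (1 - x) ^+ k by rewrite exprn_ge0 // subr_ge0.
have k0 : 0 <= k%:R :> R by [].
rewrite -addn1 natrD exprD expr1; move: ((1 - x) ^+ k) (k%:R) y0 k0 IH => y l y0 l0 IH.
have : 0 <= l * (x * y) by rewrite !mulr_ge0.
have : 0 <= x * y by rewrite mulr_ge0.
nra.
Qed.

(* With x = G / B, the penalty x (1 - x)^(2k) is at most 1 / (2k) where x >= 0 and
   at most x where x <= 0, so that a large multiple of it with k large is small
   on the feasible side and very negative on the infeasible one. *)
Lemma penalization (T : topologicalType) (A : set T) (F : T -> R) (n : nat)
    (G : 'I_n -> T -> R) (J : finType) (h : J -> T -> R) :
    compact A -> continuous F -> (forall j, continuous (G j)) ->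
    (forall j, continuous (h j)) ->
    (forall z, A z -> (forall j, 0 <= G j z) -> (forall j, h j z = 0) -> 0 < F z) ->
  exists w B Lam eta k, [/\ 0 <= w, 0 < B, 0 <= Lam, 0 < eta & forall z, A z ->
    eta <= F z - \sum_j w * (1 - G j z / B) ^+ (2 * k) * G j z
           + Lam * \sum_j h j z ^+ 2].
Proof.
move=> cA cF cG ch pos.
case: (eqVneq A set0) => [->|/set0P A0].
  by exists 0, 1, 0, 1, 0; split.
have cmax (Phi : T -> R) : continuous Phi -> exists b, forall z, A z -> Phi z <= b.
  move=> cPhi; have [|c _ Hc] := @compact_EVT_max T R Phi A A0 cA.
    by apply: continuous_subspaceT => x; apply: cPhi.
  by exists (Phi c) => z Az; apply: Hc; rewrite inE.
have cnorm (Phi : T -> R) : continuous Phi -> continuous (fun z => `|Phi z|).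
  by move=> cPhi x; apply: continuous_comp; [apply: cPhi|apply: norm_continuous].
have cpp (Phi : T -> R) : continuous Phi -> continuous (fun z => pos_part (Phi z)).
  move=> cPhi; apply: continuous_mul; last exact: cst_continuous.
  exact: continuous_add cPhi (cnorm _ cPhi).
(* [Psi] vanishes only where all constraints hold and [F] is at most 0, which [pos] excludes on [A];
   compactness gives a positive minimum. *)
pose Psi z := pos_part (F z) + \sum_j pos_part (- G j z) + \sum_j h j z ^+ 2.
have cPsi : continuous Psi.
  apply: continuous_add; first apply: continuous_add (cpp _ cF) _.
    apply: continuous_bigsum => j; apply: cpp => y; apply: continuousN; exact: cG.
  by apply: continuous_bigsum => j; apply: continuous_power.
have sG0 z : 0 <= \sum_j pos_part (- G j z) by apply: sumr_ge0 => j _; apply: pos_part_ge0.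
have sh0 z : 0 <= \sum_j h j z ^+ 2 by apply: sumr_ge0 => j _; apply: sqr_ge0.
have Psi0 z : A z -> 0 < Psi z.
  move=> Az; rewrite lt_neqAle eq_sym andbC addr_ge0 ?addr_ge0 ?pos_part_ge0 //=.
  apply/negP; rewrite /Psi paddr_eq0 ?addr_ge0 ?pos_part_ge0 //.
  rewrite paddr_eq0 ?pos_part_ge0 // => /andP[/andP[/eqP F0 G0] h0].
  have : 0 < F z.
    apply: pos => // j.
      move: G0; rewrite psumr_eq0; last by move=> i _; apply: pos_part_ge0.
      move/allP/(_ j (mem_index_enum _)) => /= /eqP Gj.
      rewrite leNgt; apply/negP => Gn.
      by move: Gj; rewrite /pos_part gtr0_norm ?oppr_gt0 //; lra.
    move: h0; rewrite psumr_eq0; last by move=> i _; apply: sqr_ge0.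
    by move/allP/(_ j (mem_index_enum _)) => /=; rewrite sqrf_eq0 => /eqP.
  by move=> Fz; move: F0; rewrite /pos_part gtr0_norm //; lra.
have [mu [mu0 Hmu]] : exists mu, 0 < mu /\ forall z, A z ->
    [\/ mu <= F z, exists j, mu <= - G j z | mu <= \sum_j h j z ^+ 2].
  have [|c Ac Hc] := @compact_EVT_min T R Psi A A0 cA.
    by apply: continuous_subspaceT => x; apply: cPsi.
  rewrite inE in Ac.
  have n2 : 0 < n.+2%:R :> R by rewrite ltr0n.
  (* The minimum is divided into one share for [F], one for the equations and [n] for the
     inequalities; at each point some share must be reached. *)
  exists (Psi c / n.+2%:R); split; first by rewrite divr_gt0 // Psi0.
  move=> z Az; have := Hc z; rewrite inE => /(_ Az) PsiLe.
  set mu := Psi c / _; have mu0 : 0 < mu by rewrite divr_gt0 // Psi0.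
  have muE : Psi c = mu * n%:R + mu + mu.
    by rewrite -[LHS](divfK (lt0r_neq0 n2)) -/mu -addn2 natrD; ring.
  apply: contrapT => no.
  have no1 : pos_part (F z) < mu.
    rewrite ltNge; apply/negP => le; apply: no; apply: Or31.
    by move: le; rewrite /pos_part; case: (lerP 0 (F z)) => F0;
      rewrite ?(ger0_norm F0) ?(ltr0_norm F0); lra.
  have no3 : \sum_j h j z ^+ 2 < mu.
    by rewrite ltNge; apply/negP => le; apply: no; apply: Or33.
  have no2 : \sum_j pos_part (- G j z) <= mu * n%:R.
    rewrite mulr_natr -[X in mu *+ X]card_ord -sumr_const; apply: ler_sum => j _.
    rewrite leNgt; apply/negP => le; apply: no; apply: Or32; exists j.
    by move: le; rewrite /pos_part; case: (lerP 0 (- G j z)) => F0;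
      rewrite ?(ger0_norm F0) ?(ltr0_norm F0); lra.
  by move: PsiLe; rewrite muE /Psi; lra.
have [bF HbF] := cmax _ (cnorm _ cF).
have [bG HbG] := cmax _ (continuous_bigsum (t := index_enum 'I_n) (fun j => cnorm _ (cG j))).
pose BF := `|bF|; pose B := 1 + `|bG|.
have B0 : 0 < B by rewrite /B; have := normr_ge0 bG; lra.
have HF z : A z -> - BF <= F z.
  move=> Az; have := HbF z Az; have := ler_norm bF; rewrite -/BF.
  by have := ler_norm (- F z); rewrite normrN; lra.
have HG j z : A z -> `|G j z| <= B.
  move=> Az; have := HbG z Az; have := ler_norm bG; rewrite /B.
  rewrite (bigD1 j) //=.
  have : 0 <= \sum_(i < n | i != j) `|G i z| by apply: sumr_ge0.
  lra.
(* Cap on a single inequality penalty: all [n] together take at most half of [mu]. *)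
pose dl := mu / (2 * n.+1%:R).
have n1 : 0 < n.+1%:R :> R by rewrite ltr0n.
have dl0 : 0 < dl by rewrite divr_gt0 // mulr_gt0.
have dln : n%:R * dl <= mu / 2.
  rewrite /dl; have -> : mu / 2 = n.+1%:R * (mu / (2 * n.+1%:R)) by field; rewrite gt_eqF.
  by rewrite ler_wpM2r ?ler_nat // ltW.
(* A gain of [BF + n * dl + 1] outweighs both - F and the other penalties by 1. With w = 2 k dl / B
   the cap [dl] follows from [bernoulli_weight], and [K <= 2 * k] makes [w * mu] at least that
   gain. *)
pose K := (BF + n%:R * dl + 1) * B / (dl * mu).
have [k Hk] : exists k : nat, K <= (2 * k)%:R.
  exists (Num.truncn `|K|).+1; apply: (le_trans (ler_norm _)).
  by apply: (le_trans (ltW (truncnS_gt _))); rewrite ler_nat leq_pmull.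
pose w := dl * (2 * k)%:R / B.
have w0 : 0 <= w by rewrite divr_ge0 ?(ltW B0) // mulr_ge0 // ltW.
have wmu : BF + n%:R * dl + 1 <= w * mu.
  rewrite /w; have -> : BF + n%:R * dl + 1 = dl * K / B * mu.
    by rewrite /K; field; rewrite !gt_eqF.
  by rewrite ler_wpM2r ?(ltW mu0) // ler_wpM2r ?invr_ge0 ?(ltW B0) // ler_wpM2l // ltW.
exists w, B, ((BF + n%:R * dl + 1) / mu), (Num.min (mu / 2) 1), k.
have BF0 : 0 <= BF by apply: normr_ge0.
have nd0 : 0 <= n%:R * dl by rewrite mulr_ge0 // ltW.
split=> //.
- by rewrite divr_ge0 ?(ltW mu0) // !addr_ge0.
- by rewrite lt_min divr_gt0 // ltr01.
move=> z Az; pose t j := w * (1 - G j z / B) ^+ (2 * k) * G j z.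
have evn j : 0 <= (1 - G j z / B) ^+ (2 * k) by rewrite exprM exprn_ge0 // sqr_ge0.
have t_le j : t j <= dl.
  rewrite /t; case: (lerP 0 (G j z)) => Gj; last first.
    apply: (le_trans _ (ltW dl0)); apply: mulr_ge0_le0; last exact: ltW.
    exact: mulr_ge0.
  have /(bernoulli_weight (2 * k)) : 0 <= G j z / B <= 1.
    rewrite divr_ge0 ?(ltW B0) //= ler_pdivrMr // mul1r.
    exact: le_trans (ler_norm _) (HG j z Az).
  have -> : w * (1 - G j z / B) ^+ (2 * k) * G j z =
    dl * ((2 * k)%:R * (G j z / B * (1 - G j z / B) ^+ (2 * k))) by rewrite /w; ring.
  by move=> HB; rewrite -[leRHS]mulr1 ler_pM2l.
have st_le (Q : pred 'I_n) : \sum_(j | Q j) t j <= n%:R * dl.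
  apply: (@le_trans _ _ (\sum_(j | Q j) dl)); first exact: ler_sum.
  rewrite sumr_const -[dl *+ _]mulr_natl ler_wpM2r ?(ltW dl0) // ler_nat.
  by rewrite -[leqRHS]card_ord max_card.
have Lh0 : 0 <= (BF + n%:R * dl + 1) / mu * \sum_j h j z ^+ 2.
  by rewrite mulr_ge0 // divr_ge0 ?(ltW mu0) // !addr_ge0.
case: (Hmu z Az) => [HFz|[j Hj]|Hh].
- apply: (@le_trans _ _ (mu / 2)); first by rewrite ge_min lexx.
  have := st_le predT; rewrite /t; lra.
- apply: (@le_trans _ _ 1); first by rewrite ge_min lexx orbT.
  have -> : \sum_j w * (1 - G j z / B) ^+ (2 * k) * G j z = t j + \sum_(i | i != j) t i.
    by rewrite (bigD1 j).
  have := HF z Az; have := st_le (fun i => i != j).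
  have : w * mu <= - t j.
    have -> : - t j = w * ((1 - G j z / B) ^+ (2 * k) * - G j z) by rewrite /t; ring.
    rewrite ler_wpM2l //.
    apply: (le_trans Hj); rewrite ler_peMl ?(le_trans (ltW mu0)) //.
    by apply: exprn_ege1; rewrite lerDl oppr_ge0 mulr_le0_ge0 ?invr_ge0 ?(ltW B0) //; lra.
  lra.
- apply: (@le_trans _ _ 1); first by rewrite ge_min lexx orbT.
  have := HF z Az; have := st_le predT; rewrite /t.
  have : BF + n%:R * dl + 1 <= (BF + n%:R * dl + 1) / mu * \sum_j h j z ^+ 2.
    rewrite -[leLHS](divfK (lt0r_neq0 mu0)) ler_wpM2l //.
    by rewrite divr_ge0 ?(ltW mu0) // !addr_ge0.
  lra.
Qed.

End Penalization.

(** * Boundedness of the lifted variables *)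

Section UnivariateModule.
Variable R : realType.
Implicit Types (g p q : {poly R}).

Definition sos_poly p : Prop := exists s : seq {poly R}, p = \sum_(q <- s) q ^+ 2.

Definition uqm g p : Prop := exists s0 s1, [/\ sos_poly s0, sos_poly s1 & p = s0 + s1 * g].

Lemma sos_poly0 : sos_poly 0.
Proof. by exists [::]; rewrite big_nil. Qed.

Lemma sos_polyX p : sos_poly (p ^+ 2).
Proof. by exists [:: p]; rewrite big_seq1. Qed.

Lemma sos_polyD p q : sos_poly p -> sos_poly q -> sos_poly (p + q).
Proof. by move=> [s ->] [t ->]; exists (s ++ t); rewrite big_cat. Qed.

Lemma sos_polyM p q : sos_poly p -> sos_poly (p * q ^+ 2).
Proof.
move=> [s ->]; exists [seq r * q | r <- s].
by rewrite big_map big_distrl; apply: eq_bigr => r _; rewrite exprMn.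
Qed.

Lemma sos_polyC (c : R) : 0 <= c -> sos_poly c%:P.
Proof. by move=> c0; exists [:: (Num.sqrt c)%:P]; rewrite big_seq1 -polyC_exp sqr_sqrtr. Qed.

Lemma sos_polyZ (c : R) p : 0 <= c -> sos_poly p -> sos_poly (p * c%:P).
Proof. by move=> c0 Hp; rewrite -(sqr_sqrtr c0) polyC_exp; apply: sos_polyM. Qed.

Lemma uqm_sos g p : sos_poly p -> uqm g p.
Proof. by move=> sp; exists p, 0; split=> //; [apply: sos_poly0|rewrite mul0r addr0]. Qed.

Lemma uqmD g p q : uqm g p -> uqm g q -> uqm g (p + q).
Proof.
move=> [s0 [s1 [H0 H1 ->]]] [t0 [t1 [K0 K1 ->]]].
exists (s0 + t0), (s1 + t1); split; [exact: sos_polyD|exact: sos_polyD|ring].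
Qed.

Lemma uqmM g p q : uqm g p -> uqm g (p * q ^+ 2).
Proof.
move=> [s0 [s1 [H0 H1 ->]]]; exists (s0 * q ^+ 2), (s1 * q ^+ 2).
by split; [exact: sos_polyM|exact: sos_polyM|ring].
Qed.

Lemma uqmC g (c : R) : 0 <= c -> uqm g c%:P.
Proof. by move=> c0; apply/uqm_sos/sos_polyC. Qed.

Lemma uqmZ g (c : R) p : 0 <= c -> uqm g p -> uqm g (p * c%:P).
Proof. by move=> c0 Hp; rewrite -(sqr_sqrtr c0) polyC_exp; apply: uqmM. Qed.

Lemma uqm_le g (c d : R) p : c <= d -> uqm g (c%:P - p) -> uqm g (d%:P - p).
Proof.
move=> cd Hp; have -> : d%:P - p = (d - c)%:P + (c%:P - p) by rewrite polyCB; ring.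
by apply: uqmD => //; apply: uqmC; rewrite subr_ge0.
Qed.

(** (p X + a)^2 <= 2 p^2 X^2 + 2 a^2 and p^2 X^2 <= d X^2 <= d c. In one variable all squares may be
    multiplied in, so a bound on p^2 already bounds every power. *)
Lemma uqm_archimedean g (c : R) p : 0 < c -> uqm g (c%:P - 'X ^+ 2) ->
  exists2 d, 0 < d & uqm g (d%:P - p ^+ 2).
Proof.
move=> c0 HX; elim/poly_ind: p => [|p a [d d0 Hd]].
  by exists 1 => //; rewrite expr0n subr0; apply: uqmC.
exists (2 * (d * c) + 2 * (a ^+ 2 + 1)).
  have := sqr_ge0 a; have := mulr_gt0 d0 c0; lra.
have -> : (2 * (d * c) + 2 * (a ^+ 2 + 1))%:P - (p * 'X + a%:P) ^+ 2 =
   ((d%:P - p ^+ 2) * 'X ^+ 2 + (c%:P - 'X ^+ 2) * d%:P) * 2%:P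
   + 2%:P + (p * 'X - a%:P) ^+ 2.
  by rewrite !(polyCD, polyCM, polyC_exp); ring.
apply: uqmD; last by apply/uqm_sos/sos_polyX.
apply: uqmD; last exact: uqmC.
apply: uqmZ => //; apply: uqmD; first exact: uqmM.
by apply: uqmZ => //; apply: ltW.
Qed.

Lemma uqm_power g (d : R) p m : 0 <= d -> uqm g (d%:P - p ^+ 2) ->
  uqm g ((d ^+ m)%:P - p ^+ (2 * m)).
Proof.
move=> d0 Hp; elim: m => [|m IH]; first by rewrite !expr0 subrr; apply/uqm_sos/sos_poly0.
have -> : (d ^+ m.+1)%:P - p ^+ (2 * m.+1) =
   ((d ^+ m)%:P - p ^+ (2 * m)) * p ^+ 2 + (d%:P - p ^+ 2) * (d ^+ m)%:P.
  by rewrite mulnS exprD exprS polyCM; ring.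
apply: uqmD; first exact: uqmM.
by apply: uqmZ; rewrite ?exprn_ge0.
Qed.

End UnivariateModule.

(** * The cone of sparse certificates and its bounds on variables *)

Section SparseCone.
Variables (R : realType) (r n : nat).
Local Notation V := (vertex r n).
Local Notation P := (mpoly #|V| R).
Local Notation C := (@mpolyC #|V| R).
Variables (f : 'I_r -> 'I_n -> {poly R}) (g : 'I_n -> {poly R}).
Variables (N : nat) (I : 'I_N -> {set V}).

(** No degree bound is imposed: a derivation has finitely many leaves, hence fits into every
    sufficiently high relaxation order. *)
Inductive sparse_cone (J : 'I_N -> {set 'I_n}) (H : 'I_N -> {set 'I_r * 'I_n}) : P -> Prop :=
| cone_sq a p : poly_in (I a) p -> sparse_cone J H (p ^+ 2)
| cone_ineq a j p : j \in J a -> poly_in (I a) p -> sparse_cone J H (p ^+ 2 * univ (g j) j)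
| cone_eq a l i p : (l, i) \in H a -> poly_in (I a) p -> sparse_cone J H (p * lifting f l i)
| cone_add p q : sparse_cone J H p -> sparse_cone J H q -> sparse_cone J H (p + q).

Variables (xa : 'I_n -> 'I_N) (ha : 'I_r * 'I_n -> 'I_N).
Hypothesis hxa : forall j, xv r j \in I (xa j).
Hypothesis hha : forall l i, constraint_vars l i \subset I (ha (l, i)).
Hypothesis N0 : (0 < N)%N.

Local Notation M := (sparse_cone (assigned_to xa) (assigned_to ha)).

Lemma sparse_coneC c : 0 <= c -> M (C c).
Proof.
move=> c0; rewrite -(sqr_sqrtr c0) rmorphXn.
exact/(cone_sq _ _ (a := Ordinal N0))/poly_inC.
Qed.

Lemma sparse_coneZ c p : 0 <= c -> M p -> M (C c * p).
Proof.
move=> c0; elim=> [a q Sq|a j q ja Sq|a l i q lia Sq|q q' _ IH _ IH'].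
- rewrite -(sqr_sqrtr c0) rmorphXn -exprMn.
  by apply: (cone_sq _ _ (a := a)); apply: poly_inM => //; apply: poly_inC.
- rewrite -(sqr_sqrtr c0) rmorphXn mulrA -exprMn.
  by apply: (cone_ineq _ (a := a)) => //; apply: poly_inM => //; apply: poly_inC.
- rewrite mulrA.
  by apply: (cone_eq _ (a := a)) => //; apply: poly_inM => //; apply: poly_inC.
- by rewrite mulrDr; apply: cone_add.
Qed.

Lemma sparse_cone0 : M 0.
Proof. by rewrite -(rmorph0 C); apply: sparse_coneC. Qed.

Lemma sparse_cone_sum (T : Type) (s : seq T) (Q : pred T) (F : T -> P) :
  (forall j, Q j -> M (F j)) -> M (\sum_(j <- s | Q j) F j).
Proof. by move=> HF; apply: big_ind => //; [exact: sparse_cone0|exact: cone_add]. Qed.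

Lemma univC (c : R) j : univ c%:P j = C c.
Proof. by rewrite /univ horner_algC alg_mpolyC. Qed.

(** All multipliers are polynomials in x_j, which belongs to the clique [xa j] of g_j. *)
Lemma sparse_cone_uqm j p : uqm (g j) p -> M (univ p j).
Proof.
move=> [s0 [s1 [[t0 ->] [t1 ->] ->]]].
rewrite /univ rmorphD rmorphM !rmorph_sum big_distrl /=.
apply: cone_add; apply: sparse_cone_sum => q _; rewrite rmorphXn.
  by apply: (cone_sq _ _ (a := xa j)); apply: (poly_in_univ q).
apply: (cone_ineq _ (a := xa j)); first by rewrite inE.
exact: (poly_in_univ q).
Qed.

Definition infeasible j : Prop := forall x, (g j).[x] < 0.

(** Multiplying - g_j = e + (sum of q^2) by p^2 gives - e p^2 = p^2 g_j + (sum of (p q)^2). *)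
Lemma infeasible_clique j p : infeasible j -> poly_in (I (xa j)) p -> M (- p ^+ 2).
Proof.
move=> inf Sp; have [|e e0 [s sE]] := @pos_poly_sos R (- g j).
  by move=> x; rewrite hornerN oppr_gt0.
have -> : - p ^+ 2 = C e^-1 * (p ^+ 2 * univ (g j) j + \sum_(q <- s) (p * univ q j) ^+ 2).
  have -> : univ (g j) j = - (C e + \sum_(q <- s) univ q j ^+ 2).
    rewrite -[g j]opprK sE /univ rmorphN rmorphD rmorph_sum /=.
    rewrite [X in X + _](univC e j); congr (- (_ + _)).
    by apply: eq_bigr => q _; rewrite rmorphXn.
  have -> : \sum_(q <- s) (p * univ q j) ^+ 2 = p ^+ 2 * \sum_(q <- s) univ q j ^+ 2.
    by rewrite big_distrr; apply: eq_bigr => q _; rewrite exprMn.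
  have ee : C e^-1 * C e = 1 by rewrite -rmorphM mulVf ?gt_eqF // rmorph1.
  rewrite -[in LHS](mul1r (p ^+ 2)) -ee; ring.
apply: sparse_coneZ; first by rewrite invr_ge0 ltW.
apply: cone_add; first by apply: (cone_ineq _ (a := xa j)) => //; rewrite inE.
apply: sparse_cone_sum => q _; apply: (cone_sq _ _ (a := xa j)).
by apply: poly_inM => //; apply: poly_in_univ.
Qed.

Section Substitution.
Variables (rho : R) (q : 'I_N -> P).
Hypothesis hq : forall a, poly_in (I a) (q a) /\ quadratic_module g (I a) (assigned_to xa a) (q a).
Hypothesis hball : C (rho ^+ 2) - \sum_(j < n) var (xv r j) ^+ 2 = \sum_(a < N) q a.
Variables (j : 'I_n) (xbar : 'I_n -> R).

(** The [q a] may involve the t_{l,i}, but the left side of the ball identity does not, so these are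
    set to 0. Where g_i is nonnegative at [xbar i], the other constraints become nonnegative
    constants. *)
Definition subst_pt (i : 'I_#|V|) : {poly R} :=
  match enum_val i with
  | inl i => if i == j then 'X else (xbar i)%:P
  | inr _ => 0
  end.

Definition subst (p : P) : {poly R} := mmap (@polyC R) subst_pt p.

Lemma subst_rmorph : exists th : {rmorphism P -> {poly R}}, th =1 subst.
Proof. by exists (mmap (@polyC R) subst_pt). Qed.

Lemma subst_const (D : {set V}) p : xv r j \notin D -> poly_in D p -> exists c, subst p = c%:P.
Proof.
move=> jD /poly_inP Sp; rewrite /subst /mmap.
have K (T : eqType) (s : seq T) (F : T -> {poly R}) :
   (forall i, i \in s -> exists c, F i = c%:P) -> exists c, \sum_(i <- s) F i = c%:P.
  elim: s => [|i s IH] HF; first by exists 0; rewrite big_nil.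
  have [c cE] := HF i (mem_head _ _).
  have [|d dE] := IH; first by move=> k ks; apply: HF; rewrite inE ks orbT.
  by exists (c + d); rewrite big_cons cE dE polyCD.
apply: K => m /Sp /forallP mD.
suff [c cE] : exists c, mmap1 subst_pt m = c%:P by exists (mcoeff m p * c); rewrite cE polyCM.
rewrite /mmap1; apply: (big_ind (fun x : {poly R} => exists c, x = c%:P)).
- by exists 1.
- by move=> x y [c ->] [d ->]; exists (c * d); rewrite polyCM.
move=> i _; rewrite /subst_pt; case E: (enum_val i) => [k|lk]; last first.
  by exists (0 ^+ m i); rewrite polyC_exp.
case: (eqVneq k j) => [kj|_]; last by exists (xbar k ^+ m i); rewrite polyC_exp.
have := mD (enum_val i); rewrite E kj jD /= => /eqP; rewrite -kj -E enum_valK => ->.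
by exists 1; rewrite expr0.
Qed.

Lemma subst_var i : subst (var (xv r i)) = if i == j then 'X else (xbar i)%:P.
Proof. by rewrite /subst /var mmapX mmap1U /subst_pt enum_rankK. Qed.

Hypothesis hxbar : forall i, infeasible i \/ 0 <= (g i).[xbar i].

Lemma subst_quadratic_module a : (forall i, xa i = a -> ~ infeasible i) ->
  uqm (g j) (subst (q a)).
Proof.
move=> feas; have [th thE] := subst_rmorph; rewrite -thE.
have [_ [s0 [s [Hs0 Hs ->]]]] := hq a.
have sosth p : is_sos (I a) p -> sos_poly (th p).
  move=> [ps [_ ->]]; exists [seq th x | x <- ps].
  by rewrite big_map rmorph_sum; apply: eq_bigr => x _; rewrite rmorphXn.
rewrite rmorphD rmorph_sum; apply: uqmD; first exact/uqm_sos/sosth.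
apply: big_ind => [||i]; [exact/uqm_sos/sos_poly0|exact: uqmD|].
rewrite inE => /eqP ia; rewrite rmorphM /= univE.
have -> : th (map_poly C (g i)).[var (xv r i)] = g i \Po subst (var (xv r i)).
  rewrite -thE /= -horner_map -map_poly_comp /comp_poly; congr (_.[_]).
  by apply: eq_map_poly => c /=; rewrite thE /subst mmapC.
have si : sos_poly (th (s i)) by apply/sosth/Hs; rewrite inE ia.
rewrite subst_var; case: eqP => [ij|_].
  rewrite comp_polyXr; exists 0, (th (s i)); split; [exact: sos_poly0|by []|].
  by rewrite add0r ij.
rewrite comp_polyCr; apply/uqm_sos/sos_polyZ => //.
by case: (hxbar i) => // inf; case: (feas i ia).
Qed.

(** A clique carrying an infeasible constraint does not contain x_j, so its [q a] turns into a
    constant, of unknown sign, which [c] cancels. *)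
Lemma subst_bound a : (forall i, infeasible i -> xv r j \notin I (xa i)) ->
  exists c, uqm (g j) (subst (q a) + c%:P).
Proof.
move=> feas; case: (pselect (exists i, xa i = a /\ infeasible i)) => [[i [ia inf]]|no].
  have [||c ->] := @subst_const (I a) (q a); [by rewrite -ia; apply: feas|by case: (hq a)|].
  by exists (- c); rewrite -polyCD subrr; apply/uqm_sos/sos_poly0.
exists 0; rewrite addr0; apply: subst_quadratic_module => i ia inf.
by apply: no; exists i.
Qed.

Lemma subst_ball : (forall i, infeasible i -> xv r j \notin I (xa i)) ->
  exists2 c, 0 < c & uqm (g j) (c%:P - 'X ^+ 2).
Proof.
move=> feas; have [K HK] : exists K, uqm (g j) (\sum_a subst (q a) + K%:P).
  elim: (index_enum _) => [|a t [K HK]].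
    by exists 0; rewrite big_nil addr0; apply/uqm_sos/sos_poly0.
  have [c Hc] := subst_bound a feas; exists (c + K).
  by rewrite big_cons polyCD addrACA; apply: uqmD.
pose S2 := \sum_(i < n | i != j) xbar i ^+ 2.
exists (1 + `|rho ^+ 2 - S2 + K|); first by rewrite ltr_wpDr.
apply: (@uqm_le _ _ (rho ^+ 2 - S2 + K)).
  by have := ler_norm (rho ^+ 2 - S2 + K); lra.
suff E : \sum_a subst (q a) = (rho ^+ 2 - S2)%:P - 'X ^+ 2.
  have -> : (rho ^+ 2 - S2 + K)%:P - 'X ^+ 2 = (rho ^+ 2 - S2)%:P - 'X ^+ 2 + K%:P.
    by rewrite [in LHS]polyCD addrAC.
  by rewrite -E.
have [th thE] := subst_rmorph.
under eq_bigr do rewrite -thE.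
rewrite -rmorph_sum -hball rmorphB rmorph_sum /=.
have thC c : th (C c) = c%:P by rewrite thE /subst mmapC.
have thX i : th (var (xv r i) ^+ 2) = (if i == j then 'X else (xbar i)%:P) ^+ 2.
  by rewrite rmorphXn /= thE subst_var.
rewrite thC (bigD1 j) //= thX eqxx polyCB /S2 rmorph_sum /= opprD addrA addrAC.
congr (_ - _ - _); apply: eq_bigr => i ij.
by rewrite thX (negPf ij) polyC_exp.
Qed.

End Substitution.

(* Fixing all variables but x_j turns the ball identity into a univariate one.
   In a clique with an infeasible constraint nothing is known about q, but there
   the cone contains - p ^+ 2 for every p. *)
Lemma coordinate_bounded (rho : R) (q : 'I_N -> P) (j : 'I_n) :
    (forall a, poly_in (I a) (q a) /\ quadratic_module g (I a) (assigned_to xa a) (q a)) ->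
    C (rho ^+ 2) - \sum_(j < n) var (xv r j) ^+ 2 = \sum_(a < N) q a ->
  (exists2 c, 0 < c & uqm (g j) (c%:P - 'X ^+ 2)) \/
  (exists2 i, infeasible i & xv r j \in I (xa i)).
Proof.
move=> hq hball; case: (pselect (exists2 i, infeasible i & xv r j \in I (xa i))); first by right.
move=> no; left.
have /choice[xbar hxbar] : forall i, exists x, infeasible i \/ 0 <= (g i).[x].
  move=> i; case: (pselect (infeasible i)) => inf; first by exists 0; left.
  apply: contrapT => nex; apply: inf => x; rewrite ltNge; apply/negP => gx.
  by apply: nex; exists x; right.
apply: (subst_ball hq hball hxbar) => i inf; apply/negP => ji.
by apply: no; exists i.
Qed.

Lemma univ_power_bounded (rho : R) (q : 'I_N -> P) (j : 'I_n) (p : {poly R}) :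
    (forall a, poly_in (I a) (q a) /\ quadratic_module g (I a) (assigned_to xa a) (q a)) ->
    C (rho ^+ 2) - \sum_(j < n) var (xv r j) ^+ 2 = \sum_(a < N) q a ->
  exists2 d, 0 < d & power_bounded C M d (univ p j).
Proof.
move=> hq hball; case: (coordinate_bounded j hq hball) => [[c c0 Hc]|[i inf ji]].
  have [d d0 Hd] := uqm_archimedean p c0 Hc; exists d => // m.
  have := sparse_cone_uqm (uqm_power m (ltW d0) Hd).
  have -> // : univ ((d ^+ m)%:P - p ^+ (2 * m)) j = C (d ^+ m) - univ p j ^+ (2 * m).
  by rewrite -(univC (d ^+ m) j) /univ rmorphB [X in _ - X = _]rmorphXn.
(* Here [M] contains the negative of the square of p(x_j)^m, so the constant 1 bounds every
   power. *)
exists 1 => // m; rewrite expr1n; apply: cone_add; first exact: sparse_coneC.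
rewrite mulnC exprM; apply: (infeasible_clique inf).
by apply/poly_inX/poly_in_univ.
Qed.

(** The difference of equal powers of [p'] and [p] is a multiple of h_{l,i} within the clique, and
    multiples of h_{l,i} enter the cone with either sign. *)
Lemma cone_congruence a l i p p' c : (l, i) \in assigned_to ha a ->
    poly_in (I a) p -> poly_in (I a) p' -> p' - p = lifting f l i ->
  power_bounded C M c p -> power_bounded C M c p'.
Proof.
move=> lia Sp Sp' E Hp m.
have -> : C (c ^+ m) - p' ^+ (2 * m) = C (c ^+ m) - p ^+ (2 * m) - (p' ^+ (2 * m) - p ^+ (2 * m)).
  by ring.
apply: cone_add; first exact: Hp.
rewrite subrXX E -mulrN mulrC.
apply: (cone_eq _ lia); apply/poly_inN/poly_in_sum => k _.
by apply: poly_inM; apply: poly_inX.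
Qed.

Lemma var_power_bounded (rho : R) (q : 'I_N -> P) v :
    (forall a, poly_in (I a) (q a) /\ quadratic_module g (I a) (assigned_to xa a) (q a)) ->
    C (rho ^+ 2) - \sum_(j < n) var (xv r j) ^+ 2 = \sum_(a < N) q a ->
  exists2 c, 0 < c & power_bounded C M c (var v).
Proof.
move=> hq hball; case: v => [j|[l i]].
  have [c c0] := univ_power_bounded j 'X hq hball.
  by rewrite /univ horner_algX; exists c.
have [m im] : exists m, nat_of_ord i = m by exists i.
elim: m i im => [|m IH] i im; have Sl := poly_in_lifting f l i.
  have [c c0 Hc] := univ_power_bounded i (f l i) hq hball; exists c => //.
  have lvars := hha l i; rewrite /constraint_vars im eqxx in lvars.
  apply: (cone_congruence (a := ha (l, i)) (l := l) (i := i) _ _ _ _ Hc).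
  - by rewrite inE.
  - by apply: poly_in_univ; apply: (fintype.subsetP lvars); rewrite !inE eqxx orbT.
  - by apply: poly_in_var; apply: (fintype.subsetP lvars); rewrite !inE eqxx.
  - by rewrite /lifting im eqxx.
have im' : nat_of_ord (ord_pred i) = m.
  by rewrite /= im addSn /= modnDr modn_small // ltnW // -im.
have [c c0 Hc] := univ_power_bounded i (f l i) hq hball.
have [d d0 Hd] := IH _ im'; exists (d * c); first exact: mulr_gt0.
have lvars := hha l i; rewrite /constraint_vars im /= in lvars.
have Sx : poly_in (I (ha (l, i))) (univ (f l i) i : P).
  by apply: poly_in_univ; apply: (fintype.subsetP lvars); rewrite !inE eqxx !orbT.
have St : poly_in (I (ha (l, i))) (var (tv l (ord_pred i)) : P).
  by apply: poly_in_var; apply: (fintype.subsetP lvars); rewrite !inE eqxx !orbT.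
apply: (cone_congruence (a := ha (l, i)) (l := l) (i := i)
          (p := var (tv l (ord_pred i)) * univ (f l i) i)).
- by rewrite inE.
- exact: poly_inM.
- by apply: poly_in_var; apply: (fintype.subsetP lvars); rewrite !inE eqxx.
- by rewrite /lifting im.
(* Both factors lie in the clique of the constraint, whose squares belong to the cone; this is where
   t_{l,i-1} and x_i must share a clique. *)
apply: (power_boundedM _ _ (poly_inC (I (ha (l, i)))) (@poly_inD _ _ _ _)
          (@poly_inM _ _ _ _)) => //.
- exact: cone_add.
- exact: sparse_coneZ.
- by move=> p; apply: cone_sq.
Qed.

End SparseCone.

(** * Certificates below the optimal value *)

Lemma sum_assigned (A : finType) (N : nat) (s : A -> 'I_N) (S : nmodType) (F : A -> S) :
  \sum_(a < N) \sum_(x in assigned_to s a) F x = \sum_x F x.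
Proof.
rewrite [RHS](partition_big s xpredT) //=; apply: eq_bigr => a _.
by apply: eq_bigl => x; rewrite inE.
Qed.

Section Certificate.
Variables (R : realType) (r n : nat) (hn : (0 < n)%N).
Local Notation V := (vertex r n).
Local Notation P := (mpoly #|V| R).
Local Notation C := (@mpolyC #|V| R).
Variables (f : 'I_r -> 'I_n -> {poly R}) (g : 'I_n -> {poly R}).

Lemma eval_atC (z : V -> R) c : eval_at z (C c) = c.
Proof. exact: mevalC. Qed.

Lemma eval_atM (z : V -> R) p p' : eval_at z (p * p') = eval_at z p * eval_at z p'.
Proof. exact: mevalM. Qed.

Lemma eval_atX (z : V -> R) p k : eval_at z (p ^+ k) = eval_at z p ^+ k.
Proof. exact: rmorphXn. Qed.

Lemma eval_atD (z : V -> R) p p' : eval_at z (p + p') = eval_at z p + eval_at z p'.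
Proof. exact: mevalD. Qed.

Lemma eval_atB (z : V -> R) p p' : eval_at z (p - p') = eval_at z p - eval_at z p'.
Proof. exact: mevalB. Qed.

Lemma eval_at_sum (z : V -> R) (T : Type) (s : seq T) (Q : pred T) (F : T -> P) :
  eval_at z (\sum_(j <- s | Q j) F j) = \sum_(j <- s | Q j) eval_at z (F j).
Proof. exact: raddf_sum. Qed.

Lemma eval_at_var (z : V -> R) v : eval_at z (var v) = z v.
Proof. by rewrite /eval_at mevalXU enum_rankK. Qed.

Lemma eval_at_univ (z : V -> R) p i : eval_at z (univ p i) = p.[z (xv r i)].
Proof.
rewrite univE /eval_at -horner_map -map_poly_comp /= -/(eval_at z _) eval_at_var.
by congr (_.[_]); apply: map_poly_id => c _ /=; apply: mevalC.
Qed.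

Lemma eval_at_objective (z : V -> R) lam :
  eval_at z (\sum_l var (tv l (ord_last hn)) - C lam) =
  \sum_(l < r) z (tv l (ord_last hn)) - lam.
Proof.
rewrite eval_atB eval_atC eval_at_sum; congr (_ - _).
by apply: eq_bigr => l _; apply: eval_at_var.
Qed.

Variables (E : rel V) (hE : chordal_extension constraint_graph E).
Variables (N : nat) (I : 'I_N -> {set V}) (hI : enumerates_maximal_cliques E I).
Variables (xa : 'I_n -> 'I_N) (hxa : forall j, xv r j \in I (xa j)).
Variables (ha : 'I_r * 'I_n -> 'I_N).
Hypothesis hha : forall l i, constraint_vars l i \subset I (ha (l, i)).
Variables (ta : 'I_r -> 'I_N) (hta : forall l, tv l (ord_last hn) \in I (ta l)).
Variables (rho : R) (q : 'I_N -> P).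
Hypothesis hq : forall a, poly_in (I a) (q a) /\ quadratic_module g (I a) (assigned_to xa a) (q a).
Hypothesis hball : C (rho ^+ 2) - \sum_(j < n) var (xv r j) ^+ 2 = \sum_(a < N) q a.

Local Notation M := (sparse_cone f g I (assigned_to xa) (assigned_to ha)).

Lemma maximal_clique_is_clique a : is_clique E (I a).
Proof. by case: hI => _ /(_ (I a)) [_ H]; case/maxsetP: (H (ex_intro _ a erefl)). Qed.

Lemma clique_sub_maximal D : is_clique E D -> exists a, D \subset I a.
Proof.
move=> cD; have [D' maxD' DD'] := maxset_exists cD.
by case: hI => _ /(_ D') [H _]; have [a aE] := H maxD'; exists a; rewrite aE.
Qed.

Lemma objective_in_cone lam :
    (forall z : V -> R, (forall j, 0 <= (g j).[z (xv r j)]) ->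
       (forall l i, eval_at z (lifting f l i) = 0) ->
       lam < \sum_l z (tv l (ord_last hn))) ->
  M (\sum_l var (tv l (ord_last hn)) - C lam).
Proof.
move=> pos.
have N0 : (0 < N)%N by apply: leq_ltn_trans (ltn_ord (xa (ord_last hn))).
have [c Hc] : exists c, 0 < c /\ forall v, power_bounded C M c (var v).
  have /choice[c Hc] : forall v, exists c, 0 < c /\ power_bounded C M c (var v).
    by move=> v; have [c c0 Hc] := var_power_bounded f hxa hha N0 v hq hball; exists c.
  have c0 v : 0 <= c v by apply: ltW; case: (Hc v).
  exists (1 + \sum_v c v); split; first by rewrite ltr_wpDr // sumr_ge0.
  move=> v; case: (Hc v) => cv0 Hv.
  apply: (power_bounded_le (@cone_add _ _ _ f g _ I _ _) _ (ltW cv0) _ Hv).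
    exact: sparse_coneC.
  rewrite (bigD1 v) //= addrCA lerDl addr_ge0 // sumr_ge0 // => w _; exact: c0.
have [s s0 Mv] : exists2 s, 0 < s & forall v, power_bounded C M (s ^+ 2) (var v).
  case: Hc => c0 Hc; exists (Num.sqrt c); first by rewrite sqrtr_gt0.
  by move=> v; rewrite sqr_sqrtr ?ltW.
pose A : set 'rV[R]_#|V| := [set x : 'rV[R]_#|V| | forall i, x ord0 i \in `[- s, s]%R]%classic.
have cA : compact A.
  exact: (@rV_compact R #|V| (fun=> [set` `[- s, s]%R]%classic) (fun=> @segment_compact R _ _)).
pose ev (x : 'rV[R]_#|V|) (p : P) := meval (fun i => x ord0 i) p.
have evE x p : ev x p = eval_at (fun v => x ord0 (enum_rank v)) p.
  by apply: meval_eq => i; rewrite enum_valK.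
have [||||w [B [Lam [eta [k [w0 B0 Lam0 eta0 Hpen]]]]]] :=
   @penalization R 'rV[R]_#|V| A
     (fun x => ev x (\sum_l var (tv l (ord_last hn)) - C lam)) n
     (fun j x => ev x (univ (g j) j)) ('I_r * 'I_n)%type
     (fun li x => ev x (lifting f li.1 li.2)) cA.
- exact: meval_continuous.
- by move=> j; apply: meval_continuous.
- by move=> li; apply: meval_continuous.
- move=> x _ Hg Hh; rewrite evE eval_at_objective subr_gt0.
  apply: (pos (fun v => x ord0 (enum_rank v))) => [j|l i].
    by have := Hg j; rewrite evE eval_at_univ.
  by have := Hh (l, i); rewrite evE.
(* The square of [wg j] is the penalty weight, so the penalty is a generator of the cone. *)
pose wg j : {poly R} := (Num.sqrt w)%:P * (1 - B^-1 *: g j) ^+ k.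
pose a0 := Ordinal N0.
(* Each penalty goes to the clique of its constraint, and the constant to [a0]. *)
pose F a : P := \sum_(l in assigned_to ta a) var (tv l (ord_last hn))
   - (if a == a0 then C lam else 0)
   - \sum_(j in assigned_to xa a) univ (wg j) j ^+ 2 * univ (g j) j
   + \sum_(li in assigned_to ha a) C Lam * lifting f li.1 li.2 ^+ 2.
have FE : \sum_a F a = \sum_l var (tv l (ord_last hn)) - C lam
   - \sum_j univ (wg j) j ^+ 2 * univ (g j) j
   + \sum_(li : 'I_r * 'I_n) C Lam * lifting f li.1 li.2 ^+ 2.
  rewrite /F big_split /= sumrB sumrB !sum_assigned; congr (_ - _ - _ + _).
  by rewrite -big_mkcond big_pred1_eq.
have SF a : poly_in (I a) (F a).
  have Sh li : li \in assigned_to ha a -> poly_in (I a) (lifting f li.1 li.2 : P).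
    case: li => l i; rewrite inE => /eqP <-.
    exact: poly_in_sub (hha l i) (poly_in_lifting f l i).
  apply: poly_inD; first (apply: poly_inB; first (apply: poly_inB)).
  - by apply: poly_in_sum => l; rewrite inE => /eqP <-; apply: poly_in_var.
  - by case: eqP => _; [|rewrite -(rmorph0 C)]; apply: poly_inC.
  - apply: poly_in_sum => j; rewrite inE => /eqP <-.
    by apply: poly_inM; [apply: poly_inX|]; apply: poly_in_univ.
  - apply: poly_in_sum => li /Sh Shli.
    by apply: poly_inM; [apply: poly_inC|apply: poly_inX].
have MF : M (\sum_a F a).
  have [EC EI _ ECh] := hE.
  apply: (box_positive s0 (@cone_add _ _ _ f g _ I _ _) _ _ Mv EC EI ECh
     maximal_clique_is_clique clique_sub_maximal _ N0 SF eta0).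
  - by move=> c' p; apply: sparse_coneZ.
  - by move=> c'; apply: sparse_coneC.
  - by move=> a p; apply: cone_sq.
  move=> z zs; pose x : 'rV[R]_#|V| := \row_i z (enum_val i).
  have xz p : ev x p = eval_at z p by apply: meval_eq => i; rewrite mxE.
  have Ax : A x by move=> i; rewrite mxE in_itv /= -ler_norml.
  apply: (le_trans (Hpen x Ax)); rewrite le_eqVlt; apply/orP; left; apply/eqP.
  rewrite -eval_at_sum FE eval_atD eval_atB !eval_at_sum xz; congr (_ - _ + _).
    apply: eq_bigr => j _; rewrite xz eval_atM eval_atX !eval_at_univ; congr (_ * _).
    by rewrite /wg !hornerE exprMn sqr_sqrtr // -exprM mulnC [_ / B]mulrC.
  rewrite big_distrr; apply: eq_bigr => li _ /=.
  by rewrite xz eval_atM eval_atX eval_atC.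
(* Undoing the penalties stays in the cone: [Lam] times h^2 is subtracted as a multiple of h. *)
have -> : \sum_l var (tv l (ord_last hn)) - C lam = \sum_a F a +
   (\sum_j univ (wg j) j ^+ 2 * univ (g j) j
   + \sum_(li : 'I_r * 'I_n) (- (C Lam * lifting f li.1 li.2)) * lifting f li.1 li.2).
  rewrite FE; under [X in _ + (_ + X)]eq_bigr do rewrite mulNr -mulrA -expr2.
  by rewrite sumrN; ring.
apply: cone_add => //; apply: cone_add; apply: sparse_cone_sum => //.
- move=> j _; apply: (cone_ineq _ _ _ (a := xa j)); first by rewrite inE.
  exact: poly_in_univ.
- case=> l i _; apply: (cone_eq _ _ _ (a := ha (l, i))); first by rewrite inE.
  apply/poly_inN/poly_inM; first exact: poly_inC.
  exact: poly_in_sub (hha l i) (poly_in_lifting f l i).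
Qed.

End Certificate.

(** * Moment and Gram matrices *)

Section Psd.
Variable R : realType.

Lemma psd_congr m k (T : 'M[R]_(m, k)) (A : 'M[R]_m) : psd A -> psd (T^T *m A *m T).
Proof.
move=> [sA pA]; split; first by rewrite !trmx_mul trmxK sA mulmxA.
by move=> u; have := pA (T *m u); rewrite trmx_mul !mulmxA.
Qed.

Lemma psd0 m : psd (0 : 'M[R]_m).
Proof. by split=> [|u]; rewrite ?trmx0 // mulmx0 mul0mx mxE. Qed.

Lemma psdD m (A B : 'M[R]_m) : psd A -> psd B -> psd (A + B).
Proof.
move=> [sA pA] [sB pB]; split; first by rewrite raddfD /= sA sB.
by move=> u; rewrite mulmxDr mulmxDl mxE addr_ge0.
Qed.

Lemma psd_rank1 m (c : 'cV[R]_m) : psd (c *m c^T).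
Proof.
split; first by rewrite trmx_mul trmxK.
move=> u; rewrite -mulmxA -mulmxA mulmxA mxE big_ord1.
have -> : (u^T *m c) 0 0 = (c^T *m u) 0 0 by rewrite -[in LHS](trmxK c) -trmx_mul mxE.
by rewrite -expr2 sqr_ge0.
Qed.

End Psd.

Section MonomialBases.
Variables (R : realType) (r n : nat).
Local Notation V := (vertex r n).
Local Notation P := (mpoly #|V| R).
Local Notation C := (@mpolyC #|V| R).
Implicit Types (I : {set V}) (p q g : P) (Y : multinom #|V| -> R).

Lemma bmon_val_inj I d : injective (@bmon_val r n I d).
Proof. by move=> u v uv; apply/val_inj/val_inj. Qed.

Lemma bmon_val_in I d (u : bmon I d) : mon_in I (bmon_val u).
Proof. exact: (valP u). Qed.

Lemma mdeg_bmon_val I d (u : bmon I d) : (mdeg (bmon_val u) <= d)%N.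
Proof. by rewrite -ltnS; apply: bmdeg. Qed.

Lemma bmon_ex I d m : mon_in I m -> (mdeg m <= d)%N -> exists u : bmon I d, bmon_val u = m.
Proof.
move=> mI; rewrite -ltnS => md.
by exists (exist (fun m : bmultinom _ _ => mon_in I (bmnm m)) (BMultinom md) mI).
Qed.

Lemma sum_bmon (S : nmodType) I d (F : multinom #|V| -> S) (s : seq (multinom #|V|)) :
    uniq s -> (forall m, m \in s -> mon_in I m && (mdeg m <= d)%N) ->
    (forall m, m \notin s -> F m = 0) ->
  \sum_(u : bmon I d) F (bmon_val u) = \sum_(m <- s) F m.
Proof.
move=> us sI F0; rewrite (bigID (fun u => bmon_val u \in s)) /= [X in _ + X]big1 ?addr0; last first.
  by move=> u /F0.
rewrite -big_filter -[LHS](big_map (@bmon_val r n I d) xpredT F).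
apply: perm_big; apply: uniq_perm => //.
  rewrite (map_inj_uniq (@bmon_val_inj I d)); apply: filter_uniq; exact: index_enum_uniq.
move=> m; apply/mapP/idP => [[u + ->]|ms]; first by rewrite mem_filter => /andP[].
have /andP[mI md] := sI m ms; have [u uE] := bmon_ex mI md.
by exists u; rewrite // mem_filter uE ms mem_index_enum.
Qed.

(** Neither clique nor truncation degree appears; [riesz] agrees with it on polynomials of the
    clique within the degree bound. *)
Definition moment_fun Y p : R := \sum_(m <- msupp p) mcoeff m p * Y m.

Lemma riesz_moment_fun I d Y p : poly_in I p -> (msize p <= d.+1)%N ->
  riesz (fun u : bmon I d => Y (bmon_val u)) p = moment_fun Y p.
Proof.
move=> /poly_inP pI pd; apply: (sum_bmon (F := fun m => mcoeff m p * Y m)).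
- exact: msupp_uniq.
- move=> m mp; rewrite pI //= -ltnS; exact: leq_trans (msize_mdeg_lt mp) pd.
- by move=> m; rewrite -mcoeff_eq0 => /eqP ->; rewrite mul0r.
Qed.

(** Supports vary with the polynomial; a common index set makes linearity termwise. *)
Lemma moment_fun_wide Y p d : (msize p <= d.+1)%N ->
  moment_fun Y p = \sum_(u : bmon [set: V] d) mcoeff (bmon_val u) p * Y (bmon_val u).
Proof.
move=> pd; rewrite -(@riesz_moment_fun [set: V] d) //.
by apply/poly_inP => m _; apply/forallP => v; rewrite inE.
Qed.

Lemma moment_funD Y p q : moment_fun Y (p + q) = moment_fun Y p + moment_fun Y q.
Proof.
pose d := maxn (msize (p + q)) (maxn (msize p) (msize q)).
have d1 : (msize (p + q) <= d.+1)%N by rewrite leqW // leq_maxl.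
have d2 : (msize p <= d.+1)%N by rewrite leqW // /d maxnCA leq_maxl.
have d3 : (msize q <= d.+1)%N by rewrite leqW // /d maxnA leq_maxr.
rewrite !(moment_fun_wide Y (d := d)) // -big_split; apply: eq_bigr => u _ /=.
by rewrite mcoeffD mulrDl.
Qed.

Lemma moment_funZ Y c p : moment_fun Y (C c * p) = c * moment_fun Y p.
Proof.
pose d := maxn (msize (C c * p)) (msize p).
have d1 : (msize (C c * p) <= d.+1)%N by rewrite leqW // leq_maxl.
have d2 : (msize p <= d.+1)%N by rewrite leqW // leq_maxr.
rewrite !(moment_fun_wide Y (d := d)) // big_distrr; apply: eq_bigr => u _ /=.
by rewrite mcoeffCM mulrA.
Qed.

Lemma moment_fun0 Y : moment_fun Y 0 = 0.
Proof. by rewrite /moment_fun msupp0 big_nil. Qed.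

Lemma moment_fun_sum Y (T : Type) (s : seq T) (Q : pred T) (F : T -> P) :
  moment_fun Y (\sum_(j <- s | Q j) F j) = \sum_(j <- s | Q j) moment_fun Y (F j).
Proof. by apply: big_morph; [exact: moment_funD|exact: moment_fun0]. Qed.

Lemma moment_fun1 Y : moment_fun Y 1 = Y (mnm0).
Proof. by rewrite /moment_fun msupp1 big_seq1 mcoeff1 eqxx mul1r. Qed.

Lemma rieszE I d (y : bmon I d -> R) p :
  riesz y p = \sum_(u : bmon I d) mcoeff (bmon_val u) p * y u.
Proof. by []. Qed.

Lemma riesz_sum I d (y : bmon I d -> R) (T : Type) (s : seq T) (Q : pred T) (F : T -> P) :
  riesz y (\sum_(j <- s | Q j) F j) = \sum_(j <- s | Q j) riesz y (F j).
Proof.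
apply: big_morph => [p q|]; rewrite !rieszE.
  by rewrite -big_split; apply: eq_bigr => u _ /=; rewrite mcoeffD mulrDl.
by rewrite big1 // => u _; rewrite mcoeff0 mul0r.
Qed.

Lemma rieszZ I d (y : bmon I d -> R) c p : riesz y (C c * p) = c * riesz y p.
Proof.
rewrite !rieszE big_distrr; apply: eq_bigr => u _ /=.
by rewrite mcoeffCM mulrA.
Qed.

Definition mon_comb I m (u : 'cV[R]_#|{: bmon I m}|) : P :=
  \sum_i C (u i 0) * mpolyX R (bmon_val (enum_val i)).

Lemma mon_comb_in I m u : poly_in I (@mon_comb I m u).
Proof.
apply: poly_in_sum => i _; apply: poly_inM; first exact: poly_inC.
exact/poly_in_mon/bmon_val_in.
Qed.

Lemma msizeD_max p q d : (msize p <= d)%N -> (msize q <= d)%N -> (msize (p + q) <= d)%N.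
Proof. by move=> Hp Hq; apply: leq_trans (mmeasureD_le _ _ _) _; rewrite geq_max Hp Hq. Qed.

Lemma msize_sum_le (T : Type) (s : seq T) (Q : pred T) (F : T -> P) d :
  (forall j, Q j -> (msize (F j) <= d)%N) -> (msize (\sum_(j <- s | Q j) F j) <= d)%N.
Proof.
move=> HF; apply: (big_ind (fun p : P => (msize p <= d)%N)) => //.
  by rewrite mmeasure0.
by move=> p q; apply: msizeD_max.
Qed.

Lemma msizeCM_le c p : (msize (C c * p) <= msize p)%N.
Proof. by rewrite mul_mpolyC; apply: mmeasureZ_le. Qed.

Lemma mon_comb_msize I m u : (msize (@mon_comb I m u) <= m.+1)%N.
Proof.
apply: msize_sum_le => i _; apply: leq_trans (msizeCM_le _ _) _.
by rewrite mmeasureX ltnS mdeg_bmon_val.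
Qed.

Definition coef_vec I m p : 'cV[R]_#|{: bmon I m}| :=
  \col_i mcoeff (bmon_val (enum_val i)) p.

Lemma coef_vecK I m p : poly_in I p -> (msize p <= m.+1)%N -> mon_comb (coef_vec I m p) = p.
Proof.
move=> /poly_inP pI pm; rewrite [RHS]mpolyE /mon_comb.
rewrite -(sum_bmon (I := I) (d := m) (F := fun m => mcoeff m p *: mpolyX R m)).
- rewrite (reindex_onto (@enum_rank (bmon I m)) enum_val) /=; last by move=> i _; rewrite enum_valK.
  by apply: eq_big => [u|u _]; rewrite ?enum_rankK ?eqxx // mxE enum_rankK mul_mpolyC.
- exact: msupp_uniq.
- move=> u up; rewrite pI //= -ltnS; exact: leq_trans (msize_mdeg_lt up) pm.
- by move=> u; rewrite -mcoeff_eq0 => /eqP ->; rewrite scale0r.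
Qed.

Lemma localizing_mx_quad I d m g (y : bmon I d -> R) (u : 'cV[R]_#|{: bmon I m}|) :
  (u^T *m localizing_mx m g y *m u) 0 0 = riesz y (g * mon_comb u ^+ 2).
Proof.
have -> : g * mon_comb u ^+ 2 = \sum_j \sum_i C (u i 0 * u j 0) *
   (g * mpolyX R (bmon_val (enum_val i)) * mpolyX R (bmon_val (enum_val j))).
  rewrite expr2 /mon_comb big_distrr /= big_distrr; apply: eq_bigr => j _ /=.
  rewrite big_distrl big_distrr; apply: eq_bigr => i _ /=; rewrite rmorphM /=; ring.
rewrite riesz_sum mxE; apply: eq_bigr => j _; rewrite mxE riesz_sum big_distrl.
by apply: eq_bigr => i _ /=; rewrite rieszZ !mxE mulrAC.
Qed.

Lemma psd_localizing I d m g (y : bmon I d -> R) :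
  psd (localizing_mx m g y) <->
  (forall p, poly_in I p -> (msize p <= m.+1)%N -> 0 <= riesz y (g * p ^+ 2)).
Proof.
split=> [[_ H] p pI pm|H].
  by rewrite -(coef_vecK pI pm) -localizing_mx_quad.
split=> [|u]; first by apply/matrixP => i j; rewrite !mxE; congr riesz; ring.
by rewrite localizing_mx_quad; apply: H; [exact: mon_comb_in|exact: mon_comb_msize].
Qed.

Lemma moment_mxE I d m (y : bmon I d -> R) : moment_mx m y = localizing_mx m 1 y.
Proof. by apply/matrixP => i j; rewrite !mxE mul1r. Qed.

Lemma psd_moment I d m (y : bmon I d -> R) :
  psd (moment_mx m y) <->
  (forall p, poly_in I p -> (msize p <= m.+1)%N -> 0 <= riesz y (p ^+ 2)).
Proof.
rewrite moment_mxE psd_localizing.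
by split=> H p pI pm; have := H p pI pm; rewrite mul1r.
Qed.

Lemma gram_polyD I m (Q Q' : 'M[R]_#|{: bmon I m}|) :
  gram_poly (Q + Q') = gram_poly Q + gram_poly Q'.
Proof. by rewrite /gram_poly map_mxD mulmxDr mulmxDl mxE. Qed.

Lemma gram_poly0 I m : gram_poly (0 : 'M[R]_#|{: bmon I m}|) = 0.
Proof. by rewrite /gram_poly map_mx0 mulmx0 mul0mx mxE. Qed.

Lemma gram_poly_rank1 I m (u : 'cV[R]_#|{: bmon I m}|) :
  gram_poly (u *m u^T) = mon_comb u ^+ 2.
Proof.
have E : (map_mx C u^T *m monvec I m) 0 0 = mon_comb u.
  by rewrite mxE; apply: eq_bigr => i _; rewrite !mxE.
rewrite /gram_poly map_mxM -mulmxA -mulmxA mulmxA mxE big_ord1.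
have -> : ((monvec I m)^T *m map_mx C u) 0 0 = (map_mx C u^T *m monvec I m) 0 0.
  by rewrite -[in LHS](trmxK (map_mx C u)) -trmx_mul [LHS]mxE matrix.map_trmx.
by rewrite E expr2.
Qed.

(** The 0-1 matrix [T] picks the shorter monomial vector out of the longer one. *)
Lemma gram_poly_widen I m m' (Q : 'M[R]_#|{: bmon I m}|) : (m <= m')%N -> psd Q ->
  exists2 Q' : 'M[R]_#|{: bmon I m'}|, psd Q' & gram_poly Q' = gram_poly Q.
Proof.
move=> mm' pQ.
pose T : 'M[R]_(#|{: bmon I m}|, #|{: bmon I m'}|) :=
  \matrix_(i, j) (bmon_val (enum_val i) == bmon_val (enum_val j))%:R.
have TE : monvec I m = map_mx C T *m monvec I m'.
  apply/matrixP => i j; rewrite !mxE.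
  have [v vE] := bmon_ex (bmon_val_in (enum_val i)) (leq_trans (mdeg_bmon_val (enum_val i)) mm').
  rewrite (bigD1 (enum_rank v)) //= big1 ?addr0 => [|k kv].
    by rewrite !mxE enum_rankK vE eqxx rmorph1 mul1r.
  rewrite !mxE -vE (inj_eq (@bmon_val_inj I m')).
  case: eqP => [vk|]; last by rewrite rmorph0 mul0r.
  by rewrite vk enum_valK eqxx in kv.
exists (T^T *m Q *m T); first exact: psd_congr.
by rewrite /gram_poly TE !map_mxM -matrix.map_trmx trmx_mul !mulmxA.
Qed.

Lemma eval_gram_ge0 (z : V -> R) I m (Q : 'M[R]_#|{: bmon I m}|) : psd Q ->
  0 <= eval_at z (gram_poly Q).
Proof.
move=> [_ pQ]; pose u : 'cV[R]_#|{: bmon I m}| :=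
  \col_i eval_at z (mpolyX R (bmon_val (enum_val i))).
suff -> : eval_at z (gram_poly Q) = (u^T *m Q *m u) 0 0 by [].
rewrite /gram_poly [in LHS]mxE [in RHS]mxE eval_at_sum.
apply: eq_bigr => j _; rewrite eval_atM !mxE; congr (_ * _).
rewrite eval_at_sum; apply: eq_bigr => i _; rewrite eval_atM !mxE; congr (_ * _).
exact: eval_atC.
Qed.

Lemma eval_moment_fun (z : V -> R) p :
  eval_at z p = moment_fun (fun m => eval_at z (mpolyX R m)) p.
Proof.
rewrite {1}[p]mpolyE eval_at_sum; apply: eq_bigr => m _.
by rewrite -mul_mpolyC eval_atM eval_atC.
Qed.

End MonomialBases.

(** * Values of the relaxations *)

Section ExtendedReals.
Variable R : realType.
Local Open Scope ereal_scope.

Lemma le_ereal_by_reals (l s : \bar R) :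
  (forall lam : R, lam%:E < l -> lam%:E <= s) -> l <= s.
Proof.
move=> H; case: s H => [s| |] H; last 2 first.
- by rewrite leey.
- case: l H => [l| |] H; rewrite ?leNye //.
    by have := H (l - 1)%R; rewrite lte_fin ltrBlDr ltrDl ltr01 => /(_ isT).
  by have := H 0%R; rewrite ltry => /(_ isT).
case: l H => [l| |] H; rewrite ?leNye //.
  rewrite lee_fin leNgt; apply/negP => sl.
  by have := H ((l + s) / 2)%R; rewrite lte_fin lee_fin => H'; have := H' ltac:(lra); lra.
by have := H (s + 1)%R; rewrite ltry => /(_ isT); rewrite lee_fin gerDl ler10.
Qed.

(** The shift by [k0] is for sequences that are controlled only at relaxation orders. The third
    hypothesis identifies the supremum with [l], which may be infinite. *)
Lemma cvg_nondecreasing_from (u : nat -> \bar R) (l : \bar R) (k0 : nat) :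
    (forall k k', (k0 <= k)%N -> (k <= k')%N -> u k <= u k') ->
    (forall k, (k0 <= k)%N -> u k <= l) ->
    (forall lam : R, lam%:E < l -> exists k1, forall k, (k1 <= k)%N -> lam%:E <= u k) ->
  (u k @[k --> \oo] --> l)%classic.
Proof.
move=> mono ub lb; rewrite -(cvg_shiftn k0).
have -> : l = ereal_sup (range (fun n => u (n + k0)%N)).
  apply/eqP; rewrite eq_le; apply/andP; split.
    apply: le_ereal_by_reals => lam /lb[k1 Hk].
    apply: (le_trans (Hk (k1 + k0)%N (leq_addr _ _))).
    by apply: ereal_sup_ubound; exists k1.
  by apply: ge_ereal_sup => _ [k _ <-]; apply: ub; rewrite leq_addl.
apply: ereal_nondecreasing_cvgn => k k' kk'.
by apply: mono; rewrite ?leq_addl // leq_add2r.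
Qed.

End ExtendedReals.

Section Degrees.
Variables (R : realType) (r n : nat).
Local Notation V := (vertex r n).
Local Notation P := (mpoly #|V| R).
Local Notation C := (@mpolyC #|V| R).
Implicit Types (p q : P).

Lemma msizeM_add p q a b : (msize p <= a.+1)%N -> (msize q <= b.+1)%N ->
  (msize (p * q) <= (a + b).+1)%N.
Proof.
move=> pa qb; case: (eqVneq p 0) => [->|p0]; first by rewrite mul0r mmeasure0.
case: (eqVneq q 0) => [->|q0]; first by rewrite mulr0 mmeasure0.
rewrite msizeM //; move: (msize p) (msize q) pa qb => x y; clear; lia.
Qed.

Lemma msizeC_le (c : R) : (msize (C c) <= 1)%N.
Proof. by rewrite msizeC leq_b1. Qed.

Lemma msize_var (v : V) : msize (var v : P) = 2%N.
Proof. by rewrite /var msizeX mdeg1. Qed.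

Lemma msizeX_le p a m : (msize p <= a.+1)%N -> (msize (p ^+ m) <= (m * a).+1)%N.
Proof.
move=> pa; elim: m => [|m IH]; first by rewrite expr0 msizeC_le.
by rewrite exprS mulSn; apply: msizeM_add.
Qed.

Lemma msize_univ (p : {poly R}) i : (msize (univ p i : P) <= (size p).-1.+1)%N.
Proof.
rewrite univE horner_coef; apply: msize_sum_le => j _.
have jp : (j < size p)%N by apply: leq_trans (ltn_ord j) (size_poly _ _).
rewrite coef_map; apply: leq_trans (msizeCM_le _ _) _.
have := @msizeX_le (var (xv r i)) 1 j; rewrite msize_var muln1 => /(_ isT) H.
by apply: leq_trans H _; rewrite prednK // (leq_ltn_trans _ jp).
Qed.

Lemma half_deg_le (p : {poly R}) : ((size p).-1 <= 2 * half_deg p)%N.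
Proof. by rewrite /half_deg; move: (size p).-1 => m; lia. Qed.

End Degrees.

(** * Feasible moment families as truncations of one sequence *)

Section Relaxations.
Variables (R : realType) (r n : nat).
Local Notation V := (vertex r n).
Local Notation P := (mpoly #|V| R).
Local Notation C := (@mpolyC #|V| R).
Variables (f : 'I_r -> 'I_n -> {poly R}) (g : 'I_n -> {poly R}).
Variables (N : nat) (I : 'I_N -> {set V}) (J : 'I_N -> {set 'I_n}).
Variables (H : 'I_N -> {set 'I_r * 'I_n}) (obj : 'I_N -> P).
Hypothesis hJ : forall a j, j \in J a -> xv r j \in I a.
Hypothesis hH : forall a l i, (l, i) \in H a -> constraint_vars l i \subset I a.
Hypothesis Sobj : forall a, poly_in (I a) (obj a).
Hypothesis dobj : forall a, (msize (obj a) <= 2)%N.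

Local Notation feasible := (moment_feasible f g J H).

Definition restricted_moments (Y : multinom #|V| -> R) k (a : 'I_N) : bmon (I a) (2 * k) -> R :=
  fun u => Y (bmon_val u).
Arguments restricted_moments Y k a u : clear implicits.

(** A monomial common to two cliques is a monomial of their intersection, where the overlap
    condition applies. Monomials indexing no entry get the value 0. *)
Lemma feasible_moments k (y : forall a, bmon (I a) (2 * k) -> R) : feasible y ->
  exists Y, y = restricted_moments Y k.
Proof.
move=> [_ _ _ overlap _].
have /choice[Y HY] : forall m : multinom #|V|, exists c, forall a (u : bmon (I a) (2 * k)),
    bmon_val u = m -> y a u = c.
  move=> m; case: (pselect (exists a, exists u : bmon (I a) (2 * k), bmon_val u = m)); last first.
    by move=> no; exists 0 => a u um; case: no; exists a, u.
  move=> [a [u um]]; exists (y a u) => b v vm.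
  have [||w wm] := @bmon_ex _ _ (I b :&: I a) (2 * k) m.
  - apply/forallP => x; apply/implyP; rewrite finset.in_setI negb_and => /orP[xb|xa].
      by rewrite -vm; apply: (implyP (forallP (bmon_val_in v) x)).
    by rewrite -um; apply: (implyP (forallP (bmon_val_in u) x)).
  - by rewrite -um mdeg_bmon_val.
  by apply: (overlap b a w); rewrite ?vm ?um wm.
exists Y; apply: functional_extensionality_dep => a; apply/funext => u.
exact: HY.
Qed.

Lemma localizing_degree k p j : (half_deg (g j) <= k)%N ->
  (msize p <= (k - half_deg (g j)).+1)%N -> (msize (univ (g j) j * p ^+ 2 : P) <= (2 * k).+1)%N.
Proof.
move=> gk pk.
have uj := @msize_univ R r n (g j) j; have p2 := msizeX_le 2 pk.
apply: (leq_trans (msizeM_add uj p2)).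
by have := half_deg_le (g j); move: (half_deg _) gk (size _).-1 => h hk s sh; clear -hk sh; lia.
Qed.

Lemma square_degree k p : (msize p <= k.+1)%N -> (msize (p ^+ 2 : P) <= (2 * k).+1)%N.
Proof. exact: msizeX_le. Qed.

(* The overlap condition is what makes a feasible family come from one global
   sequence Y; the other conditions then only involve its functional. *)
Lemma feasibleP k Y : relaxation_order g k ->
  feasible (restricted_moments Y k) <->
  [/\ (forall a p, poly_in (I a) p -> (msize p <= k.+1)%N -> 0 <= moment_fun Y (p ^+ 2)),
      (forall a j p, j \in J a -> poly_in (I a) p -> (msize p <= (k - half_deg (g j)).+1)%N ->
         0 <= moment_fun Y (univ (g j) j * p ^+ 2)),
      (forall a l i q, (l, i) \in H a -> mon_in (I a) q ->
         deg_lt (mpolyX R q * lifting f l i) (2 * k) ->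
         moment_fun Y (mpolyX R q * lifting f l i) = 0)
    & (0 < N)%N -> Y mnm0 = 1].
Proof.
move=> [k1 gk].
have sq a p : poly_in (I a) p -> (msize p <= k.+1)%N ->
    riesz (restricted_moments Y k a) (p ^+ 2) = moment_fun Y (p ^+ 2).
  by move=> pI pk; rewrite riesz_moment_fun //; [exact: poly_inX|exact: square_degree].
have loc a j p : j \in J a -> poly_in (I a) p -> (msize p <= (k - half_deg (g j)).+1)%N ->
    riesz (restricted_moments Y k a) (univ (g j) j * p ^+ 2) =
    moment_fun Y (univ (g j) j * p ^+ 2).
  move=> ja pI pk; rewrite riesz_moment_fun //; last exact: localizing_degree.
  by apply: poly_inM; [apply/poly_in_univ/hJ|apply: poly_inX].
have eqc a l i q : (l, i) \in H a -> mon_in (I a) q ->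
    deg_lt (mpolyX R q * lifting f l i) (2 * k) ->
    riesz (restricted_moments Y k a) (mpolyX R q * lifting f l i) =
    moment_fun Y (mpolyX R q * lifting f l i).
  move=> lia qI dq; rewrite riesz_moment_fun //; last exact: leqW.
  by apply: poly_inM; [exact: poly_in_mon|exact: poly_in_sub (hH lia) (poly_in_lifting f l i)].
split=> [[c1 c2 c3 _ c5]|[c1 c2 c3 c5]].
  split=> [a p pI pk|a j p ja pI pk|a l i q lia qI dq|N0].
  - by rewrite -(sq a) //; have /psd_moment := c1 a; apply.
  - by rewrite -(loc a) //; have /psd_localizing := c2 a j ja; apply.
  - by rewrite -(eqc a) //; apply: c3.
  - by rewrite -(c5 (Ordinal N0)).
split=> [a|a j ja|a l i q lia qI dq|a b w u v uw vw|a].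
- by apply/psd_moment => p pI pk; rewrite sq //; exact: (c1 a).
- by apply/psd_localizing => p pI pk; rewrite loc //; exact: (c2 a).
- by rewrite eqc //; exact: (c3 a).
- by rewrite /restricted_moments uw vw.
- by apply: c5; apply: leq_ltn_trans (ltn_ord a).
Qed.

Lemma restricted_value k Y : (0 < k)%N ->
  \sum_(a < N) riesz (restricted_moments Y k a) (obj a) =
  moment_fun Y (\sum_(a < N) obj a).
Proof.
move=> k0; rewrite moment_fun_sum; apply: eq_bigr => a _.
by rewrite riesz_moment_fun //; apply: leq_trans (dobj a) _; clear -k0; lia.
Qed.

Lemma feasible_narrow k k' Y : relaxation_order g k -> relaxation_order g k' -> (k <= k')%N ->
  feasible (restricted_moments Y k') -> feasible (restricted_moments Y k).
Proof.
move=> hk hk' kk' /(feasibleP Y hk')[c1 c2 c3 c5]; apply/(feasibleP Y hk).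
split=> // [a p pI pk|a j p ja pI pk|a l i q lia qI dq].
- by apply: (c1 a) => //; apply: leq_trans pk _; rewrite ltnS.
- by apply: (c2 a) => //; apply: leq_trans pk _; rewrite ltnS leq_sub2r.
- by apply: (c3 a) => //; apply: leq_trans dq _; rewrite leq_mul2l kk' orbT.
Qed.

End Relaxations.

Arguments restricted_moments {R r n N I} Y k a u.

(** * Monotonicity and bounds of the two relaxation values *)

Section RelaxationValues.
Variables (R : realType) (r n : nat).
Local Notation V := (vertex r n).
Local Notation P := (mpoly #|V| R).
Local Notation C := (@mpolyC #|V| R).
Variables (f : 'I_r -> 'I_n -> {poly R}) (g : 'I_n -> {poly R}).
Variables (N : nat) (I : 'I_N -> {set V}) (J : 'I_N -> {set 'I_n}).
Variables (H : 'I_N -> {set 'I_r * 'I_n}) (obj : 'I_N -> P).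
Hypothesis hJ : forall a j, j \in J a -> xv r j \in I a.
Hypothesis hH : forall a l i, (l, i) \in H a -> constraint_vars l i \subset I a.
Hypothesis Sobj : forall a, poly_in (I a) (obj a).
Hypothesis dobj : forall a, (msize (obj a) <= 2)%N.
Hypothesis N0 : (0 < N)%N.

Local Notation restr := (@restricted_moments R r n N I).
Local Notation feasible := (moment_feasible f g J H).
Local Notation M := (sparse_cone f g I J H).

Lemma moment_value_nondecreasing k k' : relaxation_order g k -> relaxation_order g k' ->
  (k <= k')%N -> (moment_value f g I J H obj k <= moment_value f g I J H obj k')%E.
Proof.
move=> hk hk' kk'; apply/ereal_infP => _ [y /[dup] fy /feasible_moments[Y yE] <-].
apply: ereal_inf_lbound; exists (restr Y k).
  by apply: (feasible_narrow hJ hH hk hk' kk'); rewrite -yE.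
by rewrite yE !(restricted_value Sobj dobj) //; [case: hk'|case: hk].
Qed.

Lemma cone_moment_ge0 p : M p -> exists k0, forall k Y, (k0 <= k)%N -> relaxation_order g k ->
  feasible (restr Y k) -> 0 <= moment_fun Y p.
Proof.
elim=> [a q Sq|a j q ja Sq|a l i q lia Sq|q q' _ [k1 H1] _ [k2 H2]].
- exists (msize q) => k Y qk hk /(feasibleP f hJ hH Y hk)[c1 _ _ _].
  by apply: (c1 a) => //; apply: leqW.
- exists (msize q + half_deg (g j))%N => k Y qk hk /(feasibleP f hJ hH Y hk)[_ c2 _ _].
  rewrite mulrC; apply: (c2 a) => //; apply: leqW.
  by rewrite leq_subRL ?(leq_trans _ qk) ?leq_addl // addnC.
- exists (msize q + msize (lifting f l i : P))%N => k Y qk hk /(feasibleP f hJ hH Y hk)[_ _ c3 _].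
  (* The moment relaxation tests only monomial multiples of h_{l,i}, so the multiplier is
     expanded. *)
  rewrite {1}[q]mpolyE big_distrl moment_fun_sum big_seq big1 // => m mq /=.
  rewrite -mul_mpolyC -mulrA moment_funZ (c3 a) ?mulr0 //; first exact: (poly_inP _ _ Sq).
  have md := msize_mdeg_lt mq.
  have dX : (msize (mpolyX R m : P) <= (mdeg m).+1)%N by rewrite msizeX.
  apply: leq_trans (msizeM_add dX (leqnSn _)) _.
  by move: (msize _) (msize _) (mdeg m) qk md => x y z; clear; lia.
- exists (maxn k1 k2) => k Y; rewrite geq_max => /andP[k1k k2k] hk fY.
  by rewrite moment_funD addr_ge0 ?(H1 k Y) ?(H2 k Y).
Qed.

Lemma moment_value_ge lam : M (\sum_a obj a - C lam) ->
  exists k0, forall k, (k0 <= k)%N -> relaxation_order g k ->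
  (lam%:E <= moment_value f g I J H obj k)%E.
Proof.
move=> /cone_moment_ge0[k0 Hk]; exists k0 => k k0k hk.
apply/ereal_infP => _ [y /[dup] fy /feasible_moments[Y yE] <-].
rewrite yE (restricted_value Sobj dobj) //; last by case: hk.
rewrite yE in fy; have := Hk k Y k0k hk fy.
have -> : \sum_a obj a - C lam = \sum_a obj a + C (- lam) * 1 by rewrite mulr1 rmorphN.
rewrite moment_funD moment_funZ moment_fun1.
have /(feasibleP f hJ hH Y hk)[_ _ _ ->] // := fy.
by rewrite mulr1 subr_ge0 lee_fin.
Qed.

(** The identity of [sos_feasible] for an arbitrary polynomial, in order that certificates can be
    added. *)
Definition sos_cert k p : Prop :=
  exists (Q0 : forall a, 'M[R]_#|{: bmon (I a) k}|)
         (Q : forall a j, 'M[R]_#|{: bmon (I a) (k - half_deg (g j))}|)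
         (tau : 'I_N -> 'I_r -> 'I_n -> P),
    [/\ (forall a, psd (Q0 a)),
        (forall a j, psd (Q a j)),
        (forall a l i, (l, i) \in H a ->
          poly_in (I a) (tau a l i) /\ deg_lt (tau a l i * lifting f l i) (2 * k))
      & p = \sum_(a < N) gram_poly (Q0 a)
        + (\sum_(a < N) \sum_(j in J a) gram_poly (Q a j) * univ (g j) j
        + \sum_(a < N) \sum_(li in H a) tau a li.1 li.2 * lifting f li.1 li.2)].

Lemma sos_certD k p q : sos_cert k p -> sos_cert k q -> sos_cert k (p + q).
Proof.
move=> [Q0 [Q [tau [H1 H2 H3 ->]]]] [Q0' [Q' [tau' [H1' H2' H3' ->]]]].
exists (fun a => Q0 a + Q0' a), (fun a j => Q a j + Q' a j), (fun a l i => tau a l i + tau' a l i).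
split=> [a|a j|a l i lia|]; [exact: psdD|exact: psdD| |].
  have [S1 d1] := H3 a l i lia; have [S2 d2] := H3' a l i lia.
  by split; [exact: poly_inD|rewrite mulrDl; exact: msizeD_max].
rewrite addrACA; congr (_ + _); last (rewrite addrACA; congr (_ + _)).
- by rewrite -big_split; apply: eq_bigr => a _; rewrite gram_polyD.
- rewrite -big_split; apply: eq_bigr => a _; rewrite -big_split.
  by apply: eq_bigr => j _; rewrite gram_polyD mulrDl.
- rewrite -big_split; apply: eq_bigr => a _; rewrite -big_split.
  by apply: eq_bigr => j _; rewrite mulrDl.
Qed.

Lemma big_only (T : finType) (S : nmodType) (Q : pred T) (x : T) (F : T -> S) :
  Q x -> (forall y, Q y -> y != x -> F y = 0) -> \sum_(y | Q y) F y = F x.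
Proof. by move=> Qx F0; rewrite (bigD1 x) //= big1 ?addr0 // => y /andP[/F0]. Qed.

Lemma deg_lt0 d : deg_lt (0 : P) d.
Proof. by rewrite /deg_lt mmeasure0. Qed.

(** A leaf fills a single slot, by the rank-one Gram matrix of the coefficients of [q] or by one
    multiplier [tau]; all other slots are 0. *)
Lemma cone_sos_cert p : M p -> exists k0, forall k, (k0 <= k)%N -> sos_cert k p.
Proof.
have sum0 (T : finType) (Q : pred T) (F : T -> P) :
  (forall x, F x = 0) -> \sum_(x | Q x) F x = 0 by move=> F0; rewrite big1.
elim=> [a q Sq|a j q ja Sq|a l i q lia Sq|q q' _ [k1 H1] _ [k2 H2]].
- exists (msize q) => k qk.
  exists (fun b => if b == a then coef_vec (I b) k q *m (coef_vec (I b) k q)^T else 0).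
  exists (fun _ _ => 0), (fun _ _ _ => 0); split=> [b|b j|b l i _|].
  + by case: eqP => _; [exact: psd_rank1|exact: psd0].
  + exact: psd0.
  + by rewrite mul0r deg_lt0; split=> //; exact: (poly_inC _ 0).
  rewrite (big_only (x := a)) // => [|b _ /negPf ->]; last exact: gram_poly0.
  rewrite eqxx gram_poly_rank1 coef_vecK ?(leqW qk) //.
  rewrite !sum0 ?addr0 // => x; rewrite sum0 // => y; last by rewrite gram_poly0 mul0r.
  by rewrite mul0r.
- exists (msize q + half_deg (g j))%N => k qk.
  exists (fun _ => 0), (fun b i => if (b == a) && (i == j) then
     coef_vec (I b) (k - half_deg (g i)) q *m (coef_vec (I b) (k - half_deg (g i)) q)^T else 0).
  exists (fun _ _ _ => 0); split=> [b|b i|b l i _|].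
  + exact: psd0.
  + by case: ifP => _; [exact: psd_rank1|exact: psd0].
  + by rewrite mul0r deg_lt0; split=> //; exact: (poly_inC _ 0).
  rewrite sum0 ?add0r => [|x]; last exact: gram_poly0.
  rewrite (big_only (x := a)) // => [|b _ /negPf ba]; last first.
    by rewrite sum0 // => i; rewrite ba gram_poly0 mul0r.
  rewrite (big_only (x := j)) // => [|i _ /negPf ij]; last by rewrite ij andbF gram_poly0 mul0r.
  rewrite !eqxx gram_poly_rank1 coef_vecK //; last first.
    by apply: leqW; rewrite leq_subRL ?(leq_trans _ qk) ?leq_addl // addnC.
  by rewrite sum0 ?addr0 // => b; rewrite sum0 // => li; rewrite mul0r.
- exists (msize (q * lifting f l i)) => k qk.
  exists (fun _ => 0), (fun _ _ => 0).
  exists (fun b l' i' => if (b == a) && ((l', i') == (l, i)) then q else 0).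
  split=> [b|b j|b l' i' _|]; [exact: psd0|exact: psd0| |].
    case: ifP => [/andP[/eqP -> /eqP[-> ->]]|_].
      by split=> //; apply: leq_trans qk _; rewrite leq_pmull.
    by rewrite mul0r deg_lt0; split=> //; exact: (poly_inC _ 0).
  rewrite sum0 ?add0r => [|x]; last exact: gram_poly0.
  rewrite sum0 ?add0r => [|x]; last by rewrite sum0 // => y; rewrite gram_poly0 mul0r.
  rewrite (big_only (x := a)) // => [|b _ /negPf ba]; last first.
    by rewrite sum0 // => li; rewrite ba mul0r.
  rewrite (big_only (x := (l, i))) // => [|li _ lin]; first by rewrite /= !eqxx.
  by rewrite -surjective_pairing (negPf lin) andbF mul0r.
- exists (maxn k1 k2) => k; rewrite geq_max => /andP[k1k k2k].
  by apply: sos_certD; [exact: H1|exact: H2].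
Qed.

Lemma sos_value_ge lam : M (\sum_a obj a - C lam) ->
  exists k0, forall k, (k0 <= k)%N -> (lam%:E <= sos_value f g I J H obj k)%E.
Proof.
move=> /cone_sos_cert[k0 Hk]; exists k0 => k k0k.
apply: ereal_sup_ubound; exists lam => //.
have [Q0 [Q [tau [H1 H2 H3 E]]]] := Hk k k0k.
exists Q0, Q, tau; split=> //; rewrite E; ring.
Qed.

Lemma sos_feasible_widen k k' lam : (k <= k')%N ->
  sos_feasible f g I J H obj k lam -> sos_feasible f g I J H obj k' lam.
Proof.
move=> kk' [Q0 [Q [tau [H1 H2 H3 E]]]].
(* The witnesses must be functions of all [a] and [j], even where [Q a j] is not known to be
   positive semidefinite; hence the implication inside the sigma type. *)
have widen m m' a (A : 'M[R]_#|{: bmon (I a) m}|) : (m <= m')%N ->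
    {B : 'M[R]_#|{: bmon (I a) m'}| | psd A -> psd B /\ gram_poly B = gram_poly A}.
  move=> mm'; apply: cid; case: (pselect (psd A)) => [pA|nA]; last by exists 0 => /nA.
  by have [B pB BE] := gram_poly_widen mm' pA; exists B.
have kj j : (k - half_deg (g j) <= k' - half_deg (g j))%N by rewrite leq_sub2r.
exists (fun a => sval (widen _ _ a (Q0 a) kk')).
exists (fun a j => sval (widen _ _ a (Q a j) (kj j))), tau.
split=> [a|a j ja|a l i lia|].
- by case: (widen _ _ _ _ _) => B /= HB; case: (HB (H1 a)).
- by case: (widen _ _ _ _ _) => B /= HB; case: (HB (H2 a j ja)).
- have [S1 d1] := H3 a l i lia; split=> //.
  by apply: leq_trans d1 _; rewrite leq_mul2l kk' orbT.
have -> : \sum_a gram_poly (sval (widen _ _ a (Q0 a) kk')) = \sum_a gram_poly (Q0 a).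
  by apply: eq_bigr => a _; case: (widen _ _ _ _ _) => B /= HB; case: (HB (H1 a)).
rewrite -E; congr (_ - _ - _); apply: eq_bigr => a _; apply: eq_bigr => j ja; congr (_ * _).
by case: (widen _ _ _ _ _) => B /= HB; case: (HB (H2 a j ja)).
Qed.

Lemma sos_value_nondecreasing k k' : (k <= k')%N ->
  (sos_value f g I J H obj k <= sos_value f g I J H obj k')%E.
Proof.
move=> kk'; apply/ereal_supP => _ [lam flam <-].
by apply: ereal_sup_ubound; exists lam => //; apply: sos_feasible_widen flam.
Qed.

Section Point.
Variable z : V -> R.
Hypothesis zg : forall j, 0 <= (g j).[z (xv r j)].
Hypothesis zh : forall l i, eval_at z (lifting f l i) = 0.

Lemma sos_value_le_point k : (sos_value f g I J H obj k <= (eval_at z (\sum_a obj a))%:E)%E.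
Proof.
apply/ereal_supP => _ [lam [Q0 [Q [tau [H1 H2 H3 E]]]] <-]; rewrite lee_fin -subr_ge0.
have -> : eval_at z (\sum_a obj a) - lam = eval_at z (\sum_(a < N) gram_poly (Q0 a))
   + eval_at z (\sum_(a < N) \sum_(j in J a) gram_poly (Q a j) * univ (g j) j)
   + eval_at z (\sum_(a < N) \sum_(li in H a) tau a li.1 li.2 * lifting f li.1 li.2).
  rewrite -E !eval_atB eval_atC; ring.
rewrite !eval_at_sum; apply: addr_ge0; first apply: addr_ge0.
- by apply: sumr_ge0 => a _; apply: eval_gram_ge0.
- apply: sumr_ge0 => a _; rewrite eval_at_sum; apply: sumr_ge0 => j ja.
  by rewrite eval_atM eval_at_univ; apply: mulr_ge0 => //; apply/eval_gram_ge0/H2.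
- apply: sumr_ge0 => a _; rewrite eval_at_sum; apply: sumr_ge0 => li _.
  by rewrite eval_atM zh mulr0.
Qed.

Lemma moment_value_le_point k : relaxation_order g k ->
  (moment_value f g I J H obj k <= (eval_at z (\sum_a obj a))%:E)%E.
Proof.
(* Moments of the Dirac measure at [z], whose functional is evaluation. *)
move=> hk; pose Y m := eval_at z (mpolyX R m).
have YE p : moment_fun Y p = eval_at z p by rewrite [RHS]eval_moment_fun.
apply: ereal_inf_lbound; exists (restr Y k); last first.
  by rewrite (restricted_value Sobj dobj) ?YE //; case: hk.
apply/(feasibleP f hJ hH Y hk); split.
- by move=> a p _ _; rewrite YE eval_atX sqr_ge0.
- by move=> a j p _ _ _; rewrite YE eval_atM eval_atX eval_at_univ mulr_ge0 // sqr_ge0.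
- by move=> a l i q _ _ _; rewrite YE eval_atM zh mulr0.
- by move=> _; rewrite -moment_fun1 YE; apply: (eval_atC z 1).
Qed.

End Point.
End RelaxationValues.

(** * The lifted problem *)

Section Lifting.
Variables (R : realType) (r n : nat) (hn : (0 < n)%N).
Local Notation V := (vertex r n).
Variables (f : 'I_r -> 'I_n -> {poly R}) (g : 'I_n -> {poly R}).

Lemma ord_predE (i : 'I_n) : (0 < i)%N -> nat_of_ord (ord_pred i) = i.-1.
Proof.
case: i => [[|m] mn] //= _; rewrite ?addSn /= modnDr modn_small //; exact: ltnW.
Qed.

Lemma prod_upto (F : 'I_n -> R) (i : 'I_n) : \prod_(j < n | (j <= i)%N) F j =
  (if i == 0%N :> nat then 1 else \prod_(j < n | (j <= ord_pred i)%N) F j) * F i.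
Proof.
rewrite (bigD1 i) // mulrC; congr (_ * _); case: eqP => [i0|/eqP i0].
  by rewrite big_pred0 // => j; rewrite i0 leqn0 -(inj_eq val_inj) /= i0 andbN.
apply: eq_bigl => j; rewrite ord_predE ?lt0n // -(inj_eq val_inj) /=.
by rewrite andbC -ltn_neqAle -[in RHS]ltnS prednK // lt0n.
Qed.

Lemma eval_lifting (z : V -> R) l i : eval_at z (lifting f l i) = z (tv l i) -
  (if i == 0%N :> nat then 1 else z (tv l (ord_pred i))) * (f l i).[z (xv r i)].
Proof.
rewrite /lifting; case: ifP => _; rewrite eval_atB ?eval_atM !eval_at_var eval_at_univ //.
by rewrite mul1r.
Qed.

(** The equations are triangular in t, so x determines t as partial products. *)
Lemma lifting_solutionE (z : V -> R) :
  (forall l i, eval_at z (lifting f l i) = 0) <->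
  (forall l i, z (tv l i) = \prod_(j < n | (j <= i)%N) (f l j).[z (xv r j)]).
Proof.
split=> zE l i; last by rewrite eval_lifting zE prod_upto zE subrr.
have [m im] : exists m, nat_of_ord i = m by exists i.
elim: m i im => [|m IH] i im; have := zE l i; rewrite eval_lifting => /subr0_eq ->;
  rewrite prod_upto im //=; rewrite IH // ord_predE im //.
Qed.

Lemma lifting_objective (z : V -> R) : (forall l i, eval_at z (lifting f l i) = 0) ->
  \sum_l z (tv l (ord_last hn)) = separable_fun f (\row_j z (xv r j)).
Proof.
move=> /lifting_solutionE zE; apply: eq_bigr => l _; rewrite zE.
apply: eq_big => [j|j _]; last by rewrite mxE.
by rewrite /= -ltnS prednK // ltn_ord.
Qed.

Definition lift_point (x : 'rV[R]_n) (t : 'M[R]_(r, n)) (v : V) : R :=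
  match v with inl j => x 0 j | inr (l, j) => t l j end.

Lemma eval_lifted_point x t p : meval (lifted_point x t) p = eval_at (lift_point x t) p.
Proof. by []. Qed.

Definition product_lift (x : 'rV[R]_n) : 'M[R]_(r, n) :=
  \matrix_(l, i) \prod_(j < n | (j <= i)%N) (f l j).[x 0 j].

Lemma product_lift_lifting x l i : eval_at (lift_point x (product_lift x)) (lifting f l i) = 0.
Proof.
move: l i; apply/lifting_solutionE => l i.
by rewrite [LHS]mxE.
Qed.

Lemma product_lift_objective x :
  \sum_l product_lift x l (ord_last hn) = separable_fun f x.
Proof.
have := @lifting_objective (lift_point x (product_lift x)) (product_lift_lifting x).
move=> /= ->; congr separable_fun; apply/rowP => j; by rewrite mxE.
Qed.

Lemma opt_value_lifted : opt_value f g = lifted_opt_value f g hn.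
Proof.
rewrite /opt_value /lifted_opt_value; congr ereal_inf; apply/seteqP; split=> y.
  move=> [x /= gx <-]; exists (x, product_lift x).
    by split=> // l i; rewrite eval_lifted_point product_lift_lifting.
  exact: (congr1 EFin (product_lift_objective x)).
move=> [[x t] /= [h0 gx] <-]; exists x => //.
have /= -> := @lifting_objective (lift_point x t) h0.
by congr (separable_fun _ _)%:E; apply/rowP => j; rewrite mxE.
Qed.

End Lifting.

Theorem theorem3p2 (R : realType) (n r : nat) (hn : (0 < n)%N) (hr : (0 < r)%N)
  (f : 'I_r -> 'I_n -> {poly R}) (g : 'I_n -> {poly R})
  (E : rel (vertex r n)) (hE : chordal_extension constraint_graph E)
  (N : nat) (I : 'I_N -> {set vertex r n}) (hI : enumerates_maximal_cliques E I)
  (xa : 'I_n -> 'I_N) (hxa : forall j, xv r j \in I (xa j))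
  (ha : 'I_r * 'I_n -> 'I_N)
  (hha : forall l i, constraint_vars l i \subset I (ha (l, i)))
  (ta : 'I_r -> 'I_N) (hta : forall l, tv l (ord_last hn) \in I (ta l))
  (rho : R) (q : 'I_N -> mpoly #|vertex r n| R)
  (hq : forall a, poly_in (I a) (q a) /\
                  quadratic_module g (I a) (assigned_to xa a) (q a))
  (hball : mpolyC #|vertex r n| (rho ^+ 2) - \sum_(j < n) var (xv r j) ^+ 2
           = \sum_(a < N) q a) :
  let J := assigned_to xa in
  let H := assigned_to ha in
  let obj := fun a : 'I_N => \sum_(l in assigned_to ta a) var (tv l (ord_last hn)) in
  let pstar := opt_value f g in
  let p := fun k => moment_value f g I J H obj k in
  let lambda := fun k => sos_value f g I J H obj k in
  [/\ pstar = lifted_opt_value f g hn,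
      (forall k k', relaxation_order g k -> relaxation_order g k' -> (k <= k')%N ->
         (p k <= p k')%E),
      (forall k k', relaxation_order g k -> relaxation_order g k' -> (k <= k')%N ->
         (lambda k <= lambda k')%E),
      (p k @[k --> \oo] --> pstar)%classic
    & (lambda k @[k --> \oo] --> pstar)%classic].
Proof.
move=> J H obj pstar p lambda.
have N0 : (0 < N)%N by apply: leq_ltn_trans (ltn_ord (xa (ord_last hn))).
have hJ a j : j \in J a -> xv r j \in I a by rewrite inE => /eqP <-.
have hH a l i : (l, i) \in H a -> constraint_vars l i \subset I a by rewrite inE => /eqP <-.
have Sobj a : poly_in (I a) (obj a).
  by apply: poly_in_sum => l; rewrite inE => /eqP <-; apply: poly_in_var.
have dobj a : (msize (obj a) <= 2)%N by apply: msize_sum_le => l _; rewrite msize_var.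
have objE : \sum_a obj a = \sum_l var (tv l (ord_last hn)) by apply: sum_assigned.
(* The successor ensures [1 <= k] even if every half degree is 0. *)
pose k0 := (\max_j half_deg (g j)).+1.
have rel k : (k0 <= k)%N -> relaxation_order g k.
  move=> hk; split=> [|j]; first exact: leq_trans hk.
  by apply: leq_trans (ltnW hk); apply: (@leq_bigmax _ (fun j => half_deg (g j))).
have mono_p k k' : relaxation_order g k -> relaxation_order g k' -> (k <= k')%N ->
    (p k <= p k')%E by apply: moment_value_nondecreasing.
have mono_l k k' : (k <= k')%N -> (lambda k <= lambda k')%E by apply: sos_value_nondecreasing.
(* If the problem is infeasible, [pstar] is +oo and every real [lam] qualifies. *)
have cone lam : (lam%:E < pstar)%E ->
    sparse_cone f g I J H (\sum_a obj a - mpolyC _ lam).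
  move=> lamp; rewrite objE.
  apply: (objective_in_cone hE hI hxa hha hta hq hball) => z zg zh.
  rewrite (lifting_objective hn zh) -lte_fin; apply: (lt_le_trans lamp).
  apply: ereal_inf_lbound; exists (\row_j z (xv r j)) => //= j.
  by rewrite mxE.
have val x : eval_at (lift_point x (product_lift f x)) (\sum_a obj a) = separable_fun f x.
  rewrite objE eval_at_sum -(product_lift_objective hn f x).
  by apply: eq_bigr => l _; rewrite eval_at_var.
split.
- exact: opt_value_lifted.
- exact: mono_p.
- by move=> k k' _ _; apply: mono_l.
- apply: (cvg_nondecreasing_from (k0 := k0)).
  + by move=> k k' hk hkk'; apply: mono_p => //; apply: rel => //; apply: leq_trans hkk'.
  + move=> k /rel hk; apply/ereal_infP => _ [x gx <-]; rewrite -val.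
    by apply: moment_value_le_point => //; apply: product_lift_lifting.
  + move=> lam /cone /(moment_value_ge hJ hH Sobj dobj N0)[k1 Hk]; exists (maxn k0 k1) => k.
    by rewrite geq_max => /andP[/rel hk hk1]; apply: Hk.
(* With truncated subtraction in [k - half_deg (g j)], monotonicity and the bound by feasible points
   hold for the sum-of-squares values at every [k]. *)
- apply: (cvg_nondecreasing_from (k0 := 0)).
  + by move=> k k' _; apply: mono_l.
  + move=> k _; apply/ereal_infP => _ [x gx <-]; rewrite -val.
    by apply: sos_value_le_point => //; apply: product_lift_lifting.
  + by move=> lam /cone /sos_value_ge.
Qed.
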